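(* Let $a \in C^2(\mathbb{R}_+ \times \mathbb{R}_+)$ be a given function and let $c>0$, $\mu \ge 0$ be given constants. Let $g \in C^1(\mathbb{R}_+ \times \mathbb{R})$ be a given function for which there exists a constant $v_{\max}>0$ such that $$0 < g(0,w) \le g(v,w) \le v_{\max}, \quad \text{for all } v \in \mathbb{R}_+,\ w \in \mathbb{R}.$$ Let $\theta,\varphi \in W^{2,\infty}([0,1])$ be given functions with $\varphi(x)>0$ for all $x\in[0,1]$, for which the following equalities hold: $$\theta(0) = a(0,\varphi(0)), \qquad \frac{\partial a}{\partial t}(0,\varphi(0)) + c\,\frac{\partial a}{\partial v}(0,\varphi(0))\,\varphi'(0) = -\varphi(0)\,\theta'(0),$$ $$\varphi'(1) = -\mu c^{-1}\big(\varphi(1) - g(\varphi(1),\theta(1))\big).$$ Then the initial-boundary value problem $$\frac{\partial w}{\partial t}(t,x) + v(t,x)\frac{\partial w}{\partial x}(t,x) = \frac{\partial v}{\partial t}(t,x) - c\,\frac{\partial v}{\partial x}(t,x) = 0, \quad \text{for all } (t,x)\in \mathbb{R}_+\times[0,1],$$ $$w(t,0) - a(t,v(t,0)) = \frac{\partial v}{\partial t}(t,1) + \mu\big(v(t,1) - g(v(t,1),w(t,1))\big) = 0, \quad \text{for all } t \ge 0,$$ $$w(0,x) - \theta(x) = v(0,x) - \varphi(x) = 0, \quad \text{for all } x \in [0,1],$$ admits a unique solution $w,v \in C^1(\mathbb{R}_+\times[0,1])$. Moreover, the solution $w,v$ has Lipschitz derivatives on every compact $S \subset \mathbb{R}_+\times[0,1]$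 and satisfies the following inequalities for all $(t,x)\in\mathbb{R}_+\times[0,1]$: $$\|w[t]\|_\infty \le \max\big(B_t, \|\theta\|_\infty\big),$$ $$\min\Big(\min_{0\le x\le 1}(\varphi(x)),\ \min\{g(0,w): |w| \le \max(B_t,\|\theta\|_\infty)\}\Big) \le v(t,x) \le \max\Big(\max_{0\le x\le 1}(\varphi(x)),\ v_{\max}\Big),$$ where $$B_t := \max\Big\{|a(s,v)| : s\in[0,t],\ 0\le v\le \max\big(\max_{0\le x\le 1}(\varphi(x)), v_{\max}\big)\Big\}.$$
   Context: $\mathbb{R}_+ := [0,+\infty)$. The function $a$ has arguments denoted $(t,v)$ and $g$ has arguments denoted $(v,w)$. For a set $U$ with non-empty interior, $C^k(U)$ is the class of real-valued continuous functions on $U$ with continuous derivatives of order $k$ on $U$. $W^{2,\infty}([0,1])$ is the space of $C^1$ functions on $[0,1]$ with Lipschitz derivative. For $w:\mathbb{R}_+\times[0,1]\to\mathbb{R}$, $w[t]$ denotes the profile at time $t$, i.e. $(w[t])(x)=w(t,x)$ for $x\in[0,1]$; for a bounded function $w:[0,1]\to\mathbb{R}$, $\|w\|_\infty := \sup_{0\le x\le 1}|w(x)|$. Since $a$ and $g$ are defined only for nonnegative values of the argument $v$, being a solution of the problem includes that $v(t,0)\ge 0$ and $v(t,1)\ge 0$, so that the boundary conditions make sense. *)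

(* Defs.v *)
From Stdlib Require Export Reals List.
From Coquelicot Require Export Coquelicot.

Open Scope R_scope.

(* Functions are total on R (or R x R), but only their restriction to the set
   under consideration matters; at boundary points the derivatives are
   one-sided. *)

Definition is_derive_on (D : R -> Prop) (f : R -> R) (x l : R) : Prop :=
  filterdiff f (within D (locally x)) (fun h : R => scal h l).

Definition ex_derive_on (D : R -> Prop) (f : R -> R) (x : R) : Prop :=
  exists l, is_derive_on D f x l.

(* Like [Derive], meaningful only where [ex_derive_on] holds and [x] is not
   isolated in [D]. *)
Definition Derive_on (D : R -> Prop) (f : R -> R) (x : R) : R :=
  iota (is_derive_on D f x).

Definition ex_partial1 (U : R * R -> Prop) (f : R -> R -> R) (p : R * R) : Prop :=
  ex_derive_on (fun s => U (s, snd p)) (fun s => f s (snd p)) (fst p).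

Definition ex_partial2 (U : R * R -> Prop) (f : R -> R -> R) (p : R * R) : Prop :=
  ex_derive_on (fun y => U (fst p, y)) (fun y => f (fst p) y) (snd p).

Definition partial1 (U : R * R -> Prop) (f : R -> R -> R) (t x : R) : R :=
  Derive_on (fun s => U (s, x)) (fun s => f s x) t.

Definition partial2 (U : R * R -> Prop) (f : R -> R -> R) (t x : R) : R :=
  Derive_on (fun y => U (t, y)) (fun y => f t y) x.

Definition uncurry2 (f : R -> R -> R) (p : R * R) : R := f (fst p) (snd p).

Fixpoint Ck (k : nat) (U : R * R -> Prop) (f : R -> R -> R) : Prop :=
  continuous_on U (uncurry2 f) /\
  match k with
  | O => True
  | S k' =>
      (forall p, U p -> ex_partial1 U f p /\ ex_partial2 U f p) /\
      Ck k' U (partial1 U f) /\ Ck k' U (partial2 U f)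
  end.

Definition lipschitz_on {V : NormedModule R_AbsRing} (D : V -> Prop) (f : V -> R) : Prop :=
  exists L : R, forall p q : V, D p -> D q ->
    Rabs (f p - f q) <= L * norm (minus p q).

Definition compact_set {T : UniformSpace} (K : T -> Prop) : Prop :=
  forall (I : Type) (O : I -> T -> Prop),
    (forall i, open (O i)) ->
    (forall p, K p -> exists i, O i p) ->
    exists l : list I, forall p, K p -> exists i, In i l /\ O i p.

Definition is_max (E : R -> Prop) (m : R) : Prop := E m /\ forall y, E y -> y <= m.
Definition is_min (E : R -> Prop) (m : R) : Prop := E m /\ forall y, E y -> m <= y.

(* Unspecified when [E] has no greatest (resp. least) element. *)
Definition set_max (E : R -> Prop) : R := iota (is_max E).
Definition set_min (E : R -> Prop) : R := iota (is_min E).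

Definition unit_itv (x : R) : Prop := 0 <= x <= 1.

(* Meaningful for functions that are bounded on [0,1]. *)
Definition sup_norm (f : R -> R) : R :=
  real (Lub_Rbar (fun y => exists x, unit_itv x /\ y = Rabs (f x))).

Definition max01 (f : R -> R) : R :=
  set_max (fun y => exists x, unit_itv x /\ y = f x).

Definition min01 (f : R -> R) : R :=
  set_min (fun y => exists x, unit_itv x /\ y = f x).

Definition W2inf (f : R -> R) : Prop :=
  (forall x, unit_itv x -> ex_derive_on unit_itv f x) /\
  continuous_on unit_itv (Derive_on unit_itv f) /\
  lipschitz_on unit_itv (Derive_on unit_itv f).

Definition strip (p : R * R) : Prop := 0 <= fst p /\ 0 <= snd p <= 1.

Definition dom_a (p : R * R) : Prop := 0 <= fst p /\ 0 <= snd p.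

Definition dom_g (p : R * R) : Prop := 0 <= fst p.

(* [a] and [g] are only given for nonnegative values of [v], hence the sign
   conditions at the two boundary points. *)
Definition is_solution (a g : R -> R -> R) (c mu : R) (theta phi : R -> R)
    (w v : R -> R -> R) : Prop :=
  Ck 1 strip w /\ Ck 1 strip v /\
  (forall t, 0 <= t -> 0 <= v t 0 /\ 0 <= v t 1) /\
  (forall t x, 0 <= t -> 0 <= x <= 1 ->
     partial1 strip w t x + v t x * partial2 strip w t x = 0 /\
     partial1 strip v t x - c * partial2 strip v t x = 0) /\
  (forall t, 0 <= t ->
     w t 0 - a t (v t 0) = 0 /\
     partial1 strip v t 1 + mu * (v t 1 - g (v t 1) (w t 1)) = 0) /\
  (forall x, 0 <= x <= 1 ->
     w 0 x - theta x = 0 /\ v 0 x - phi x = 0).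

Definition B_bound (a : R -> R -> R) (phi : R -> R) (vmax t : R) : R :=
  set_max (fun y => exists s v,
    0 <= s <= t /\ 0 <= v <= Rmax (max01 phi) vmax /\ y = Rabs (a s v)).

(* Main.v *)
Require Import Defs.
From Stdlib Require Import Reals Lra Lia ClassicalEpsilon.
From Coquelicot Require Import Coquelicot.
Open Scope R_scope.

(* Write [v t x = q (t + x / c)]: the wave [v] is determined by its values on [x = 1], and
   the characteristics of [w], parametrized by [s = t + x / c], satisfy
   [d (x / c) / d s = q s / (c + q s)].  Hence the level [Sig (t + x / c) - x / c], with [Sig] the
   primitive of [q / (c + q)], is constant along them, [w t x] is the datum ([theta] or
   [a t (v t 0)]) carried by the foot of the characteristic, and the foot is obtained by
   inverting one increasing function.  The problem becomes the fixed-point equation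
   [u t = e^(-mu t) (u 0 + int_0^t mu e^(mu s) g (u s) (w s 1) ds)] for [u t = v t 1], where [w s 1]
   depends causally and Lipschitz-continuously on [u]; this form preserves the bounds
   [phi 1 e^(-mu t) <= u t <= M].  Picard iteration gives existence and uniqueness, and the
   compatibility conditions say exactly that [q] and the datum are C^1 where they are glued. *)

(** * Bounded Lipschitz functions *)

(** The speed of [w] is the unknown [v], so comparing the [w] of two different [v] would ordinarily
    cost a bound on the derivatives of [w]. Carrying the datum along explicit level lines avoids
    this: only Lipschitz constants of [theta], [a] and [phi] enter, together with a positive lower
    bound on the slope of the function that is inverted. That slope bound needs [u] bounded away
    from 0 on each [0, T], which is why [phi 1 e^(-mu t)] is kept as a lower bound. The sharper
    lower bound of the theorem depends on [B_t], hence on [w], and is recovered only for the fixed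
    point. Causality permits a norm weighted in time, so existence is global at once, without
    continuation.

    Derivatives on the edges of the strip are one-sided. To use ordinary calculus, functions of one
    variable are extended past their intervals, by clamping where Lipschitz continuity suffices and
    by C^1 extensions where derivatives are taken. Continuity of the derivatives and their Lipschitz
    bounds both come from one closure calculus of bounded Lipschitz functions. *)

Definition BL {X : Type} (D : X -> Prop) (dist : X -> X -> R) (f : X -> R) : Prop :=
  exists B, 0 <= B /\ forall x, D x -> Rabs (f x) <= B /\
    forall y, D y -> Rabs (f x - f y) <= B * dist x y.

Definition dR (x y : R) : R := Rabs (x - y).
Definition dRR (p q : R * R) : R := Rabs (fst p - fst q) + Rabs (snd p - snd q).

Definition seg (a b x : R) : Prop := a <= x <= b.
Definition rect (a b a' b' : R) (p : R * R) : Prop :=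
  a <= fst p <= b /\ a' <= snd p <= b'.

Lemma dR_ge0 x y : 0 <= dR x y.
Proof. apply Rabs_pos. Qed.

Lemma dRR_ge0 p q : 0 <= dRR p q.
Proof. unfold dRR. pose proof (Rabs_pos (fst p - fst q)). pose proof (Rabs_pos (snd p - snd q)). lra. Qed.

#[export] Hint Resolve dR_ge0 dRR_ge0 : core.

Section BL_closure.
Context {X : Type} (D : X -> Prop) (dist : X -> X -> R).
Hypothesis dist_ge0 : forall x y, 0 <= dist x y.

Lemma BL_ext f g : (forall x, D x -> f x = g x) -> BL D dist f -> BL D dist g.
Proof.
  intros E [B [HB H]]. exists B. split; [exact HB|]. intros x Dx.
  rewrite <- (E x Dx). destruct (H x Dx) as [H1 H2]. split; [exact H1|].
  intros y Dy. rewrite <- (E y Dy). auto.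
Qed.

Lemma BL_const k : BL D dist (fun _ => k).
Proof.
  exists (Rabs k). split; [apply Rabs_pos|]. intros x _. split; [lra|].
  intros y _. rewrite Rminus_diag, Rabs_R0. apply Rmult_le_pos; [apply Rabs_pos|auto].
Qed.

Lemma BL_plus f g : BL D dist f -> BL D dist g -> BL D dist (fun x => f x + g x).
Proof.
  intros [A [HA H]] [B [HB H']]. exists (A + B). split; [lra|]. intros x Dx.
  destruct (H x Dx) as [H1 H2]. destruct (H' x Dx) as [H3 H4]. split.
  - eapply Rle_trans; [apply Rabs_triang|lra].
  - intros y Dy. replace (f x + g x - (f y + g y)) with ((f x - f y) + (g x - g y)) by ring.
    eapply Rle_trans; [apply Rabs_triang|].
    specialize (H2 y Dy). specialize (H4 y Dy). lra.
Qed.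

(** A product of Lipschitz functions is Lipschitz only if the factors are bounded; this is why [BL]
    keeps a bound and a Lipschitz constant together in one [B]. *)
Lemma BL_mult f g : BL D dist f -> BL D dist g -> BL D dist (fun x => f x * g x).
Proof.
  intros [A [HA H]] [B [HB H']]. exists (A * B + A * B).
  assert (HAB : 0 <= A * B) by (apply Rmult_le_pos; assumption). split; [lra|]. intros x Dx.
  destruct (H x Dx) as [H1 H2]. destruct (H' x Dx) as [H3 H4]. split.
  - rewrite Rabs_mult. apply Rle_trans with (A * B); [|lra].
    apply Rmult_le_compat; auto using Rabs_pos.
  - intros y Dy. replace (f x * g x - f y * g y) with (f x * (g x - g y) + (f x - f y) * g y) by ring.
    eapply Rle_trans; [apply Rabs_triang|]. rewrite !Rabs_mult.
    specialize (H2 y Dy). specialize (H4 y Dy). destruct (H' y Dy) as [H5 _].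
    replace ((A * B + A * B) * dist x y) with (A * (B * dist x y) + (A * dist x y) * B) by ring.
    apply Rplus_le_compat; apply Rmult_le_compat; auto using Rabs_pos.
Qed.

Lemma BL_opp f : BL D dist f -> BL D dist (fun x => - f x).
Proof.
  intros H. apply BL_ext with (fun x => -1 * f x); [intros; ring|].
  apply BL_mult; [apply BL_const|exact H].
Qed.

Lemma BL_minus f g : BL D dist f -> BL D dist g -> BL D dist (fun x => f x - g x).
Proof. intros. apply BL_plus; [|apply BL_opp]; assumption. Qed.

Lemma BL_inv f m : 0 < m -> (forall x, D x -> m <= f x) -> BL D dist f ->
  BL D dist (fun x => / f x).
Proof.
  intros Hm Hf [B [HB H]]. exists (/ m + B * (/ m * / m)).
  assert (Im : 0 < / m) by (apply Rinv_0_lt_compat; exact Hm).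
  assert (HBm : 0 <= B * (/ m * / m)) by (apply Rmult_le_pos; nra).
  split; [lra|]. intros x Dx. destruct (H x Dx) as [H1 H2]. pose proof (Hf x Dx).
  assert (Ix : 0 < / f x <= / m).
  { split; [apply Rinv_0_lt_compat; lra|apply Rinv_le_contravar; lra]. }
  split; [rewrite Rabs_pos_eq; lra|].
  intros y Dy. specialize (H2 y Dy). pose proof (Hf y Dy).
  assert (Iy : 0 < / f y <= / m).
  { split; [apply Rinv_0_lt_compat; lra|apply Rinv_le_contravar; lra]. }
  replace (/ f x - / f y) with (- (f x - f y) * (/ f x * / f y)) by (field; lra).
  rewrite Rabs_mult, Rabs_Ropp, (Rabs_pos_eq (/ f x * / f y)) by nra.
  apply Rle_trans with (B * dist x y * (/ m * / m)).
  - apply Rmult_le_compat; auto using Rabs_pos; nra.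
  - pose proof (Rmult_le_pos (/ m) (dist x y) ltac:(lra) (dist_ge0 x y)). lra.
Qed.

Lemma BL_div f g m : 0 < m -> (forall x, D x -> m <= g x) -> BL D dist f -> BL D dist g ->
  BL D dist (fun x => f x / g x).
Proof. intros. apply BL_mult; [assumption|]. eapply BL_inv; eassumption. Qed.

Lemma BL_comp (h : R -> R) f a b : BL (seg a b) dR h -> (forall x, D x -> a <= f x <= b) ->
  BL D dist f -> BL D dist (fun x => h (f x)).
Proof.
  intros [A [HA H]] Hf [B [HB H']]. exists (A + A * B).
  assert (HAB : 0 <= A * B) by (apply Rmult_le_pos; assumption). split; [lra|]. intros x Dx.
  destruct (H (f x) (Hf x Dx)) as [H1 H2]. split; [lra|]. intros y Dy.
  specialize (H2 (f y) (Hf y Dy)). destruct (H' x Dx) as [_ H3]. specialize (H3 y Dy).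
  unfold dR in H2. pose proof (dist_ge0 x y).
  apply Rle_trans with (A * (B * dist x y)); [|nra].
  eapply Rle_trans; [exact H2|]. apply Rmult_le_compat_l; assumption.
Qed.

Lemma BL_comp2 (h : R -> R -> R) f g a b a' b' :
  BL (rect a b a' b') dRR (uncurry2 h) ->
  (forall x, D x -> a <= f x <= b) -> (forall x, D x -> a' <= g x <= b') ->
  BL D dist f -> BL D dist g -> BL D dist (fun x => h (f x) (g x)).
Proof.
  intros [A [HA H]] Hf Hg [B [HB H']] [C [HC H'']]. exists (A + A * (B + C)).
  assert (HABC : 0 <= A * (B + C)) by (apply Rmult_le_pos; lra). split; [lra|]. intros x Dx.
  destruct (H (f x, g x) (conj (Hf x Dx) (Hg x Dx))) as [H1 H2].
  unfold uncurry2 in *; simpl in *. split; [lra|]. intros y Dy.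
  specialize (H2 (f y, g y) (conj (Hf y Dy) (Hg y Dy))).
  destruct (H' x Dx) as [_ H3]. specialize (H3 y Dy).
  destruct (H'' x Dx) as [_ H4]. specialize (H4 y Dy).
  unfold dRR in H2; simpl in H2. pose proof (dist_ge0 x y).
  apply Rle_trans with (A * ((B + C) * dist x y)); [|nra].
  eapply Rle_trans; [exact H2|]. apply Rmult_le_compat_l; lra.
Qed.

Lemma BL_subset (D' : X -> Prop) f : (forall x, D' x -> D x) -> BL D dist f -> BL D' dist f.
Proof.
  intros S [B [HB H]]. exists B. split; [exact HB|]. intros x Dx.
  destruct (H x (S x Dx)) as [H1 H2]. split; auto.
Qed.

End BL_closure.

Lemma BL_seg_id a b : BL (seg a b) dR (fun x => x).
Proof.
  exists (1 + Rabs a + Rabs b). pose proof (Rabs_pos a). pose proof (Rabs_pos b).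
  split; [lra|]. intros x [H1 H2]. split.
  - pose proof (Rle_abs b). pose proof (Rle_abs (- a)) as HA. rewrite Rabs_Ropp in HA.
    apply Rabs_le. lra.
  - intros y _. unfold dR. pose proof (Rabs_pos (x - y)). nra.
Qed.

Lemma BL_fst a b a' b' : BL (rect a b a' b') dRR fst.
Proof.
  destruct (BL_seg_id a b) as [B [HB H]]. exists B. split; [exact HB|].
  intros x [Hx _]. destruct (H (fst x) Hx) as [H1 H2]. split; [exact H1|].
  intros y [Hy _]. specialize (H2 _ Hy). unfold dR, dRR in *.
  pose proof (Rabs_pos (snd x - snd y)). nra.
Qed.

Lemma BL_snd a b a' b' : BL (rect a b a' b') dRR snd.
Proof.
  destruct (BL_seg_id a' b') as [B [HB H]]. exists B. split; [exact HB|].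
  intros x [_ Hx]. destruct (H (snd x) Hx) as [H1 H2]. split; [exact H1|].
  intros y [_ Hy]. specialize (H2 _ Hy). unfold dR, dRR in *.
  pose proof (Rabs_pos (fst x - fst y)). nra.
Qed.

Definition locBL (f : R -> R) : Prop := forall a b, BL (seg a b) dR f.

Lemma locBL_comp h f : locBL h -> locBL f -> locBL (fun x => h (f x)).
Proof.
  intros Hh Hf a b. destruct (Hf a b) as [B [HB H]].
  apply BL_comp with (- B) B; auto.
  intros x Hx. apply Rabs_le_between. apply H, Hx.
Qed.

Lemma locBL_Lip f L : (forall x y, Rabs (f x - f y) <= L * Rabs (x - y)) -> locBL f.
Proof.
  intros H a b. exists (Rabs L * (1 + Rabs (b - a)) + Rabs (f a)).
  pose proof (Rabs_pos L). pose proof (Rabs_pos (b - a)). pose proof (Rabs_pos (f a)).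
  pose proof (Rle_abs L).
  assert (HP : 0 <= Rabs L * Rabs (b - a)) by (apply Rmult_le_pos; assumption).
  assert (HB : 0 <= Rabs L * (1 + Rabs (b - a)) + Rabs (f a)) by lra.
  split; [exact HB|]. intros x [H4 H5]. split.
  - replace (f x) with ((f x - f a) + f a) by ring. eapply Rle_trans; [apply Rabs_triang|].
    pose proof (H x a) as H6. rewrite (Rabs_pos_eq (x - a)) in H6 by lra.
    rewrite (Rabs_pos_eq (b - a)) by lra.
    assert (L * (x - a) <= Rabs L * (b - a)) by (apply Rle_trans with (Rabs L * (x - a));
      [apply Rmult_le_compat_r|apply Rmult_le_compat_l]; lra).
    lra.
  - intros y _. unfold dR. eapply Rle_trans; [apply H|].
    apply Rmult_le_compat_r; [apply Rabs_pos|lra].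
Qed.

Lemma locBL_continuous f : locBL f -> forall x, continuous f x.
Proof.
  intros H x. destruct (H (x - 1) (x + 1)) as [B [HB HL]].
  apply continuity_pt_filterlim. intros eps Heps.
  exists (Rmin 1 (eps / (B + 1))). split.
  - apply Rmin_glb_lt; [lra|]. apply Rdiv_lt_0_compat; lra.
  - intros y [_ Hy]. simpl in *. unfold Rdist in *.
    pose proof (Rmin_l 1 (eps / (B + 1))). pose proof (Rmin_r 1 (eps / (B + 1))).
    assert (Hy1 : Rabs (y - x) < 1) by lra.
    apply Rabs_lt_between in Hy1.
    destruct (HL y ltac:(unfold seg; lra)) as [_ HL2].
    specialize (HL2 x ltac:(unfold seg; lra)). unfold dR in HL2.
    assert (Hy2 : Rabs (y - x) < eps / (B + 1)) by lra.
    apply Rmult_lt_compat_r with (r := B + 1) in Hy2; [|lra].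
    unfold Rdiv in Hy2. rewrite Rmult_assoc, Rinv_l, Rmult_1_r in Hy2 by lra.
    pose proof (Rabs_pos (y - x)). nra.
Qed.

(** * Clamping to an interval *)

Definition clamp (a b x : R) : R := Rmax a (Rmin b x).

Lemma clamp_in a b x : a <= b -> a <= clamp a b x <= b.
Proof. intros. unfold clamp, Rmax, Rmin. repeat destruct Rle_dec; lra. Qed.

Lemma clamp_id a b x : a <= x <= b -> clamp a b x = x.
Proof. intros. unfold clamp, Rmax, Rmin. repeat destruct Rle_dec; lra. Qed.

Lemma clamp_lip a b x y : Rabs (clamp a b x - clamp a b y) <= Rabs (x - y).
Proof.
  unfold clamp, Rmax, Rmin, Rabs. repeat destruct Rle_dec; repeat destruct Rcase_abs; lra.
Qed.

Lemma Rmax_lip a x y : Rabs (Rmax a x - Rmax a y) <= Rabs (x - y).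
Proof.
  unfold Rmax, Rabs. repeat destruct Rle_dec; repeat destruct Rcase_abs; lra.
Qed.

Lemma Rmin_lip a x y : Rabs (Rmin a x - Rmin a y) <= Rabs (x - y).
Proof.
  unfold Rmin, Rabs. repeat destruct Rle_dec; repeat destruct Rcase_abs; lra.
Qed.

Lemma continuous_Lip1 (f : R -> R) : (forall x y, Rabs (f x - f y) <= Rabs (x - y)) ->
  forall x, continuous f x.
Proof.
  intros H. apply locBL_continuous, locBL_Lip with 1. intros. rewrite Rmult_1_l. auto.
Qed.

Lemma continuous_clamp a b x : continuous (clamp a b) x.
Proof. apply continuous_Lip1, clamp_lip. Qed.

(** * One-sided derivatives and mean values *)

Lemma is_derive_on_eps (D : R -> Prop) (f : R -> R) x l : D x ->
  (is_derive_on D f x l <->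
   forall eps, 0 < eps -> exists del, 0 < del /\
     forall y, D y -> Rabs (y - x) < del -> Rabs (f y - f x - (y - x) * l) <= eps * Rabs (y - x)).
Proof.
  intros Dx. split.
  - intros [_ H] eps Heps.
    destruct (H x (fun P HP => filter_le_within _ _ HP) (mkposreal eps Heps)) as [del Hd].
    exists del. split; [apply cond_pos|]. intros y Dy Hy. exact (Hd y Hy Dy).
  - intros H. split; [exact (@is_linear_scal_l R_AbsRing R_NormedModule l)|]. intros z Hz.
    (* [filterdiff] quantifies over every limit [z] of the filter. As [x] itself lies in [D], each
       neighbourhood of [z] must contain [x], which forces [z = x]. *)
    assert (z = x) as ->.
    { apply Rminus_diag_uniq. destruct (Req_dec (z - x) 0) as [E|E]; [exact E|exfalso].
      pose proof (Rabs_pos_lt _ E) as Hp.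
      destruct (Hz (ball z (mkposreal _ Hp)) (locally_ball _ _)) as [del Hd].
      specialize (Hd x (ball_center _ _) Dx).
      change (Rabs (x - z) < Rabs (z - x)) in Hd. rewrite Rabs_minus_sym in Hd. lra. }
    intros eps. destruct (H eps (cond_pos eps)) as [del [Hdel Hd]].
    exists (mkposreal del Hdel). intros y Hy Dy. exact (Hd y Dy Hy).
Qed.

Lemma is_derive_is_derive_on (D : R -> Prop) f x l : D x ->
  is_derive f x l -> is_derive_on D f x l.
Proof.
  intros Dx [Hl H]. apply is_derive_on_eps; [exact Dx|]. intros eps Heps.
  destruct (H x (fun P HP => HP) (mkposreal eps Heps)) as [del Hd].
  exists del. split; [apply cond_pos|]. intros y _ Hy. exact (Hd y Hy).
Qed.

Lemma is_derive_on_is_derive (D : R -> Prop) f x l : locally x D ->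
  is_derive_on D f x l -> is_derive f x l.
Proof.
  intros [r Hr] H. assert (Dx : D x) by (apply Hr, ball_center).
  rewrite is_derive_on_eps in H by exact Dx.
  split; [exact (@is_linear_scal_l R_AbsRing R_NormedModule l)|]. intros z Hz.
  apply (@is_filter_lim_locally_unique R_AbsRing R_NormedModule) in Hz. subst z. intros eps.
  destruct (H eps (cond_pos eps)) as [del [Hdel Hd]].
  exists (mkposreal _ (Rmin_glb_lt _ _ _ Hdel (cond_pos r))).
  intros y Hy. change (Rabs (y - x) < Rmin del r) in Hy.
  apply Hd.
  - apply Hr. change (Rabs (y - x) < r). eapply Rlt_le_trans; [exact Hy|apply Rmin_r].
  - eapply Rlt_le_trans; [exact Hy|apply Rmin_l].
Qed.

(** The condition under which a derivative within [D] is unique, so that the [iota] in [Derive_on]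
    picks it. *)
Definition accum (D : R -> Prop) (x : R) : Prop :=
  D x /\ forall del, 0 < del -> exists y, D y /\ y <> x /\ Rabs (y - x) < del.

Lemma is_derive_on_unique D f x l l' : accum D x ->
  is_derive_on D f x l -> is_derive_on D f x l' -> l = l'.
Proof.
  intros [Dx HA] H H'. rewrite is_derive_on_eps in H, H' by exact Dx.
  apply Rminus_diag_uniq. destruct (Req_dec (l - l') 0) as [E|E]; [exact E|exfalso].
  pose proof (Rabs_pos_lt _ E) as Hp.
  destruct (H (Rabs (l - l') / 3) ltac:(lra)) as [e [He H1]].
  destruct (H' (Rabs (l - l') / 3) ltac:(lra)) as [e' [He' H2]].
  destruct (HA (Rmin e e') (Rmin_glb_lt _ _ _ He He')) as [y [Dy [Hy Hd]]].
  pose proof (Rmin_l e e'). pose proof (Rmin_r e e').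
  specialize (H1 y Dy ltac:(lra)). specialize (H2 y Dy ltac:(lra)).
  assert (Hyx : 0 < Rabs (y - x)) by (apply Rabs_pos_lt; lra).
  assert (HH : Rabs ((y - x) * (l - l')) <= Rabs (l - l') / 3 * Rabs (y - x) + Rabs (l - l') / 3 * Rabs (y - x)).
  { replace ((y - x) * (l - l')) with ((f y - f x - (y - x) * l') - (f y - f x - (y - x) * l)) by ring.
    eapply Rle_trans; [apply Rabs_triang|]. rewrite Rabs_Ropp. lra. }
  rewrite Rabs_mult in HH. nra.
Qed.

Lemma iota_R_eq (P : R -> Prop) x : (forall y, P y -> y = x) -> P x -> iota P = x.
Proof. exact (@iota_unique R_AbsRing R_CompleteNormedModule P x). Qed.

Lemma Derive_on_eq D f x l : accum D x -> is_derive_on D f x l -> Derive_on D f x = l.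
Proof.
  intros HA H. unfold Derive_on. apply iota_R_eq; [|exact H].
  intros y Hy. eapply is_derive_on_unique; eassumption.
Qed.

Lemma Derive_on_correct D f x : accum D x -> ex_derive_on D f x ->
  is_derive_on D f x (Derive_on D f x).
Proof. intros HA [l H]. rewrite (Derive_on_eq _ _ _ _ HA H). exact H. Qed.

Lemma ex_derive_on_continuous (D : R -> Prop) f x : D x -> ex_derive_on D f x ->
  forall eps, 0 < eps -> exists del, 0 < del /\
    forall y, D y -> Rabs (y - x) < del -> Rabs (f y - f x) < eps.
Proof.
  intros Dx [l H] eps Heps. rewrite is_derive_on_eps in H by exact Dx.
  destruct (H 1 Rlt_0_1) as [e [He H1]].
  pose proof (Rabs_pos l) as Hl.
  assert (He2 : 0 < eps / (1 + Rabs l)) by (apply Rdiv_lt_0_compat; lra).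
  exists (Rmin e (eps / (1 + Rabs l))). split; [apply Rmin_glb_lt; assumption|].
  intros y Dy Hy. pose proof (Rmin_l e (eps / (1 + Rabs l))). pose proof (Rmin_r e (eps / (1 + Rabs l))).
  specialize (H1 y Dy ltac:(lra)).
  replace (f y - f x) with ((f y - f x - (y - x) * l) + (y - x) * l) by ring.
  eapply Rle_lt_trans; [apply Rabs_triang|]. rewrite Rabs_mult.
  assert (Hy2 : Rabs (y - x) < eps / (1 + Rabs l)) by lra.
  apply Rmult_lt_compat_r with (r := 1 + Rabs l) in Hy2; [|lra].
  unfold Rdiv in Hy2. rewrite Rmult_assoc, Rinv_l, Rmult_1_r in Hy2 by lra. nra.
Qed.

Lemma accum_seg a b x : a < b -> a <= x <= b -> accum (seg a b) x.
Proof.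
  intros Hab Hx. split; [exact Hx|]. intros del Hdel. unfold seg.
  destruct (Rlt_dec x b) as [H|H].
  - exists (Rmin b (x + del / 2)). unfold Rmin. destruct Rle_dec; repeat split; try lra;
    rewrite Rabs_pos_eq; lra.
  - exists (Rmax a (x - del / 2)). unfold Rmax. destruct Rle_dec; repeat split; try lra;
    rewrite Rabs_minus_sym, Rabs_pos_eq; lra.
Qed.

Lemma accum_subset (D D' : R -> Prop) x : (forall y, D y -> D' y) -> accum D x -> accum D' x.
Proof.
  intros S [Dx H]. split; [auto|]. intros del Hdel.
  destruct (H del Hdel) as [y [Dy H']]. exists y. split; auto.
Qed.

Lemma is_derive_on_continuous_clamp (D : R -> Prop) f a b : a <= b ->
  (forall x, a <= x <= b -> D x) -> (forall x, a <= x <= b -> ex_derive_on D f x) ->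
  forall x, continuous (fun y => f (clamp a b y)) x.
Proof.
  intros Hab HD Hf x. apply continuity_pt_filterlim. intros eps Heps.
  pose proof (clamp_in a b x Hab) as Hc.
  destruct (ex_derive_on_continuous D f _ (HD _ Hc) (Hf _ Hc) eps Heps) as [del [Hdel H]].
  exists del. split; [exact Hdel|]. intros y [_ Hy]. simpl in *. unfold Rdist in *.
  apply H; [apply HD, clamp_in, Hab|]. eapply Rle_lt_trans; [apply clamp_lip|exact Hy].
Qed.

Lemma locally_open_interval a b x : a < x < b -> locally x (fun y => a < y < b).
Proof.
  intros H. assert (Hp : 0 < Rmin (x - a) (b - x)) by (apply Rmin_glb_lt; lra).
  exists (mkposreal _ Hp). intros y Hy. change (Rabs (y - x) < Rmin (x - a) (b - x)) in Hy.
  pose proof (Rmin_l (x - a) (b - x)). pose proof (Rmin_r (x - a) (b - x)).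
  apply Rabs_lt_between in Hy. lra.
Qed.

(* Continuity of [f (clamp a b y)] everywhere encodes continuity of [f] on the closed interval. *)
Lemma MVT_clamp (f df : R -> R) a b : a < b ->
  (forall x, continuous (fun y => f (clamp a b y)) x) ->
  (forall x, a < x < b -> is_derive f x (df x)) ->
  exists x, a < x < b /\ f b - f a = df x * (b - a).
Proof.
  intros Hab Hc Hd.
  set (h := fun y => f (clamp a b y)).
  assert (Hh : forall x, a < x < b -> is_derive h x (df x)).
  { intros x Hx. apply is_derive_ext_loc with f; [|apply Hd, Hx].
    apply filter_imp with (2 := locally_open_interval a b x Hx).
    intros y Hy. unfold h. rewrite clamp_id by lra. reflexivity. }
  assert (pr1 : forall x, a < x < b -> derivable_pt h x).
  { intros x Hx. apply ex_derive_Reals_0. exists (df x). apply Hh, Hx. }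
  destruct (MVT h id a b pr1 (fun x _ => derivable_pt_id x) Hab) as [x [Hx E]].
  - intros x _. apply continuity_pt_filterlim, Hc.
  - intros x _. apply derivable_continuous_pt, derivable_pt_id.
  - exists x. split; [exact Hx|].
    rewrite derive_pt_id in E.
    assert (E1 : derive_pt h x (pr1 x Hx) = df x) by (apply derive_pt_eq_0, is_derive_Reals, Hh, Hx).
    rewrite E1 in E. unfold h, id in E.
    rewrite !clamp_id in E by lra. lra.
Qed.

Lemma MVT_R (f df : R -> R) a b : a < b ->
  (forall x, a <= x <= b -> is_derive f x (df x)) ->
  exists x, a < x < b /\ f b - f a = df x * (b - a).
Proof.
  intros Hab H. destruct (MVT_cor2 f df a b Hab) as [x [E Hx]].
  - intros x Hx. apply is_derive_Reals, H, Hx.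
  - exists x. auto.
Qed.

Lemma derive_0_const (f : R -> R) a b : a <= b ->
  (forall x, continuous (fun y => f (clamp a b y)) x) ->
  (forall x, a < x < b -> is_derive f x 0) -> f b = f a.
Proof.
  intros Hab Hc Hd. destruct (Req_dec a b) as [->|N]; [reflexivity|].
  destruct (MVT_clamp f (fun _ => 0) a b ltac:(lra) Hc Hd) as [x [_ E]]. lra.
Qed.

Lemma is_derive_bound_Lip (f df : R -> R) L a b :
  (forall x, a <= x <= b -> is_derive f x (df x)) ->
  (forall x, a <= x <= b -> Rabs (df x) <= L) ->
  forall x y, a <= x <= b -> a <= y <= b -> Rabs (f x - f y) <= L * Rabs (x - y).
Proof.
  intros Hd HL.
  assert (W : forall x y, a <= x <= b -> a <= y <= b -> x < y -> Rabs (f x - f y) <= L * Rabs (x - y)).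
  { intros x y Hx Hy Hxy. destruct (MVT_R f df x y Hxy) as [z [Hz E]].
    - intros z Hz. apply Hd. lra.
    - rewrite (Rabs_minus_sym (f x)), (Rabs_minus_sym x), E, Rabs_mult.
      apply Rmult_le_compat_r; [apply Rabs_pos|]. apply HL. lra. }
  intros x y Hx Hy. destruct (Rtotal_order x y) as [H|[->|H]].
  - auto.
  - rewrite !Rminus_diag, Rabs_R0. lra.
  - rewrite (Rabs_minus_sym (f x)), (Rabs_minus_sym x). auto.
Qed.

(** By the mean value theorem the difference quotient at [x0] is a value of [df] at a nearby point,
    and these values tend to [df x0]. This turns matching slopes into differentiability at the two
    gluing points, [/ c] for [v] and 0 for the datum of [w]. *)
Lemma C1_glue (f df : R -> R) x0 r : 0 < r -> continuous f x0 ->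
  (forall x, x0 - r < x < x0 + r -> x <> x0 -> is_derive f x (df x)) ->
  continuous df x0 -> is_derive f x0 (df x0).
Proof.
  intros Hr Hf Hd Hc. apply is_derive_Reals. intros eps Heps.
  apply continuity_pt_filterlim in Hc. destruct (Hc eps Heps) as [del [Hdel H]].
  assert (Hp : 0 < Rmin r del) by (apply Rmin_glb_lt; lra).
  exists (mkposreal _ Hp). intros h Hh0 Hh. simpl in Hh.
  pose proof (Rmin_l r del). pose proof (Rmin_r r del).
  assert (HC : forall u w, Rabs (u - x0) < r -> Rabs (w - x0) < r -> u < w ->
    forall x, continuous (fun y => f (clamp u w y)) x).
  { intros u w Hu Hw Huw x. apply continuous_comp; [apply continuous_clamp|].
    pose proof (clamp_in u w x ltac:(lra)).
    apply Rabs_lt_between in Hu. apply Rabs_lt_between in Hw.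
    destruct (Req_dec (clamp u w x) x0) as [->|N]; [exact Hf|].
    apply (ex_derive_continuous f). exists (df (clamp u w x)). apply Hd; [lra|exact N]. }
  assert (E : exists z, Rabs (z - x0) < Rabs h /\ f (x0 + h) - f x0 = df z * h).
  { destruct (Rlt_dec 0 h) as [Hp'|Hn].
    - rewrite (Rabs_pos_eq h) in * by lra.
      destruct (MVT_clamp f df x0 (x0 + h)) as [z [Hz E]].
      + lra.
      + apply HC; [rewrite Rminus_diag, Rabs_R0; lra|rewrite Rabs_pos_eq; lra|lra].
      + intros z Hz. apply Hd; lra.
      + exists z. split; [rewrite Rabs_pos_eq; lra|]. rewrite E. ring.
    - rewrite (Rabs_left h) in * by lra.
      destruct (MVT_clamp f df (x0 + h) x0) as [z [Hz E]].
      + lra.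
      + apply HC; [rewrite Rabs_left; lra|rewrite Rminus_diag, Rabs_R0; lra|lra].
      + intros z Hz. apply Hd; lra.
      + exists z. split; [rewrite Rabs_left; lra|]. lra. }
  destruct E as [z [Hz E]]. rewrite E. unfold Rdiv. rewrite Rmult_assoc, Rinv_r, Rmult_1_r by exact Hh0.
  destruct (Req_dec z x0) as [->|N]; [rewrite Rminus_diag, Rabs_R0; exact Heps|].
  apply (H z). split; [split; [exact I|auto]|]. simpl. unfold Rdist. lra.
Qed.

Lemma is_derive_eq (f : R -> R) (x l l' : R) : is_derive f x l -> l = l' -> is_derive f x l'.
Proof. intros H <-. exact H. Qed.

(** * Elementary derivative rules on the line *)

Section R_derivatives.
Variables (f g : R -> R) (x a b : R).
Hypotheses (Hf : is_derive f x a) (Hg : is_derive g x b).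

Lemma is_derive_R_plus : is_derive (fun y => f y + g y) x (a + b).
Proof. exact (is_derive_plus (K := R_AbsRing) (V := R_NormedModule) f g x a b Hf Hg). Qed.

Lemma is_derive_R_minus : is_derive (fun y => f y - g y) x (a - b).
Proof. exact (is_derive_minus (K := R_AbsRing) (V := R_NormedModule) f g x a b Hf Hg). Qed.

Lemma is_derive_R_mult : is_derive (fun y => f y * g y) x (a * g x + f x * b).
Proof.
  apply is_derive_Reals. apply is_derive_Reals in Hf. apply is_derive_Reals in Hg.
  exact (derivable_pt_lim_mult f g x a b Hf Hg).
Qed.

Lemma is_derive_R_comp h l : is_derive h (f x) l -> is_derive (fun y => h (f y)) x (l * a).
Proof.
  intros Hh. rewrite Rmult_comm.
  exact (is_derive_comp (K := R_AbsRing) (V := R_NormedModule) h f x l a Hh Hf).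
Qed.

End R_derivatives.

Lemma is_derive_R_const (k x : R) : is_derive (fun _ : R => k) x 0.
Proof. exact (is_derive_const (K := R_AbsRing) (V := R_NormedModule) k x). Qed.

Lemma is_derive_R_id (x : R) : is_derive (fun y : R => y) x 1.
Proof. exact (is_derive_id (K := R_AbsRing) x). Qed.

Lemma is_derive_R_affine (k m x : R) : is_derive (fun y : R => k * y + m) x k.
Proof.
  apply is_derive_eq with ((0 * x + k * 1) + 0); [|ring].
  apply is_derive_R_plus; [|apply is_derive_R_const].
  apply (is_derive_R_mult (fun _ => k) (fun y => y)); [apply is_derive_R_const|apply is_derive_R_id].
Qed.

Lemma is_derive_exp_scal (k x : R) : is_derive (fun t => exp (k * t)) x (k * exp (k * x)).
Proof. auto_derive; [exact I|ring]. Qed.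

Lemma is_derive_nonpos_le (f df : R -> R) a b : a <= b ->
  (forall x, a <= x <= b -> is_derive f x (df x)) -> (forall x, a <= x <= b -> df x <= 0) ->
  f b <= f a.
Proof.
  intros Hab Hd Hp. destruct (Req_dec a b) as [->|N]; [lra|].
  destruct (MVT_R f df a b ltac:(lra) Hd) as [x [Hx E]]. specialize (Hp x ltac:(lra)). nra.
Qed.

(** * Functions of two variables *)

Lemma continuous_on_clamp2 (U : R * R -> Prop) f a b a' b' : a <= b -> a' <= b' ->
  (forall p, rect a b a' b' p -> U p) -> continuous_on U (uncurry2 f) ->
  forall x y, continuity_2d_pt (fun x y => f (clamp a b x) (clamp a' b' y)) x y.
Proof.
  intros Hab Hab' HU Hf x y eps.
  pose proof (clamp_in a b x Hab) as Hx. pose proof (clamp_in a' b' y Hab') as Hy.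
  destruct (Hf (clamp a b x, clamp a' b' y) (HU (clamp a b x, clamp a' b' y) (conj Hx Hy)) _ (locally_ball _ eps)) as [del Hd].
  exists del. intros u v Hu Hv.
  apply (Hd (clamp a b u, clamp a' b' v)).
  - split; (eapply Rle_lt_trans; [apply clamp_lip|assumption]).
  - apply HU. split; apply clamp_in; assumption.
Qed.

(** Maximize over [y] on each slice, choosing a maximizer [Y x]; uniform continuity makes the slice
    maximum a continuous function of [x], which is then maximized in turn. *)
Lemma EVT_2d (h : R -> R -> R) a b a' b' : a <= b -> a' <= b' ->
  (forall x y, continuity_2d_pt h x y) ->
  exists x0 y0, a <= x0 <= b /\ a' <= y0 <= b' /\
    forall x y, a <= x <= b -> a' <= y <= b' -> h x y <= h x0 y0.
Proof.
  intros Hab Hab' Hc.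
  assert (Hslice : forall x, exists y0, a' <= y0 <= b' /\ forall y, a' <= y <= b' -> h x y <= h x y0).
  { intros x. destruct (continuity_ab_maj (h x) a' b' Hab') as [y0 [H1 H2]].
    - intros y _ eps Heps. destruct (Hc x y (mkposreal eps Heps)) as [del Hd].
      exists del. split; [apply cond_pos|]. intros z [_ Hz].
      apply (Hd x z); [rewrite Rminus_diag, Rabs_R0; apply cond_pos|exact Hz].
    - exists y0. auto. }
  set (Y := fun x => proj1_sig (constructive_indefinite_description _ (Hslice x))).
  assert (HY : forall x, a' <= Y x <= b' /\ forall y, a' <= y <= b' -> h x y <= h x (Y x)).
  { intros x. unfold Y. destruct constructive_indefinite_description. assumption. }
  destruct (continuity_ab_maj (fun x => h x (Y x)) a b Hab) as [x0 [H1 H2]].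
  - intros x Hx eps Heps.
    assert (He2 : 0 < eps / 2) by lra.
    (* The interval is enlarged by 1 because the nearby point [z] may leave [a, b]. *)
    destruct (uniform_continuity_2d h (a - 1) (b + 1) a' b' (fun x y _ _ => Hc x y)
      (mkposreal _ He2)) as [del Hd]. simpl in Hd.
    exists (Rmin 1 del). split; [apply Rmin_glb_lt; [lra|apply cond_pos]|].
    intros z [_ Hz]. simpl in *. unfold Rdist in *.
    pose proof (Rmin_l 1 del). pose proof (Rmin_r 1 del).
    assert (Hz1 : Rabs (z - x) < 1) by lra. apply Rabs_lt_between in Hz1.
    destruct (HY x) as [Hx1 Hx2]. destruct (HY z) as [Hz2 Hz3].
    specialize (Hx2 (Y z) Hz2). specialize (Hz3 (Y x) Hx1).
    assert (D0 : forall y : R, Rabs (y - y) < del)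
      by (intros; rewrite Rminus_diag, Rabs_R0; apply cond_pos).
    pose proof (Hd x (Y x) z (Y x) ltac:(lra) Hx1 ltac:(lra) Hx1 ltac:(lra) (D0 _)) as E1.
    pose proof (Hd x (Y z) z (Y z) ltac:(lra) Hz2 ltac:(lra) Hz2 ltac:(lra) (D0 _)) as E2.
    apply Rabs_lt_between in E1. apply Rabs_lt_between in E2.
    apply Rabs_lt_between. lra.
  - exists x0, (Y x0). destruct (HY x0) as [H3 _]. repeat split; try tauto; try apply H2; try apply H3.
    intros x y Hx Hy. destruct (HY x) as [_ H4]. eapply Rle_trans; [apply H4, Hy|apply H1, Hx].
Qed.

Lemma continuous_on_rect_max (U : R * R -> Prop) f a b a' b' : a <= b -> a' <= b' ->
  (forall p, rect a b a' b' p -> U p) -> continuous_on U (uncurry2 f) ->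
  exists x0 y0, a <= x0 <= b /\ a' <= y0 <= b' /\
    forall x y, a <= x <= b -> a' <= y <= b' -> f x y <= f x0 y0.
Proof.
  intros Hab Hab' HU Hf.
  destruct (EVT_2d _ a b a' b' Hab Hab' (continuous_on_clamp2 U f a b a' b' Hab Hab' HU Hf))
    as [x0 [y0 [Hx [Hy H]]]].
  exists x0, y0. split; [exact Hx|]. split; [exact Hy|]. intros x y Hx' Hy'.
  specialize (H x y Hx' Hy'). simpl in H. rewrite !clamp_id in H by assumption. exact H.
Qed.

Lemma continuous_on_comp_R (U : R * R -> Prop) (f : R -> R -> R) (k : R -> R) :
  (forall x, continuous k x) -> continuous_on U (uncurry2 f) ->
  continuous_on U (uncurry2 (fun x y => k (f x y))).
Proof.
  intros Hk Hf p Up. exact (filterlim_comp _ _ _ _ _ _ _ _ (Hf p Up) (Hk (f (fst p) (snd p)))).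
Qed.

Lemma continuous_on_rect_bounded (U : R * R -> Prop) f a b a' b' : a <= b -> a' <= b' ->
  (forall p, rect a b a' b' p -> U p) -> continuous_on U (uncurry2 f) ->
  exists B, 0 <= B /\ forall x y, a <= x <= b -> a' <= y <= b' -> Rabs (f x y) <= B.
Proof.
  intros Hab Hab' HU Hf.
  destruct (continuous_on_rect_max U (fun x y => Rabs (f x y)) a b a' b' Hab Hab' HU)
    as [x0 [y0 [Hx [Hy H]]]].
  { apply continuous_on_comp_R; [|exact Hf]. intros x. apply continuous_Rabs. }
  exists (Rabs (f x0 y0)). split; [apply Rabs_pos|exact H].
Qed.

Lemma Ck_1_derive1 (U : R * R -> Prop) f a b x y : Ck 1 U f ->
  (forall s, a <= s <= b -> U (s, y)) -> a < x < b ->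
  is_derive (fun s => f s y) x (partial1 U f x y).
Proof.
  intros [_ [H _]] HU Hx.
  assert (L : locally x (fun s => U (s, y))).
  { apply filter_imp with (2 := locally_open_interval a b x Hx). intros s Hs. apply HU. lra. }
  apply (is_derive_on_is_derive (fun s => U (s, y))); [exact L|].
  apply Derive_on_correct.
  - apply accum_subset with (seg a b); [exact HU|]. apply accum_seg; lra.
  - apply (H (x, y)). apply HU. lra.
Qed.

Lemma Ck_1_derive2 (U : R * R -> Prop) f a b x y : Ck 1 U f ->
  (forall s, a <= s <= b -> U (x, s)) -> a < y < b ->
  is_derive (fun s => f x s) y (partial2 U f x y).
Proof.
  intros [_ [H _]] HU Hy.
  assert (L : locally y (fun s => U (x, s))).
  { apply filter_imp with (2 := locally_open_interval a b y Hy). intros s Hs. apply HU. lra. }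
  apply (is_derive_on_is_derive (fun s => U (x, s))); [exact L|].
  apply Derive_on_correct.
  - apply accum_subset with (seg a b); [exact HU|]. apply accum_seg; lra.
  - apply (H (x, y)). apply HU. lra.
Qed.

Lemma Lip_of_lt (f : R -> R) L a b :
  (forall x y, a <= x <= b -> a <= y <= b -> x < y -> Rabs (f y - f x) <= L * Rabs (y - x)) ->
  forall x y, a <= x <= b -> a <= y <= b -> Rabs (f x - f y) <= L * Rabs (x - y).
Proof.
  intros W x y Hx Hy. destruct (Rtotal_order x y) as [H|[->|H]].
  - rewrite (Rabs_minus_sym (f x)), (Rabs_minus_sym x). auto.
  - rewrite !Rminus_diag, Rabs_R0. lra.
  - auto.
Qed.

(** Two points are joined by two axis-parallel segments meeting at [(x', y)], which stays in the
    rectangle. The mean value theorem along each of them uses derivatives only in its interior, so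
    the one-sided derivatives on the edges of [U] cause no trouble. *)
Lemma Ck_1_rect_BL (U : R * R -> Prop) f a b a' b' : a <= b -> a' <= b' ->
  (forall p, rect a b a' b' p -> U p) -> Ck 1 U f -> BL (rect a b a' b') dRR (uncurry2 f).
Proof.
  intros Hab Hab' HU Hf.
  pose proof Hf as [C0 [Hex [[C1 _] [C2 _]]]].
  destruct (continuous_on_rect_bounded U f a b a' b' Hab Hab' HU C0) as [B0 [P0 H0]].
  destruct (continuous_on_rect_bounded U _ a b a' b' Hab Hab' HU C1) as [B1 [P1 H1]].
  destruct (continuous_on_rect_bounded U _ a b a' b' Hab Hab' HU C2) as [B2 [P2 H2]].
  assert (Hor : forall y, a' <= y <= b' -> forall x x', a <= x <= b -> a <= x' <= b ->
    Rabs (f x y - f x' y) <= B1 * Rabs (x - x')).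
  { intros y Hy. apply (Lip_of_lt (fun x => f x y)). intros x x' Hx Hx' Hlt.
    destruct (MVT_clamp (fun s => f s y) (fun s => partial1 U f s y) x x' Hlt) as [z [Hz E]].
    - apply (is_derive_on_continuous_clamp (fun s => U (s, y)) (fun s => f s y) x x'); [lra| |].
      + intros s Hs. apply HU. split; simpl; lra.
      + intros s Hs. apply (Hex (s, y)). apply HU. split; simpl; lra.
    - intros z Hz. apply (Ck_1_derive1 U f x x'); [exact Hf| |exact Hz].
      intros s Hs. apply HU. split; simpl; lra.
    - rewrite E, Rabs_mult. apply Rmult_le_compat_r; [apply Rabs_pos|].
      apply H1; lra. }
  assert (Ver : forall x, a <= x <= b -> forall y y', a' <= y <= b' -> a' <= y' <= b' ->
    Rabs (f x y - f x y') <= B2 * Rabs (y - y')).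
  { intros x Hx. apply (Lip_of_lt (fun y => f x y)). intros y y' Hy Hy' Hlt.
    destruct (MVT_clamp (fun s => f x s) (fun s => partial2 U f x s) y y' Hlt) as [z [Hz E]].
    - apply (is_derive_on_continuous_clamp (fun s => U (x, s)) (fun s => f x s) y y'); [lra| |].
      + intros s Hs. apply HU. split; simpl; lra.
      + intros s Hs. apply (Hex (x, s)). apply HU. split; simpl; lra.
    - intros z Hz. apply (Ck_1_derive2 U f y y'); [exact Hf| |exact Hz].
      intros s Hs. apply HU. split; simpl; lra.
    - rewrite E, Rabs_mult. apply Rmult_le_compat_r; [apply Rabs_pos|].
      apply H2; lra. }
  exists (B0 + B1 + B2). split; [lra|]. intros [x y] [Hx Hy]; simpl in Hx, Hy. unfold uncurry2; simpl.
  split; [specialize (H0 x y Hx Hy); lra|].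
  intros [x' y'] [Hx' Hy']; simpl in *. unfold dRR; simpl.
  replace (f x y - f x' y') with ((f x y - f x' y) + (f x' y - f x' y')) by ring.
  eapply Rle_trans; [apply Rabs_triang|].
  specialize (Hor y Hy x x' Hx Hx'). specialize (Ver x' Hx' y y' Hy Hy').
  pose proof (Rabs_pos (x - x')). pose proof (Rabs_pos (y - y')). nra.
Qed.

Lemma C1_chain (U : R * R -> Prop) f a b a' b' X Y s (dx dy : R) : Ck 1 U f ->
  (forall p, rect a b a' b' p -> U p) ->
  a < X s < b -> a' < Y s < b' -> is_derive X s dx -> is_derive Y s dy ->
  is_derive (fun s => f (X s) (Y s)) s
    (dx * partial1 U f (X s) (Y s) + dy * partial2 U f (X s) (Y s)).
Proof.
  intros Hf HU Hx Hy HX HY.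
  assert (HF : filterdiff (fun u : R * R => f (fst u) (snd u)) (locally (X s, Y s))
    (fun u : R * R => plus (scal (fst u) (partial1 U f (X s) (Y s))) (scal (snd u) (partial2 U f (X s) (Y s))))).
  { apply is_derive_filterdiff.
    - destruct (locally_open_interval _ _ _ Hx) as [r Hr].
      destruct (locally_open_interval _ _ _ Hy) as [r' Hr'].
      assert (Hp : 0 < Rmin r r') by (apply Rmin_glb_lt; apply cond_pos).
      exists (mkposreal _ Hp). intros [x y] [Bx By]; simpl in *.
      assert (Ix : a < x < b).
      { apply Hr. eapply ball_le; [|exact Bx]. apply Rmin_l. }
      assert (Iy : a' < y < b').
      { apply Hr'. eapply ball_le; [|exact By]. apply Rmin_r. }
      apply (Ck_1_derive1 U f a b); [exact Hf| |exact Ix].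
      intros z Hz. apply HU. split; simpl; lra.
    - apply (Ck_1_derive2 U f a' b'); [exact Hf| |exact Hy].
      intros z Hz. apply HU. split; simpl; lra.
    (* [continuous_on] controls points of [U] only; the strict inequalities on [X s] and [Y s]
       provide a full neighbourhood inside [U]. *)
    - destruct Hf as [_ [_ [[C1 _] _]]].
      intros P HP. specialize (C1 (X s, Y s) (HU (X s, Y s) (conj (conj (Rlt_le _ _ (proj1 Hx)) (Rlt_le _ _ (proj2 Hx))) (conj (Rlt_le _ _ (proj1 Hy)) (Rlt_le _ _ (proj2 Hy))))) P HP).
      unfold filtermap, within in *.
      destruct C1 as [r0 Hr0].
      destruct (locally_open_interval _ _ _ Hx) as [r Hr].
      destruct (locally_open_interval _ _ _ Hy) as [r' Hr'].
      assert (Hp : 0 < Rmin r0 (Rmin r r')) by (repeat apply Rmin_glb_lt; apply cond_pos).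
      exists (mkposreal _ Hp). intros [x y] [Bx By]; simpl in *.
      assert (Ix : a < x < b).
      { apply Hr. eapply ball_le; [|exact Bx]. eapply Rle_trans; [apply Rmin_r|apply Rmin_l]. }
      assert (Iy : a' < y < b').
      { apply Hr'. eapply ball_le; [|exact By]. eapply Rle_trans; [apply Rmin_r|apply Rmin_r]. }
      apply (Hr0 (x, y)).
      + split; (eapply ball_le; [apply Rmin_l|eassumption]).
      + apply HU. split; simpl; lra. }
  pose proof (filterdiff_comp'_2 X Y f s (fun h => scal h dx) (fun h => scal h dy)
    (fun h k => plus (scal h (partial1 U f (X s) (Y s))) (scal k (partial2 U f (X s) (Y s)))) HX HY HF) as H.
  eapply filterdiff_ext_lin; [exact H|]. intros z. simpl.
  unfold scal, plus; simpl. unfold mult; simpl. ring.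
Qed.

(** * Primitives and C^1 extension of the data *)

Lemma ex_RInt_cont (f : R -> R) a b : (forall x, continuous f x) -> ex_RInt f a b.
Proof. intros H. apply (ex_RInt_continuous f). intros; apply H. Qed.

Lemma is_derive_primitive (f : R -> R) a x : (forall x, continuous f x) ->
  is_derive (fun y => RInt f a y) x (f x).
Proof.
  intros H. apply is_derive_RInt with a; [|apply H].
  apply filter_forall. intros y. apply (RInt_correct f), ex_RInt_cont, H.
Qed.

Lemma lipschitz_on_R_clamp (f : R -> R) : lipschitz_on unit_itv f ->
  exists L, forall x y, Rabs (f (clamp 0 1 x) - f (clamp 0 1 y)) <= L * Rabs (x - y).
Proof.
  intros [L H]. exists (Rabs L). intros x y.
  pose proof (H (clamp 0 1 x) (clamp 0 1 y) (clamp_in 0 1 x Rle_0_1) (clamp_in 0 1 y Rle_0_1)) as H1.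
  change (norm (minus (clamp 0 1 x) (clamp 0 1 y))) with (Rabs (clamp 0 1 x - clamp 0 1 y)) in H1.
  pose proof (clamp_lip 0 1 x y). pose proof (Rle_abs L). pose proof (Rabs_pos L).
  pose proof (Rabs_pos (clamp 0 1 x - clamp 0 1 y)).
  eapply Rle_trans; [exact H1|]. apply Rle_trans with (Rabs L * Rabs (clamp 0 1 x - clamp 0 1 y)).
  - apply Rmult_le_compat_r; lra.
  - apply Rmult_le_compat_l; lra.
Qed.

(** The derivative is extended by constants, which keeps its Lipschitz constant, and then
    integrated. The one-sided derivatives of [f] at 0 and 1 thereby become ordinary derivatives of
    [F]. *)
Lemma W2inf_extend f : W2inf f -> exists F dF : R -> R,
  (forall x, is_derive F x (dF x)) /\
  (exists L, forall x y, Rabs (dF x - dF y) <= L * Rabs (x - y)) /\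
  (forall x, 0 <= x <= 1 -> F x = f x /\ dF x = Derive_on unit_itv f x).
Proof.
  intros [Hd [_ HL]].
  destruct (lipschitz_on_R_clamp _ HL) as [L Hlip].
  set (dF := fun x => Derive_on unit_itv f (clamp 0 1 x)).
  assert (Hc : forall x, continuous dF x).
  { apply locBL_continuous, locBL_Lip with L. exact Hlip. }
  exists (fun x => f 0 + RInt dF 0 x), dF. split; [|split].
  - intros x. apply is_derive_eq with (0 + dF x); [|ring].
    apply is_derive_R_plus; [apply is_derive_R_const|apply is_derive_primitive, Hc].
  - exists L. exact Hlip.
  - intros x Hx. split; [|unfold dF; rewrite clamp_id by exact Hx; reflexivity].
    enough (E : f x - (f 0 + RInt dF 0 x) = f 0 - (f 0 + RInt dF 0 0)).
    { rewrite RInt_point in E. unfold zero in E; simpl in E. lra. }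
    apply (derive_0_const (fun x => f x - (f 0 + RInt dF 0 x)) 0 x); [lra| |].
    + intros y. apply (continuous_minus (fun y => f (clamp 0 x y))).
      * apply (is_derive_on_continuous_clamp unit_itv); [lra| |]; unfold unit_itv; intros z Hz; [lra|].
        apply Hd. unfold unit_itv; lra.
      * apply (continuous_comp (clamp 0 x) (fun y => f 0 + RInt dF 0 y)); [apply continuous_clamp|].
        apply (continuous_plus (fun _ => f 0)); [apply continuous_const|].
        apply (ex_derive_continuous (fun y => RInt dF 0 y)).
        eexists. apply is_derive_primitive, Hc.
    + intros y Hy. apply is_derive_eq with (dF y - (0 + dF y)); [|ring].
      apply is_derive_R_minus.
      * apply (is_derive_on_is_derive unit_itv).
        -- apply filter_imp with (2 := locally_open_interval 0 x y Hy). unfold unit_itv. intros; lra.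
        -- unfold dF. rewrite clamp_id by lra. apply Derive_on_correct.
           ++ apply (accum_seg 0 1); lra.
           ++ apply Hd. unfold unit_itv; lra.
      * apply is_derive_R_plus; [apply is_derive_R_const|apply is_derive_primitive, Hc].
Qed.

(** * Fixed points of causal maps *)

Lemma is_lim_seq_geom_half K : is_lim_seq (fun n => K * (/ 2) ^ n) 0.
Proof.
  replace (Finite 0) with (Rbar_mult K 0) by (simpl; f_equal; ring).
  apply is_lim_seq_scal_l, is_lim_seq_geom. rewrite Rabs_pos_eq; lra.
Qed.

Lemma le_geom_half x K : (forall n, x <= K * (/ 2) ^ n) -> x <= 0.
Proof.
  intros H. apply (is_lim_seq_le (fun _ => x) (fun n => K * (/ 2) ^ n) x 0 H).
  - apply is_lim_seq_const.
  - apply is_lim_seq_geom_half.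
Qed.

(* Picard iteration in the norms [sup_{0<=t<=T} e^{-lam t} |u t|]: for [lam] large the map
   contracts by 1/2 on every [0,T]. *)
Lemma causal_fixed_point (C : (R -> R) -> Prop) (N : (R -> R) -> R -> R) M :
  (exists u, C u) ->
  (forall u, C u -> C (N u)) ->
  (forall u t, C u -> 0 <= t -> Rabs (u t) <= M) ->
  (forall (un : nat -> R -> R) (u : R -> R), (forall n, C (un n)) ->
     (forall t, 0 <= t -> is_lim_seq (fun n => un n t) (u t)) -> C u) ->
  (forall T, 0 <= T -> exists L, 0 <= L /\ forall u1 u2 lam K, C u1 -> C u2 -> 0 < lam -> 0 <= K ->
     (forall s, 0 <= s <= T -> Rabs (u1 s - u2 s) <= K * exp (lam * s)) ->
     forall t, 0 <= t <= T -> Rabs (N u1 t - N u2 t) <= L / lam * (K * exp (lam * t))) ->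
  (exists u, C u /\ forall t, 0 <= t -> N u t = u t) /\
  (forall u1 u2, C u1 -> C u2 -> (forall t, 0 <= t -> N u1 t = u1 t) ->
     (forall t, 0 <= t -> N u2 t = u2 t) -> forall t, 0 <= t -> u1 t = u2 t).
Proof.
  intros [u0 Hu0] HN HM Hcl HL.
  assert (HM0 : 0 <= M) by (eapply Rle_trans; [apply Rabs_pos|apply (HM u0 0 Hu0); lra]).
  assert (Hhalf : forall T, 0 <= T -> exists lam, 0 < lam /\ forall u1 u2 K, C u1 -> C u2 -> 0 <= K ->
     (forall s, 0 <= s <= T -> Rabs (u1 s - u2 s) <= K * exp (lam * s)) ->
     forall t, 0 <= t <= T -> Rabs (N u1 t - N u2 t) <= / 2 * K * exp (lam * t)).
  (* The factor [2 * L] makes [L / lam] at most 1/2, and the added 1 keeps [lam] positive when [L]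
     is 0. *)
  { intros T HT. destruct (HL T HT) as [L [HL0 H]]. exists (2 * L + 1). split; [lra|].
    intros u1 u2 K C1 C2 HK Hs t Ht.
    eapply Rle_trans; [apply (H u1 u2 (2 * L + 1) K); auto; lra|].
    rewrite Rmult_assoc. apply Rmult_le_compat_r.
    - apply Rmult_le_pos; [exact HK|left; apply exp_pos].
    - apply Rmult_le_reg_r with (2 * L + 1); [lra|]. field_simplify; lra. }
  assert (Hdiff : forall T lam, 0 <= T -> 0 < lam -> forall u1 u2, C u1 -> C u2 ->
    forall s, 0 <= s <= T -> Rabs (u1 s - u2 s) <= 2 * M * exp (lam * s)).
  { intros T lam HT Hlam u1 u2 C1 C2 s Hs.
    assert (1 <= exp (lam * s)).
    { rewrite <- exp_0. destruct (Req_dec (lam * s) 0) as [->|N0]; [lra|].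
      left. apply exp_increasing. assert (0 <= lam * s) by (apply Rmult_le_pos; lra). lra. }
    pose proof (HM u1 s C1 ltac:(lra)). pose proof (HM u2 s C2 ltac:(lra)).
    apply Rle_trans with (2 * M); [|nra].
    eapply Rle_trans; [apply Rabs_triang|]. rewrite Rabs_Ropp. lra. }
  split.
  - set (un := fix un n := match n with O => u0 | S k => N (un k) end).
    assert (HC : forall n, C (un n)) by (induction n; simpl; auto).
    assert (Hstep : forall T, 0 <= T -> exists lam, 0 < lam /\
      (forall u1 u2 K, C u1 -> C u2 -> 0 <= K ->
        (forall s, 0 <= s <= T -> Rabs (u1 s - u2 s) <= K * exp (lam * s)) ->
        forall t, 0 <= t <= T -> Rabs (N u1 t - N u2 t) <= / 2 * K * exp (lam * t)) /\
      forall n k t, 0 <= t <= T -> Rabs (un (n + k)%nat t - un n t) <= 4 * M * (/ 2) ^ n * exp (lam * t)).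
    { intros T HT. destruct (Hhalf T HT) as [lam [Hlam H]]. exists lam. split; [exact Hlam|].
      split; [exact H|].
      assert (H1 : forall n t, 0 <= t <= T -> Rabs (un (S n) t - un n t) <= 2 * M * (/ 2) ^ n * exp (lam * t)).
      { induction n as [|n IH]; intros t Ht.
        - simpl. rewrite Rmult_1_r. apply (Hdiff T); auto.
        - change (un (S (S n))) with (N (un (S n))). change (un (S n)) with (N (un n)) at 2.
          eapply Rle_trans; [apply (H _ _ (2 * M * (/ 2) ^ n)); auto|simpl; right; ring].
          apply Rmult_le_pos; [lra|]. apply pow_le; lra. }
      intros n k t Ht.
      (* The bound is strengthened to the exact geometric partial sum, so that the induction on [k]
         closes. *)
      enough (E : Rabs (un (n + k)%nat t - un n t) <= 4 * M * ((/ 2) ^ n - (/ 2) ^ (n + k)) * exp (lam * t)).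
      { eapply Rle_trans; [exact E|]. apply Rmult_le_compat_r; [left; apply exp_pos|].
        apply Rmult_le_compat_l; [lra|]. pose proof (pow_le (/ 2) (n + k) ltac:(lra)). lra. }
      induction k as [|k IH].
      - rewrite Nat.add_0_r, !Rminus_diag, Rabs_R0. lra.
      - rewrite Nat.add_succ_r.
        replace (un (S (n + k)) t - un n t) with ((un (S (n + k)) t - un (n + k)%nat t) + (un (n + k)%nat t - un n t)) by ring.
        eapply Rle_trans; [apply Rabs_triang|].
        specialize (H1 (n + k)%nat t Ht).
        replace (4 * M * ((/ 2) ^ n - (/ 2) ^ S (n + k)) * exp (lam * t)) with
          (2 * M * (/ 2) ^ (n + k) * exp (lam * t) + 4 * M * ((/ 2) ^ n - (/ 2) ^ (n + k)) * exp (lam * t))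
          by (simpl; field).
        lra. }
    assert (Hlim : forall t, 0 <= t -> ex_finite_lim_seq (fun n => un n t)).
    { intros t Ht. apply ex_lim_seq_cauchy_corr. intros eps.
      destruct (Hstep t Ht) as [lam [_ [_ H]]].
      destruct (is_lim_seq_geom_half (4 * M * exp (lam * t)) _ (locally_ball 0 (mkposreal _ (is_pos_div_2 eps)))) as [n0 Hn0].
      exists n0. 
      assert (HH : forall n, (n0 <= n)%nat -> Rabs (un n t - un n0 t) < eps / 2).
      { intros n Hn. replace n with (n0 + (n - n0))%nat by lia.
        eapply Rle_lt_trans; [apply H; lra|]. specialize (Hn0 n0 (Nat.le_refl _)).
        change (Rabs (4 * M * exp (lam * t) * (/ 2) ^ n0 - 0) < eps / 2) in Hn0.
        rewrite Rminus_0_r in Hn0. pose proof (Rle_abs (4 * M * exp (lam * t) * (/ 2) ^ n0)). lra. }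
      intros n m Hn Hm. pose proof (HH n Hn). pose proof (HH m Hm) as Hm'.
      rewrite Rabs_minus_sym in Hm'.
      replace (un n t - un m t) with ((un n t - un n0 t) + (un n0 t - un m t)) by ring.
      eapply Rle_lt_trans; [apply Rabs_triang|]. lra. }
    set (u := fun t => real (Lim_seq (fun n => un n t))).
    assert (Hu : forall t, 0 <= t -> is_lim_seq (fun n => un n t) (u t)).
    { intros t Ht. destruct (Hlim t Ht) as [l Hl]. unfold u. rewrite (is_lim_seq_unique _ _ Hl). exact Hl. }
    assert (Cu : C u) by (exact (Hcl un u HC Hu)).
    exists u. split; [exact Cu|]. intros t Ht.
    destruct (Hstep t Ht) as [lam [Hlam [Hc H]]].
    assert (Hun : forall n s, 0 <= s <= t -> Rabs (u s - un n s) <= 4 * M * (/ 2) ^ n * exp (lam * s)).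
    { intros n s Hs.
      apply (is_lim_seq_le (fun k => Rabs (un (n + k)%nat s - un n s)) (fun _ => 4 * M * (/ 2) ^ n * exp (lam * s))
        (Rabs (u s - un n s)) (4 * M * (/ 2) ^ n * exp (lam * s))).
      - intros k. apply H, Hs.
      - apply (is_lim_seq_abs _ (u s - un n s)). apply is_lim_seq_minus'; [|apply is_lim_seq_const].
        apply (is_lim_seq_ext (fun k => un (k + n)%nat s)).
        + intros k. f_equal. lia.
        + apply (is_lim_seq_incr_n (fun k => un k s)). apply Hu. lra.
      - apply is_lim_seq_const. }
    apply Rminus_diag_uniq. enough (Rabs (N u t - u t) <= 0) as E0.
    { pose proof (Rabs_pos (N u t - u t)). destruct (Req_dec (N u t - u t) 0) as [E|E]; [exact E|].
      pose proof (Rabs_pos_lt _ E). lra. }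
    (* Compare with the iterate [un (S n)], which is [N (un n)]. The two errors, one halved by the
       contraction and one by the shift of the index, are each at most
       [2 * M * (/ 2) ^ n * exp (lam * t)]. *)
    apply le_geom_half with (4 * M * exp (lam * t)). intros n.
    replace (N u t - u t) with ((N u t - N (un n) t) - (u t - un (S n) t)) by (change (un (S n)) with (N (un n)); ring).
    eapply Rle_trans; [apply Rabs_triang|]. rewrite Rabs_Ropp.
    pose proof (Hun (S n) t ltac:(lra)).
    assert (Rabs (N u t - N (un n) t) <= / 2 * (4 * M * (/ 2) ^ n) * exp (lam * t)).
    { apply Hc; auto; [|lra]. apply Rmult_le_pos; [lra|]. apply pow_le; lra. }
    simpl in *. lra.
  - intros u1 u2 C1 C2 E1 E2 t Ht.
    destruct (Hhalf t Ht) as [lam [Hlam H]].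
    assert (HH : forall n s, 0 <= s <= t -> Rabs (u1 s - u2 s) <= 2 * M * (/ 2) ^ n * exp (lam * s)).
    { induction n as [|n IH]; intros s Hs.
      - simpl. rewrite Rmult_1_r. apply (Hdiff t); auto.
      - rewrite <- E1, <- E2 by lra.
        eapply Rle_trans; [apply (H u1 u2 (2 * M * (/ 2) ^ n)); auto|simpl; right; ring].
        apply Rmult_le_pos; [lra|]. apply pow_le; lra. }
    apply Rminus_diag_uniq. enough (Rabs (u1 t - u2 t) <= 0) as E0.
    { pose proof (Rabs_pos (u1 t - u2 t)). destruct (Req_dec (u1 t - u2 t) 0) as [E|E]; [exact E|].
      pose proof (Rabs_pos_lt _ E). lra. }
    apply le_geom_half with (2 * M * exp (lam * t)). intros n.
    specialize (HH n t ltac:(lra)). lra.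
Qed.

(** * C^1 functions on the line and on the strip *)

Lemma C1_locBL (f df : R -> R) : (forall x, is_derive f x (df x)) -> (forall x, continuous df x) ->
  locBL f.
Proof.
  intros Hd Hc a b. destruct (Rle_dec a b) as [Hab|Hab].
  2: { exists 0. split; [lra|]. unfold seg. intros x Hx. lra. }
  assert (Hm : forall h : R -> R, (forall x, continuous h x) -> exists B, forall x, a <= x <= b -> Rabs (h x) <= B).
  { intros h Hh. destruct (continuity_ab_maj (fun x => Rabs (h x)) a b Hab) as [m [H1 _]].
    - intros x _. apply continuity_pt_filterlim. apply (continuous_comp h Rabs); [apply Hh|apply continuous_Rabs].
    - exists (Rabs (h m)). exact H1. }
  destruct (Hm df Hc) as [B HB].
  destruct (Hm f) as [B' HB'].
  { intros x. apply (ex_derive_continuous f). eexists. apply Hd. }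
  exists (Rabs B + Rabs B'). pose proof (Rabs_pos B). pose proof (Rabs_pos B').
  pose proof (Rle_abs B). pose proof (Rle_abs B').
  split; [lra|]. intros x Hx. split; [specialize (HB' x Hx); lra|].
  intros y Hy. unfold dR. pose proof (Rabs_pos (x - y)).
  eapply Rle_trans; [apply (is_derive_bound_Lip f df (Rabs B + Rabs B') a b); auto|lra].
  intros z Hz. specialize (HB z Hz). lra.
Qed.

Lemma is_derive_eps (f : R -> R) (x l : R) :
  is_derive f x l <->
   forall eps, 0 < eps -> exists del, 0 < del /\
     forall y, Rabs (y - x) < del -> Rabs (f y - f x - (y - x) * l) <= eps * Rabs (y - x).
Proof.
  split.
  - intros H eps Heps.
    apply (is_derive_is_derive_on (fun _ => True)) in H; [|exact I].
    rewrite is_derive_on_eps in H by exact I. destruct (H eps Heps) as [del [Hdel Hd]].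
    exists del. split; auto.
  - intros H. apply (is_derive_on_is_derive (fun _ => True)); [apply filter_forall; auto|].
    apply is_derive_on_eps; [exact I|]. intros eps Heps. destruct (H eps Heps) as [del [Hdel Hd]].
    exists del. split; auto.
Qed.

Lemma is_derive_increasing (f df : R -> R) : (forall x, is_derive f x (df x)) ->
  (forall x, 0 < df x) -> forall x y, x < y -> f x < f y.
Proof.
  intros Hd Hp x y Hxy. destruct (MVT_R f df x y Hxy) as [z [_ E]]; [intros; apply Hd|].
  specialize (Hp z). nra.
Qed.

(** The argument is local: the intermediate value theorem on [z0 - r, z0 + r] supplies the preimage
    of every [y] close to [F z0], and injectivity identifies it with the [iota]. *)
Lemma inverse_derive (F dF : R -> R) z0 : (forall z, is_derive F z (dF z)) -> (forall z, 0 < dF z) ->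
  is_derive (fun y => iota (fun z => F z = y)) (F z0) (/ dF z0).
Proof.
  intros Hd Hp.
  pose proof (is_derive_increasing F dF Hd Hp) as Hincr.
  assert (Hinj : forall x y, F x = F y -> x = y).
  { intros x y E. destruct (Rtotal_order x y) as [H|[H|H]]; [|exact H|]; apply Hincr in H; lra. }
  assert (Hinv : forall z, iota (fun z' => F z' = F z) = z).
  { intros z. apply iota_R_eq; [|reflexivity]. intros y Ey. apply Hinj, Ey. }
  set (l := dF z0). assert (Hl : 0 < l) by apply Hp.
  pose proof (proj1 (is_derive_eps F z0 l) (Hd z0)) as HF.
  destruct (HF (l / 2) ltac:(lra)) as [d0 [Hd0 H0]].
  apply is_derive_eps. intros eps Heps.
  (* One factor [l] pays for the division by [l]; the factor [l / 2] pays for passing from |z - z0|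
     to |F z - F z0| through [Hlow] below. *)
  assert (Heps2 : 0 < eps * (l * l / 2)) by (apply Rmult_lt_0_compat; nra).
  destruct (HF _ Heps2) as [d1 [Hd1 H1]].
  set (r := Rmin d0 d1 / 2).
  pose proof (Rmin_glb_lt d0 d1 0 Hd0 Hd1). pose proof (Rmin_l d0 d1). pose proof (Rmin_r d0 d1).
  assert (Hr : 0 < r) by (unfold r; lra).
  pose proof (Hincr (z0 - r) z0 ltac:(lra)) as I1. pose proof (Hincr z0 (z0 + r) ltac:(lra)) as I2.
  exists (Rmin (F z0 - F (z0 - r)) (F (z0 + r) - F z0)). split; [apply Rmin_glb_lt; lra|].
  intros y Hy.
  pose proof (Rmin_l (F z0 - F (z0 - r)) (F (z0 + r) - F z0)).
  pose proof (Rmin_r (F z0 - F (z0 - r)) (F (z0 + r) - F z0)).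
  apply Rabs_lt_between in Hy.
  destruct (IVT_gen F (z0 - r) (z0 + r) y) as [z [Hz E]].
  - intros z. apply continuity_pt_filterlim, (ex_derive_continuous F). eexists. apply Hd.
  - rewrite Rmin_left, Rmax_right by lra. lra.
  - rewrite Rmin_left, Rmax_right in Hz by lra. subst y. rewrite !Hinv.
    assert (Hzz : Rabs (z - z0) < Rmin d0 d1).
    { apply Rle_lt_trans with r; [apply Rabs_le; lra|unfold r; lra]. }
    specialize (H0 z ltac:(lra)). specialize (H1 z ltac:(lra)).
    assert (Hlow : l / 2 * Rabs (z - z0) <= Rabs (F z - F z0)).
    { replace (F z - F z0) with ((z - z0) * l - - (F z - F z0 - (z - z0) * l)) by ring.
      eapply Rle_trans; [|apply Rabs_triang_inv]. rewrite Rabs_Ropp, Rabs_mult, (Rabs_pos_eq l) by lra. lra. }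
    replace (z - z0 - (F z - F z0) * / l) with (- (F z - F z0 - (z - z0) * l) * / l) by (field; lra).
    rewrite Rabs_mult, Rabs_Ropp, (Rabs_pos_eq (/ l)) by (left; apply Rinv_0_lt_compat, Hl).
    apply Rmult_le_reg_r with l; [exact Hl|]. rewrite Rmult_assoc, Rinv_l, Rmult_1_r by lra.
    eapply Rle_trans; [exact H1|]. nra.
Qed.

Lemma is_derive_ext_interval (f h : R -> R) (a b x l : R) : a < x < b ->
  (forall y, a < y < b -> f y = h y) -> is_derive f x l -> is_derive h x l.
Proof.
  intros Hx E. apply is_derive_ext_loc.
  apply filter_imp with (2 := locally_open_interval a b x Hx). exact E.
Qed.

Lemma accum_strip1 t x : 0 <= t -> 0 <= x <= 1 -> accum (fun s => strip (s, x)) t.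
Proof.
  intros Ht Hx. apply accum_subset with (seg 0 (t + 1)).
  - unfold seg, strip; simpl. intros; lra.
  - apply accum_seg; lra.
Qed.

Lemma accum_strip2 t x : 0 <= t -> 0 <= x <= 1 -> accum (fun y => strip (t, y)) x.
Proof.
  intros Ht Hx. apply accum_subset with (seg 0 1).
  - unfold seg, strip; simpl. intros; lra.
  - apply accum_seg; lra.
Qed.

Lemma BL_continuous_on_strip f : (forall T, 0 <= T -> BL (rect 0 T 0 1) dRR (uncurry2 f)) ->
  continuous_on strip (uncurry2 f).
Proof.
  intros H [px py] [Hp1 Hp2]; simpl in Hp1, Hp2. destruct (H (px + 1) ltac:(lra)) as [B [HB HL]].
  apply filterlim_locally. intros eps.
  assert (He : 0 < eps / (2 * (B + 1))) by (apply Rdiv_lt_0_compat; [apply cond_pos|lra]).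
  assert (Hd : 0 < Rmin 1 (eps / (2 * (B + 1)))) by (apply Rmin_glb_lt; lra).
  exists (mkposreal _ Hd). intros [qx qy] [B1 B2] [Hq1 Hq2]; simpl in Hq1, Hq2.
  change (Rabs (qx - px) < Rmin 1 (eps / (2 * (B + 1)))) in B1.
  change (Rabs (qy - py) < Rmin 1 (eps / (2 * (B + 1)))) in B2.
  change (Rabs (f qx qy - f px py) < eps).
  pose proof (Rmin_l 1 (eps / (2 * (B + 1)))). pose proof (Rmin_r 1 (eps / (2 * (B + 1)))).
  assert (B3 : Rabs (qx - px) < 1) by lra. apply Rabs_lt_between in B3.
  destruct (HL (qx, qy)) as [_ HL2]; [unfold rect; simpl; lra|].
  specialize (HL2 (px, py) ltac:(unfold rect; simpl; lra)). unfold dRR, uncurry2 in HL2; simpl in HL2.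
  eapply Rle_lt_trans; [exact HL2|].
  apply Rle_lt_trans with (B * (2 * (eps / (2 * (B + 1))))).
  - apply Rmult_le_compat_l; lra.
  - pose proof (cond_pos eps).
    replace (B * (2 * (eps / (2 * (B + 1))))) with (eps * (B / (B + 1))) by (field; lra).
    apply Rmult_lt_reg_r with (B + 1); [lra|].
    replace (eps * (B / (B + 1)) * (B + 1)) with (eps * B) by (field; lra). nra.
Qed.

(** The half-planes on which [fst p < INR n] form an open cover; the largest index of a finite
    subcover bounds the time. *)
Lemma compact_strip_bounded (S : R * R -> Prop) : compact_set S -> (forall p, S p -> strip p) ->
  exists T, 0 <= T /\ forall p, S p -> rect 0 T 0 1 p.
Proof.
  intros HS Hst.
  destruct (HS nat (fun n p => fst p < INR n)) as [l Hl].
  - intros n [x y] Hxy. simpl in Hxy.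
    assert (Hd : 0 < INR n - x) by lra. exists (mkposreal _ Hd). intros [x' y'] [B1 _].
    change (Rabs (x' - x) < INR n - x) in B1. simpl. apply Rabs_lt_between in B1. lra.
  - intros p _. destruct (INR_unbounded (fst p)) as [n Hn]. exists n. exact Hn.
  - exists (fold_right Rmax 0 (map INR l)).
    assert (H0 : forall l : list nat, 0 <= fold_right Rmax 0 (map INR l)).
    { induction l0 as [|n l0 IH]; simpl; [lra|]. eapply Rle_trans; [exact IH|apply Rmax_r]. }
    split; [apply H0|]. intros p Sp. destruct (Hst p Sp) as [H1 H2].
    destruct (Hl p Sp) as [n [Hn Hlt]].
    assert (H3 : forall l : list nat, In n l -> INR n <= fold_right Rmax 0 (map INR l)).
    { induction l0 as [|k l0 IH]; simpl; [tauto|]. intros [->|Hin]; [apply Rmax_l|].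
      eapply Rle_trans; [apply IH, Hin|apply Rmax_r]. }
    simpl in Hlt. specialize (H3 l Hn). unfold rect. lra.
Qed.

Lemma dRR_le_norm (p1 p2 q1 q2 : R) :
  dRR (p1, p2) (q1, q2) <= 2 * norm (minus (p1, p2) (q1, q2)).
Proof.
  pose proof (proj1 (norm_prod (p1 - q1) (p2 - q2))) as HN.
  change (norm (p1 - q1, p2 - q2)) with (norm (minus (p1, p2) (q1, q2))) in HN.
  change (norm (p1 - q1)) with (Rabs (p1 - q1)) in HN.
  change (norm (p2 - q2)) with (Rabs (p2 - q2)) in HN.
  pose proof (Rmax_l (Rabs (p1 - q1)) (Rabs (p2 - q2))).
  pose proof (Rmax_r (Rabs (p1 - q1)) (Rabs (p2 - q2))).
  unfold dRR; simpl fst; simpl snd. set (n := norm (minus (p1, p2) (q1, q2))) in *. lra.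
Qed.

Lemma BL_lipschitz_on (S : R * R -> Prop) (f : R * R -> R) : BL S dRR f -> lipschitz_on S f.
Proof.
  intros [B [HB H]]. exists (B * 2). intros [p1 p2] [q1 q2] Hp Hq.
  destruct (H (p1, p2) Hp) as [_ HL]. eapply Rle_trans; [exact (HL (q1, q2) Hq)|].
  rewrite Rmult_assoc. apply Rmult_le_compat_l; [exact HB|apply dRR_le_norm].
Qed.

(** The hypotheses ask for ordinary derivatives even on the edges of the strip, which the
    constructed solution has because it is defined beyond the strip. Local Lipschitz bounds then
    yield both the continuity required by [Ck] and the Lipschitz claim on compact sets. *)
Lemma strip_C1 (f f1 f2 : R -> R -> R) :
  (forall t x, 0 <= t -> 0 <= x <= 1 -> is_derive (fun s => f s x) t (f1 t x)) ->
  (forall t x, 0 <= t -> 0 <= x <= 1 -> is_derive (fun y => f t y) x (f2 t x)) ->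
  (forall T, 0 <= T -> BL (rect 0 T 0 1) dRR (uncurry2 f)) ->
  (forall T, 0 <= T -> BL (rect 0 T 0 1) dRR (uncurry2 f1)) ->
  (forall T, 0 <= T -> BL (rect 0 T 0 1) dRR (uncurry2 f2)) ->
  Ck 1 strip f /\
  (forall t x, 0 <= t -> 0 <= x <= 1 -> partial1 strip f t x = f1 t x /\ partial2 strip f t x = f2 t x) /\
  (forall S, compact_set S -> (forall p, S p -> strip p) ->
     lipschitz_on S (uncurry2 (partial1 strip f)) /\ lipschitz_on S (uncurry2 (partial2 strip f))).
Proof.
  intros Hd1 Hd2 B0 B1 B2.
  assert (P : forall t x, 0 <= t -> 0 <= x <= 1 ->
    is_derive_on (fun s => strip (s, x)) (fun s => f s x) t (f1 t x) /\
    is_derive_on (fun y => strip (t, y)) (fun y => f t y) x (f2 t x)).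
  { intros t x Ht Hx. split; apply is_derive_is_derive_on; auto; split; simpl; lra. }
  assert (E : forall t x, 0 <= t -> 0 <= x <= 1 ->
    partial1 strip f t x = f1 t x /\ partial2 strip f t x = f2 t x).
  { intros t x Ht Hx. destruct (P t x Ht Hx). split; apply Derive_on_eq; auto.
    - apply accum_strip1; assumption.
    - apply accum_strip2; assumption. }
  split; [|split; [exact E|]].
  - split; [apply BL_continuous_on_strip, B0|]. split; [|split; (split; [|exact I])].
    + intros [t x] [Ht Hx]. destruct (P t x Ht Hx). split; eexists; eassumption.
    + apply continuous_on_ext with (uncurry2 f1).
      * intros [t x] [Ht Hx]. symmetry. apply (E t x Ht Hx).
      * apply BL_continuous_on_strip, B1.
    + apply continuous_on_ext with (uncurry2 f2).
      * intros [t x] [Ht Hx]. symmetry. apply (E t x Ht Hx).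
      * apply BL_continuous_on_strip, B2.
  - intros S HS Hst. destruct (compact_strip_bounded S HS Hst) as [T [HT HR]].
    split; apply BL_lipschitz_on; apply BL_subset with (rect 0 T 0 1); auto.
    + apply BL_ext with (uncurry2 f1); [|apply B1, HT].
      intros [t x] [[Ht _] Hx]. symmetry. apply (E t x Ht Hx).
    + apply BL_ext with (uncurry2 f2); [|apply B2, HT].
      intros [t x] [[Ht _] Hx]. symmetry. apply (E t x Ht Hx).
Qed.

Lemma continuous_on_curve (U : R * R -> Prop) f (X Y : R -> R) a b : a <= b ->
  continuous_on U (uncurry2 f) -> (forall s, a <= s <= b -> U (X s, Y s)) ->
  (forall s, continuous X s) -> (forall s, continuous Y s) ->
  forall s, continuous (fun s => f (X (clamp a b s)) (Y (clamp a b s))) s.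
Proof.
  intros Hab Hf HU HX HY s. apply filterlim_locally. intros eps.
  pose proof (clamp_in a b s Hab) as Hs.
  destruct (Hf _ (HU _ Hs) _ (locally_ball _ eps)) as [del Hd].
  assert (HX' : continuous (fun s => X (clamp a b s)) s)
    by (apply (continuous_comp (clamp a b) X); [apply continuous_clamp|apply HX]).
  assert (HY' : continuous (fun s => Y (clamp a b s)) s)
    by (apply (continuous_comp (clamp a b) Y); [apply continuous_clamp|apply HY]).
  pose proof (HX' _ (locally_ball _ del)) as LX. pose proof (HY' _ (locally_ball _ del)) as LY.
  unfold filtermap in LX, LY.
  apply filter_imp with (2 := filter_and _ _ LX LY). intros r [B1 B2].
  apply (Hd (X (clamp a b r), Y (clamp a b r))).
  - split; assumption.
  - apply HU, clamp_in, Hab.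
Qed.

(** The method of characteristics. The equation is used only at interior points of the strip, where
    the chain rule is two-sided; continuity carries the conclusion to end points on the boundary. *)
Lemma strip_curve_const f (X Y dX dY : R -> R) a b : a <= b -> Ck 1 strip f ->
  (forall s, a <= s <= b -> strip (X s, Y s)) ->
  (forall s, is_derive X s (dX s)) -> (forall s, is_derive Y s (dY s)) ->
  (forall s, a < s < b -> 0 < X s /\ 0 < Y s < 1) ->
  (forall s, a < s < b ->
     dX s * partial1 strip f (X s) (Y s) + dY s * partial2 strip f (X s) (Y s) = 0) ->
  f (X b) (Y b) = f (X a) (Y a).
Proof.
  intros Hab Hf HU HX HY Hint H0.
  apply (derive_0_const (fun s => f (X s) (Y s)) a b Hab).
  - apply (continuous_on_curve strip); auto.
    + apply Hf.
    + intros s. apply (ex_derive_continuous X). eexists. apply HX.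
    + intros s. apply (ex_derive_continuous Y). eexists. apply HY.
  - intros s Hs. destruct (Hint s Hs) as [H1 H2]. eapply is_derive_eq.
    + apply (C1_chain strip f 0 (X s + 1) 0 1 X Y s (dX s) (dY s)); auto; [|lra].
      intros p [P1 P2]. unfold strip. lra.
    + apply H0, Hs.
Qed.

Lemma nonincreasing_clamp (f df : R -> R) b :
  (forall x, continuous (fun y => f (clamp 0 b y)) x) -> 0 <= b ->
  (forall x, 0 < x < b -> is_derive f x (df x)) -> (forall x, 0 < x < b -> df x <= 0) -> f b <= f 0.
Proof.
  intros Hc Hb Hd Hp. destruct (Req_dec 0 b) as [<-|N]; [lra|].
  destruct (MVT_clamp f df 0 b ltac:(lra) Hc Hd) as [x [Hx E]]. specialize (Hp x Hx). nra.
Qed.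

(** A Lipschitz bound for the inverse of [f]. It is restricted to a half-line because it is meant
    for [foot_charac], whose slope bound from below decays as [T] grows. *)
Lemma inv_Lip (f df : R -> R) T del : 0 < del -> (forall x, is_derive f x (df x)) ->
  (forall x, x <= T -> del <= df x) ->
  forall x y, x <= T -> y <= T -> del * Rabs (x - y) <= Rabs (f x - f y).
Proof.
  intros Hdel Hd Hp.
  assert (W : forall x y, x <= T -> y <= T -> x < y -> del * Rabs (x - y) <= Rabs (f x - f y)).
  { intros x y Hx Hy Hxy. destruct (MVT_R f df x y Hxy) as [z [Hz E]]; [intros; apply Hd|].
    specialize (Hp z ltac:(lra)).
    rewrite (Rabs_minus_sym x), (Rabs_minus_sym (f x)), E, Rabs_mult, (Rabs_pos_eq (df z)) by lra.
    apply Rmult_le_compat_r; [apply Rabs_pos|lra]. }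
  intros x y Hx Hy. destruct (Rtotal_order x y) as [H|[->|H]].
  - auto.
  - rewrite !Rminus_diag, Rabs_R0. lra.
  - rewrite (Rabs_minus_sym (f x)), (Rabs_minus_sym x). auto.
Qed.

(** * The fixed-point equation for [v t 1] *)

Section Characteristics.
Variables (a g : R -> R -> R) (c mu vmax : R) (theta phi : R -> R) (m0 M Lphi Ltheta : R).
Hypotheses (Ha : Ck 1 dom_a a) (Hg : Ck 1 dom_g g) (Hc : 0 < c) (Hmu : 0 <= mu).
Hypothesis Hgb : forall v w, 0 <= v -> 0 < g 0 w /\ g 0 w <= g v w /\ g v w <= vmax.
Hypotheses (Hm0 : 0 < m0) (HM : vmax <= M).
Hypothesis Hphib : forall x, 0 <= x <= 1 -> m0 <= phi x <= M.
Hypothesis Hphil : forall x y,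
  Rabs (phi (clamp 0 1 x) - phi (clamp 0 1 y)) <= Lphi * Rabs (x - y).
Hypothesis Hthetal : forall x y,
  Rabs (theta (clamp 0 1 x) - theta (clamp 0 1 y)) <= Ltheta * Rabs (x - y).
Hypothesis Hcompat : theta 0 = a 0 (phi 0).

(** A class stable under [duhamel] and under pointwise limits on nonnegative times. Its lower bound
    uses only that [g] is positive; its Lipschitz constant comes from u' = mu (g - u) with [g] and
    [u] both in [0, M]. *)
Definition admissible (u : R -> R) : Prop :=
  u 0 = phi 1 /\
  (forall t, 0 <= t -> phi 1 * exp (- mu * t) <= u t <= M) /\
  (forall s t, 0 <= s -> 0 <= t -> Rabs (u s - u t) <= mu * M * Rabs (s - t)).

(* [hist u s] is the value of [v] on the line [t + x / c = s] when [v t 1 = u t]. *)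
Definition hist (u : R -> R) (s : R) : R :=
  phi (clamp 0 1 (c * s)) + (u (Rmax 0 (s - / c)) - phi 1).

Definition kap (u : R -> R) (s : R) : R := hist u s / (c + hist u s).
Definition Sig (u : R -> R) (s : R) : R := RInt (kap u) 0 s.

(* The characteristics of [w] are the level lines of [charac u]. *)
Definition charac (u : R -> R) (t x : R) : R := Sig u (t + x / c) - x / c.

(* [foot_charac u z] is the level of the characteristic issued from [(z, 0)] when [z >= 0]
   and from [(0, - phi 0 * z)] when [z <= 0]; this scale makes it C^1 at 0. *)
Definition rho (u : R -> R) (z : R) : R :=
  hist u z / (c + (hist u z + (phi (clamp 0 1 (- phi 0 * z)) - phi 0))).
Definition foot_charac (u : R -> R) (z : R) : R := RInt (rho u) 0 z.
Definition foot (u : R -> R) (t x : R) : R := iota (fun z => foot_charac u z = charac u t x).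

(** Gluing by addition: on each side of 0 one of the two terms is frozen at its value at 0, and the
    subtracted constant is the value common to both at the corner. *)
Definition datum (u : R -> R) (z : R) : R :=
  theta (clamp 0 1 (- phi 0 * z)) + (a (Rmax 0 z) (hist u (Rmax 0 z)) - a 0 (phi 0)).
Definition wsol (u : R -> R) (t x : R) : R := datum u (foot u t x).

(** The source term of the boundary equation; [Rmax 0] freezes it at negative times, so that the
    integrand in [duhamel] is continuous on the whole line. *)
Definition Gw (u : R -> R) (s : R) : R := g (u (Rmax 0 s)) (wsol u (Rmax 0 s) 1).
Definition duhamel (u : R -> R) (t : R) : R :=
  exp (- mu * t) * (phi 1 + RInt (fun s => mu * exp (mu * s) * Gw u s) 0 t).

Lemma phi_01 : m0 <= phi 0 <= M /\ m0 <= phi 1 <= M.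
Proof. split; apply Hphib; lra. Qed.

Lemma phic_bounds x : m0 <= phi (clamp 0 1 x) <= M.
Proof. apply Hphib, clamp_in. lra. Qed.

Lemma clamp01_lo x : x <= 0 -> clamp 0 1 x = 0.
Proof. intros. unfold clamp, Rmax, Rmin. repeat destruct Rle_dec; lra. Qed.

Lemma clamp01_hi x : 1 <= x -> clamp 0 1 x = 1.
Proof. intros. unfold clamp, Rmax, Rmin. repeat destruct Rle_dec; lra. Qed.

Lemma exp_decr t T : t <= T -> exp (- mu * T) <= exp (- mu * t).
Proof.
  intros H. destruct (Req_dec (- mu * T) (- mu * t)) as [->|N]; [lra|].
  left. apply exp_increasing. assert (mu * t <= mu * T) by (apply Rmult_le_compat_l; lra). lra.
Qed.

Lemma exp_le_1 T : 0 <= T -> exp (- mu * T) <= 1.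
Proof. intros H. pose proof (exp_decr 0 T H) as E. rewrite Rmult_0_r, exp_0 in E. exact E. Qed.

Section OneBoundaryValue.
Variable u : R -> R.
Hypothesis Hu : admissible u.

Lemma hist_lo s : s <= / c -> hist u s = phi (clamp 0 1 (c * s)).
Proof.
  intros H. unfold hist. rewrite Rmax_left by lra.
  destruct Hu as [-> _]. ring.
Qed.

Lemma hist_hi s : / c <= s -> hist u s = u (s - / c).
Proof.
  intros H. unfold hist. rewrite Rmax_right by lra. rewrite clamp01_hi; [ring|].
  apply Rmult_le_compat_l with (r := c) in H; [|lra]. rewrite Rinv_r in H; lra.
Qed.

Lemma hist_neg s : s <= 0 -> hist u s = phi 0.
Proof.
  intros H. pose proof (Rinv_0_lt_compat _ Hc). rewrite hist_lo by lra.
  rewrite clamp01_lo; [reflexivity|]. nra.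
Qed.

Lemma hist_bounds T s : 0 <= T -> s <= T + / c -> m0 * exp (- mu * T) <= hist u s <= M.
Proof.
  intros HT Hs. pose proof phi_01 as [_ [P1 P2]]. pose proof (exp_pos (- mu * T)).
  pose proof (exp_le_1 T HT).
  destruct (Rle_dec s (/ c)) as [H1|H1].
  - rewrite hist_lo by exact H1. pose proof (phic_bounds (c * s)). nra.
  - rewrite hist_hi by lra. destruct Hu as [_ [H2 _]].
    specialize (H2 (s - / c) ltac:(lra)). pose proof (exp_decr (s - / c) T ltac:(lra)).
    split; [|tauto]. apply Rle_trans with (phi 1 * exp (- mu * (s - / c))); [nra|tauto].
Qed.

Lemma hist_pos s : 0 < hist u s.
Proof.
  pose proof (Rinv_0_lt_compat _ Hc).
  pose proof (hist_bounds (Rmax 0 s) s (Rmax_l _ _)) as B. pose proof (Rmax_r 0 s).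
  pose proof (exp_pos (- mu * Rmax 0 s)). specialize (B ltac:(lra)). nra.
Qed.

Lemma hist_le s : hist u s <= M.
Proof.
  pose proof (Rinv_0_lt_compat _ Hc).
  apply (hist_bounds (Rmax 0 s) s (Rmax_l _ _)). pose proof (Rmax_r 0 s). lra.
Qed.

Lemma muM_ge0 : 0 <= mu * M.
Proof. pose proof phi_01. apply Rmult_le_pos; lra. Qed.

Lemma hist_Lip s t : Rabs (hist u s - hist u t) <= (Lphi * c + mu * M) * Rabs (s - t).
Proof.
  unfold hist. destruct Hu as [_ [_ H]].
  replace (phi (clamp 0 1 (c * s)) + (u (Rmax 0 (s - / c)) - phi 1) -
    (phi (clamp 0 1 (c * t)) + (u (Rmax 0 (t - / c)) - phi 1))) with
    ((phi (clamp 0 1 (c * s)) - phi (clamp 0 1 (c * t))) +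
     (u (Rmax 0 (s - / c)) - u (Rmax 0 (t - / c)))) by ring.
  eapply Rle_trans; [apply Rabs_triang|]. rewrite Rmult_plus_distr_r. apply Rplus_le_compat.
  - eapply Rle_trans; [apply Hphil|]. rewrite <- Rmult_minus_distr_l, Rabs_mult, (Rabs_pos_eq c) by lra.
    lra.
  - eapply Rle_trans; [apply H; apply Rmax_l|].
    apply Rmult_le_compat_l; [apply muM_ge0|].
    eapply Rle_trans; [apply Rmax_lip|]. right. f_equal. ring.
Qed.

Lemma hist_locBL : locBL (hist u).
Proof. eapply locBL_Lip. apply hist_Lip. Qed.

Lemma kap_bounds s : 0 < kap u s < 1.
Proof.
  unfold kap. pose proof (hist_pos s). split; [apply Rdiv_lt_0_compat; lra|].
  apply Rmult_lt_reg_r with (c + hist u s); [lra|]. field_simplify; lra.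
Qed.

Lemma kap_locBL : locBL (kap u).
Proof.
  intros x y. apply (BL_div _ _ dR_ge0 (hist u) (fun s => c + hist u s) c); [lra| | |].
  - intros s _. pose proof (hist_pos s). lra.
  - apply hist_locBL.
  - apply BL_plus; [apply BL_const, dR_ge0|apply hist_locBL].
Qed.

(** For z <= 0 the term [hist u z] is frozen at [phi 0], for z >= 0 the clamped term is; the sum
    thus selects the branch without a case distinction, and continuously. *)
Lemma rho_den z : hist u z + (phi (clamp 0 1 (- phi 0 * z)) - phi 0) =
  if Rle_dec 0 z then hist u z else phi (clamp 0 1 (- phi 0 * z)).
Proof.
  pose proof phi_01. destruct Rle_dec as [H1|H1].
  - rewrite clamp01_lo by nra. ring.
  - rewrite hist_neg by lra. ring.
Qed.

Lemma rho_den_bounds z : 0 < hist u z + (phi (clamp 0 1 (- phi 0 * z)) - phi 0) <= M.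
Proof.
  rewrite rho_den. destruct Rle_dec.
  - split; [apply hist_pos|apply hist_le].
  - pose proof (phic_bounds (- phi 0 * z)). lra.
Qed.

Lemma rho_kap z : 0 <= z -> rho u z = kap u z.
Proof. intros H. unfold rho, kap. rewrite rho_den. destruct Rle_dec; [reflexivity|lra]. Qed.

Lemma rho_neg z : z <= 0 -> rho u z = phi 0 / (c + phi (clamp 0 1 (- phi 0 * z))).
Proof. intros H. unfold rho. rewrite hist_neg by exact H. f_equal. f_equal. ring. Qed.

Lemma rho_lower T z : 0 <= T -> z <= T -> m0 * exp (- mu * T) / (c + M) <= rho u z.
Proof.
  intros HT Hz. unfold rho. pose proof (rho_den_bounds z). pose proof phi_01.
  pose proof (Rinv_0_lt_compat _ Hc).
  pose proof (hist_bounds T z HT ltac:(lra)). pose proof (exp_pos (- mu * T)).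
  apply Rmult_le_compat; [nra| |tauto|].
  - left. apply Rinv_0_lt_compat. lra.
  - apply Rinv_le_contravar; lra.
Qed.

Lemma rho_pos z : 0 < rho u z.
Proof.
  unfold rho. pose proof (rho_den_bounds z). pose proof (hist_pos z).
  apply Rdiv_lt_0_compat; lra.
Qed.

Lemma phic_scaled_locBL k : locBL (fun z => phi (clamp 0 1 (k * z))).
Proof.
  apply locBL_Lip with (Lphi * Rabs k). intros x y.
  eapply Rle_trans; [apply Hphil|]. rewrite <- Rmult_minus_distr_l, Rabs_mult. lra.
Qed.

Lemma rho_locBL : locBL (rho u).
Proof.
  intros x y.
  apply (BL_div _ _ dR_ge0 (hist u)
    (fun z => c + (hist u z + (phi (clamp 0 1 (- phi 0 * z)) - phi 0))) c); [lra| | |].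
  - intros z _. pose proof (rho_den_bounds z). lra.
  - apply hist_locBL.
  - apply BL_plus; [apply BL_const, dR_ge0|]. apply BL_plus; [apply hist_locBL|].
    apply BL_minus; [apply dR_ge0|apply phic_scaled_locBL|apply BL_const, dR_ge0].
Qed.

Lemma Sig_derive s : is_derive (Sig u) s (kap u s).
Proof. apply is_derive_primitive, locBL_continuous, kap_locBL. Qed.

Lemma foot_charac_derive z : is_derive (foot_charac u) z (rho u z).
Proof. apply is_derive_primitive, locBL_continuous, rho_locBL. Qed.

Lemma Sig_0 : Sig u 0 = 0.
Proof. unfold Sig. rewrite RInt_point. reflexivity. Qed.

Lemma foot_charac_0 : foot_charac u 0 = 0.
Proof. unfold foot_charac. rewrite RInt_point. reflexivity. Qed.

Lemma Sig_diff s t : s <= t -> 0 <= Sig u t - Sig u s <= t - s.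
Proof.
  intros H. destruct (Req_dec s t) as [->|N]; [lra|].
  destruct (MVT_R (Sig u) (kap u) s t ltac:(lra)) as [z [_ ->]]; [intros; apply Sig_derive|].
  pose proof (kap_bounds z). nra.
Qed.

Lemma Sig_Lip s t : Rabs (Sig u s - Sig u t) <= Rabs (s - t).
Proof.
  destruct (Rle_dec s t) as [H|H].
  - pose proof (Sig_diff s t H). rewrite Rabs_minus_sym, (Rabs_minus_sym s), !Rabs_pos_eq; lra.
  - pose proof (Sig_diff t s ltac:(lra)). rewrite !Rabs_pos_eq; lra.
Qed.

Lemma foot_charac_Sig z : 0 <= z -> foot_charac u z = Sig u z.
Proof.
  intros H. apply RInt_ext. intros s Hs. rewrite Rmin_left in Hs by lra.
  apply rho_kap. lra.
Qed.

(** Both sides vanish at y = 0 and have derivative - 1 / (c + phi y) in [y]: the factor [phi 0] in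
    [rho] cancels against the scaling z = - y / phi 0. *)
Lemma foot_charac_neg y : 0 <= y <= 1 -> foot_charac u (- / phi 0 * y) = charac u 0 y.
Proof.
  intros Hy. pose proof phi_01 as [[P0 _] _].
  assert (I0 : 0 < / phi 0) by (apply Rinv_0_lt_compat; lra).
  assert (Hd : forall x, is_derive (fun y => foot_charac u (- / phi 0 * y + 0) - (Sig u (/ c * y + 0) - (/ c * y + 0))) x
     (rho u (- / phi 0 * x + 0) * - / phi 0 - (kap u (/ c * x + 0) * / c - / c))).
  { intros x. apply is_derive_R_minus; [|apply is_derive_R_minus].
    - apply (is_derive_R_comp (fun y => - / phi 0 * y + 0)); [apply is_derive_R_affine|apply foot_charac_derive].
    - apply (is_derive_R_comp (fun y => / c * y + 0)); [apply is_derive_R_affine|apply Sig_derive].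
    - apply is_derive_R_affine. }
  enough (E : foot_charac u (- / phi 0 * y + 0) - (Sig u (/ c * y + 0) - (/ c * y + 0)) =
    foot_charac u (- / phi 0 * 0 + 0) - (Sig u (/ c * 0 + 0) - (/ c * 0 + 0))).
  { rewrite !Rmult_0_r, !Rplus_0_r, foot_charac_0, Sig_0 in E. unfold charac.
    rewrite Rplus_0_l. unfold Rdiv. rewrite (Rmult_comm y). lra. }
  apply (derive_0_const (fun y => foot_charac u (- / phi 0 * y + 0) - (Sig u (/ c * y + 0) - (/ c * y + 0))) 0 y); [lra| |].
  - intros x. apply (continuous_comp (clamp 0 y) (fun y => foot_charac u (- / phi 0 * y + 0) - (Sig u (/ c * y + 0) - (/ c * y + 0)))).
    + apply continuous_clamp.
    + apply (ex_derive_continuous (fun y => foot_charac u (- / phi 0 * y + 0) - (Sig u (/ c * y + 0) - (/ c * y + 0)))).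
      eexists. apply Hd.
  - intros x Hx. eapply is_derive_eq; [apply Hd|].
    rewrite !Rplus_0_r. pose proof (Rinv_0_lt_compat _ Hc).
    rewrite rho_neg by nra. unfold kap. rewrite hist_lo by nra.
    replace (- phi 0 * (- / phi 0 * x)) with x by (field; lra).
    replace (c * (/ c * x)) with x by (field; lra).
    pose proof (phic_bounds x). field. lra.
Qed.

Lemma foot_charac_increasing x y : x < y -> foot_charac u x < foot_charac u y.
Proof. apply (is_derive_increasing _ (rho u)); [apply foot_charac_derive|apply rho_pos]. Qed.

Lemma foot_charac_inj x y : foot_charac u x = foot_charac u y -> x = y.
Proof.
  intros E. destruct (Rtotal_order x y) as [H|[H|H]]; [|exact H|];
  apply foot_charac_increasing in H; lra.
Qed.

Lemma charac_t0 t : charac u t 0 = Sig u t.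
Proof. unfold charac. replace (0 / c) with 0 by (unfold Rdiv; ring). rewrite Rplus_0_r. ring. Qed.

Lemma div_c_bounds x : 0 <= x <= 1 -> 0 <= x / c <= / c.
Proof.
  intros H. pose proof (Rinv_0_lt_compat _ Hc). unfold Rdiv. nra.
Qed.

(** Since [Sig] has slope between 0 and 1, levels increase with [t] and decrease with [x]. The level
    of (t, x) therefore lies between those of the corner (0, 1) and of (t, 0), whose parameters are
    [- / phi 0] and [t]. The bound [foot u t x <= t] is the causality of the construction. *)
Lemma foot_spec t x : 0 <= t -> 0 <= x <= 1 ->
  - / phi 0 <= foot u t x <= t /\ foot_charac u (foot u t x) = charac u t x.
Proof.
  intros Ht Hx. pose proof phi_01 as [[P0 _] _].
  assert (I0 : 0 < / phi 0) by (apply Rinv_0_lt_compat; lra).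
  pose proof (div_c_bounds x Hx) as Hxc.
  assert (H1 : foot_charac u (- / phi 0) <= charac u t x).
  { replace (- / phi 0) with (- / phi 0 * 1) by ring. rewrite foot_charac_neg by lra.
    unfold charac. rewrite Rplus_0_l. replace (1 / c) with (/ c) by (unfold Rdiv; ring).
    pose proof (Sig_diff (x / c) (/ c) ltac:(lra)). pose proof (Sig_diff (x / c) (t + x / c) ltac:(lra)). lra. }
  assert (H2 : charac u t x <= foot_charac u t).
  { rewrite foot_charac_Sig by exact Ht. unfold charac. pose proof (Sig_diff t (t + x / c) ltac:(lra)). lra. }
  assert (H3 : foot_charac u (- / phi 0) <= foot_charac u t) by lra.
  destruct (IVT_gen (foot_charac u) (- / phi 0) t (charac u t x)) as [z [Hz E]].
  - intros z. apply continuity_pt_filterlim, (ex_derive_continuous (foot_charac u)).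
    eexists. apply foot_charac_derive.
  - rewrite Rmin_left, Rmax_right by lra. lra.
  - rewrite Rmin_left, Rmax_right in Hz by lra.
    assert (foot u t x = z) as ->; [|auto].
    apply iota_R_eq; [|exact E]. intros y Ey. apply foot_charac_inj. lra.
Qed.

Lemma foot_eq t x z : foot_charac u z = charac u t x -> foot u t x = z.
Proof.
  intros E. apply iota_R_eq; [|exact E]. intros y Ey. apply foot_charac_inj. lra.
Qed.

Lemma charac_BL T : BL (rect 0 T 0 1) dRR (uncurry2 (charac u)).
Proof.
  assert (HS : locBL (Sig u)).
  { apply locBL_Lip with 1. intros. rewrite Rmult_1_l. apply Sig_Lip. }
  pose proof (Rinv_0_lt_compat _ Hc).
  unfold uncurry2, charac. apply BL_minus; auto.
  - apply (BL_comp _ _ dRR_ge0 (Sig u) (fun p => fst p + snd p / c) 0 (T + / c)).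
    + apply HS.
    + intros p [Hp1 Hp2]. pose proof (div_c_bounds _ Hp2). lra.
    + apply BL_plus; [apply BL_fst|]. apply BL_mult; [apply BL_snd|apply BL_const; auto].
  - apply BL_mult; [apply BL_snd|apply BL_const; auto].
Qed.

(** Levels are Lipschitz in (t, x), and by [foot_spec] all feet stay in z <= T, where the slope of
    [foot_charac] is at least [del]. *)
Lemma foot_BL T : 0 <= T -> BL (rect 0 T 0 1) dRR (uncurry2 (foot u)).
Proof.
  intros HT. pose proof phi_01 as [[P0 _] _].
  assert (I0 : 0 < / phi 0) by (apply Rinv_0_lt_compat; lra).
  set (del := m0 * exp (- mu * T) / (c + M)).
  assert (Hdel : 0 < del).
  { pose proof phi_01. apply Rdiv_lt_0_compat; [|lra]. apply Rmult_lt_0_compat; [lra|apply exp_pos]. }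
  destruct (charac_BL T) as [B [HB H]].
  assert (HBd : 0 <= B / del) by (apply Rle_div_r; lra).
  exists (T + / phi 0 + B / del). split; [lra|]. intros [t x] [Ht Hx]; simpl in Ht, Hx.
  unfold uncurry2 in *; simpl.
  destruct (foot_spec t x (proj1 Ht) Hx) as [S1 S2]. split; [apply Rabs_le; lra|].
  intros [t' x'] [Ht' Hx']; simpl in *.
  destruct (foot_spec t' x' (proj1 Ht') Hx') as [S1' S2'].
  destruct (H (t, x) (conj Ht Hx)) as [_ H1]. specialize (H1 (t', x') (conj Ht' Hx')). simpl in H1.
  rewrite <- S2, <- S2' in H1.
  pose proof (inv_Lip (foot_charac u) (rho u) T del Hdel foot_charac_derive
    (fun z Hz => rho_lower T z HT Hz) (foot u t x) (foot u t' x') ltac:(lra) ltac:(lra)) as H2.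
  pose proof (dRR_ge0 (t, x) (t', x')).
  apply Rle_trans with (B / del * dRR (t, x) (t', x')); [|nra].
  apply Rmult_le_reg_l with del; [exact Hdel|].
  replace (del * (B / del * dRR (t, x) (t', x'))) with (B * dRR (t, x) (t', x')) by (field; lra).
  lra.
Qed.

Lemma foot_range T p : rect 0 T 0 1 p -> - / phi 0 <= uncurry2 (foot u) p <= T.
Proof.
  intros [H1 H2]. destruct (foot_spec (fst p) (snd p) ltac:(lra) H2) as [H3 _].
  unfold uncurry2. lra.
Qed.

Lemma thetac_scaled_locBL k : locBL (fun z => theta (clamp 0 1 (k * z))).
Proof.
  apply locBL_Lip with (Ltheta * Rabs k). intros x y.
  eapply Rle_trans; [apply Hthetal|]. rewrite <- Rmult_minus_distr_l, Rabs_mult. lra.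
Qed.

Lemma Rmax0_locBL : locBL (Rmax 0).
Proof. apply (locBL_Lip (Rmax 0) 1). intros. rewrite Rmult_1_l. apply Rmax_lip. Qed.

Lemma a_BL T : 0 <= T -> BL (rect 0 T 0 M) dRR (uncurry2 a).
Proof.
  intros HT. pose proof phi_01. apply (Ck_1_rect_BL dom_a); [lra|lra| |exact Ha].
  intros p [H1 H2]. unfold dom_a. lra.
Qed.

Lemma datum_BL b T : 0 <= T -> BL (seg b T) dR (datum u).
Proof.
  intros HT. unfold datum. apply BL_plus; [apply thetac_scaled_locBL|].
  apply BL_minus; [auto| |apply BL_const; auto].
  apply (BL_comp2 _ _ dR_ge0 a (Rmax 0) (fun z => hist u (Rmax 0 z)) 0 T 0 M).
  - apply a_BL, HT.
  - intros z [Hz1 Hz2]. split; [apply Rmax_l|apply Rmax_lub; lra].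
  - intros z _. split; [left; apply hist_pos|apply hist_le].
  - apply Rmax0_locBL.
  - apply (locBL_comp (hist u)); [apply hist_locBL|apply Rmax0_locBL].
Qed.

Lemma wsol_BL T : 0 <= T -> BL (rect 0 T 0 1) dRR (uncurry2 (wsol u)).
Proof.
  intros HT. apply (BL_comp _ _ dRR_ge0 (datum u) (uncurry2 (foot u)) (- / phi 0) T).
  - apply datum_BL, HT.
  - apply foot_range.
  - apply foot_BL, HT.
Qed.

Lemma u_BL T : BL (seg 0 T) dR u.
Proof.
  destruct Hu as [_ [H1 H2]]. pose proof phi_01. pose proof muM_ge0.
  exists (M + mu * M). split; [lra|]. intros x [Hx Hx']. split.
  - specialize (H1 x Hx). pose proof (exp_pos (- mu * x)).
    rewrite Rabs_pos_eq by nra. lra.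
  - intros y [Hy _]. unfold dR. eapply Rle_trans; [apply H2; lra|].
    apply Rmult_le_compat_r; [apply Rabs_pos|lra].
Qed.

Lemma u_pos t : 0 <= t -> 0 < u t <= M.
Proof.
  intros Ht. destruct Hu as [_ [H1 _]]. specialize (H1 t Ht). pose proof phi_01.
  pose proof (exp_pos (- mu * t)). split; [nra|lra].
Qed.

Lemma g_BL B : 0 <= B -> BL (rect 0 M (- B) B) dRR (uncurry2 g).
Proof.
  intros HB. pose proof phi_01. apply (Ck_1_rect_BL dom_g); [lra|lra| |exact Hg].
  intros p [H1 H2]. unfold dom_g. lra.
Qed.

Lemma w1_BL T : 0 <= T -> BL (seg 0 T) dR (fun t => wsol u t 1).
Proof.
  intros HT. destruct (wsol_BL T HT) as [B [HB H]]. exists B. split; [exact HB|].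
  assert (H01 : 0 <= 1 <= 1) by lra.
  intros t Ht. destruct (H (t, 1) (conj Ht H01)) as [H1 H2]. split; [exact H1|].
  intros s Hs. specialize (H2 (s, 1) (conj Hs H01)). unfold uncurry2, dRR in H2; simpl in H2.
  rewrite Rminus_diag, Rabs_R0, Rplus_0_r in H2. exact H2.
Qed.

Lemma gw_BL T : 0 <= T -> BL (seg 0 T) dR (fun s => g (u s) (wsol u s 1)).
Proof.
  intros HT. destruct (w1_BL T HT) as [B [HB H]].
  apply (BL_comp2 _ _ dR_ge0 g u (fun s => wsol u s 1) 0 M (- B) B).
  - apply g_BL, HB.
  - intros s [Hs _]. pose proof (u_pos s Hs). lra.
  - intros s Hs. apply Rabs_le_between. apply H, Hs.
  - apply u_BL.
  - exists B. auto.
Qed.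

Lemma Gw_locBL : locBL (Gw u).
Proof.
  intros x y.
  apply (BL_comp _ _ dR_ge0 (fun s => g (u s) (wsol u s 1)) (Rmax 0) 0 (Rmax 0 y)).
  - apply gw_BL, Rmax_l.
  - intros s [_ Hs]. split; [apply Rmax_l|]. apply Rmax_lub; [apply Rmax_l|].
    eapply Rle_trans; [exact Hs|apply Rmax_r].
  - apply Rmax0_locBL.
Qed.

Lemma Gw_bounds s : 0 < Gw u s <= M.
Proof.
  unfold Gw. pose proof (u_pos (Rmax 0 s) (Rmax_l _ _)) as [H1 _].
  destruct (Hgb (u (Rmax 0 s)) (wsol u (Rmax 0 s) 1) ltac:(lra)) as [H2 [H3 H4]]. lra.
Qed.

Lemma duhamel_integrand_continuous s : continuous (fun s => mu * exp (mu * s) * Gw u s) s.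
Proof.
  apply (continuous_mult (fun s => mu * exp (mu * s)) (Gw u)).
  - apply (continuous_mult (fun _ => mu) (fun s => exp (mu * s))); [apply continuous_const|].
    apply (ex_derive_continuous (fun s => exp (mu * s))). eexists. apply is_derive_exp_scal.
  - apply locBL_continuous, Gw_locBL.
Qed.

Lemma duhamel_acc_derive t :
  is_derive (fun t => phi 1 + RInt (fun s => mu * exp (mu * s) * Gw u s) 0 t) t
    (mu * exp (mu * t) * Gw u t).
Proof.
  apply is_derive_eq with (0 + mu * exp (mu * t) * Gw u t); [|ring].
  apply is_derive_R_plus; [apply is_derive_R_const|].
  apply (is_derive_primitive (fun s => mu * exp (mu * s) * Gw u s)), duhamel_integrand_continuous.
Qed.

Lemma duhamel_derive t : is_derive (duhamel u) t (- mu * duhamel u t + mu * Gw u t).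
Proof.
  eapply is_derive_eq.
  - apply (is_derive_R_mult (fun t => exp (- mu * t))); [apply is_derive_exp_scal|apply duhamel_acc_derive].
  - unfold duhamel.
    replace (exp (- mu * t) * (mu * exp (mu * t) * Gw u t)) with
      (exp (- mu * t) * exp (mu * t) * (mu * Gw u t)) by ring.
    rewrite <- exp_plus. replace (- mu * t + mu * t) with 0 by ring. rewrite exp_0. ring.
Qed.

Lemma exp_mu_cancel t x : exp (- mu * t) * (x * exp (mu * t)) = x.
Proof.
  replace (exp (- mu * t) * (x * exp (mu * t))) with (x * (exp (- mu * t) * exp (mu * t))) by ring.
  rewrite <- exp_plus. replace (- mu * t + mu * t) with 0 by ring. rewrite exp_0. ring.
Qed.

Lemma duhamel_acc_0 : phi 1 + RInt (fun s => mu * exp (mu * s) * Gw u s) 0 0 = phi 1.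
Proof. rewrite RInt_point. apply Rplus_0_r. Qed.

Lemma duhamel_0 : duhamel u 0 = phi 1.
Proof. unfold duhamel. rewrite duhamel_acc_0, Rmult_0_r, exp_0. ring. Qed.

(** [duhamel u t] is a weighted mean of [phi 1] and of the past values of [Gw u], with weights
    e^(-mu t) and mu e^(mu (s - t)) of total mass 1, so it inherits their common lower bounds. In
    the proof this is the monotonicity of a function after multiplication by e^(mu t). *)
Lemma duhamel_ge k t : 0 <= t -> k <= phi 1 -> (forall s, 0 <= s <= t -> k <= Gw u s) ->
  k <= duhamel u t.
Proof.
  intros Ht Hk HG. unfold duhamel. rewrite <- (exp_mu_cancel t k) at 1.
  apply Rmult_le_compat_l; [left; apply exp_pos|].
  pose proof (is_derive_nonpos_le
    (fun t => k * exp (mu * t) - (phi 1 + RInt (fun s => mu * exp (mu * s) * Gw u s) 0 t))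
    (fun t => (0 * exp (mu * t) + k * (mu * exp (mu * t))) - mu * exp (mu * t) * Gw u t) 0 t Ht) as H.
  simpl in H. rewrite duhamel_acc_0, Rmult_0_r, exp_0 in H.
  enough (k * exp (mu * t) - (phi 1 + RInt (fun s => mu * exp (mu * s) * Gw u s) 0 t) <= k * 1 - phi 1) by lra.
  apply H.
  - intros x _. apply is_derive_R_minus; [|apply duhamel_acc_derive].
    apply (is_derive_R_mult (fun _ => k) (fun t => exp (mu * t))); [apply is_derive_R_const|apply is_derive_exp_scal].
  - intros x Hx. specialize (HG x Hx). pose proof (exp_pos (mu * x)).
    assert (0 <= mu * exp (mu * x)) by (apply Rmult_le_pos; lra). nra.
Qed.

Lemma duhamel_le k t : 0 <= t -> phi 1 <= k -> (forall s, 0 <= s <= t -> Gw u s <= k) ->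
  duhamel u t <= k.
Proof.
  intros Ht Hk HG. unfold duhamel. rewrite <- (exp_mu_cancel t k).
  apply Rmult_le_compat_l; [left; apply exp_pos|].
  pose proof (is_derive_nonpos_le
    (fun t => (phi 1 + RInt (fun s => mu * exp (mu * s) * Gw u s) 0 t) - k * exp (mu * t))
    (fun t => mu * exp (mu * t) * Gw u t - (0 * exp (mu * t) + k * (mu * exp (mu * t)))) 0 t Ht) as H.
  simpl in H. rewrite duhamel_acc_0, Rmult_0_r, exp_0 in H.
  enough ((phi 1 + RInt (fun s => mu * exp (mu * s) * Gw u s) 0 t) - k * exp (mu * t) <= phi 1 - k * 1) by lra.
  apply H.
  - intros x _. apply is_derive_R_minus; [apply duhamel_acc_derive|].
    apply (is_derive_R_mult (fun _ => k) (fun t => exp (mu * t))); [apply is_derive_R_const|apply is_derive_exp_scal].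
  - intros x Hx. specialize (HG x Hx). pose proof (exp_pos (mu * x)).
    assert (0 <= mu * exp (mu * x)) by (apply Rmult_le_pos; lra). nra.
Qed.

Lemma duhamel_admissible : admissible (duhamel u).
Proof.
  pose proof phi_01 as [_ [P1 P1']].
  assert (B : forall t, 0 <= t -> phi 1 * exp (- mu * t) <= duhamel u t <= M).
  { intros t Ht. split.
    - unfold duhamel. rewrite Rmult_comm. apply Rmult_le_compat_l; [left; apply exp_pos|].
      enough (0 <= RInt (fun s => mu * exp (mu * s) * Gw u s) 0 t) by lra.
      apply RInt_ge_0; [exact Ht|apply ex_RInt_cont, duhamel_integrand_continuous|].
      intros x _. pose proof (Gw_bounds x). pose proof (exp_pos (mu * x)).
      repeat apply Rmult_le_pos; lra.
    - apply duhamel_le; [exact Ht|lra|]. intros s _. apply Gw_bounds. }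
  split; [apply duhamel_0|]. split; [exact B|].
  intros s t Hs Ht. pose proof (Rmax_l s t). pose proof (Rmax_r s t).
  apply (is_derive_bound_Lip (duhamel u) (fun t => - mu * duhamel u t + mu * Gw u t) (mu * M) 0 (Rmax s t)).
  - intros x _. apply duhamel_derive.
  (* The two terms of the derivative have opposite signs and absolute values at most [mu * M]; hence
     the bound is [mu * M] and not twice that. *)
  - intros x [Hx _]. specialize (B x Hx). pose proof (Gw_bounds x). pose proof (exp_pos (- mu * x)).
    assert (0 <= duhamel u x) by nra. apply Rabs_le.
    assert (0 <= mu * duhamel u x) by (apply Rmult_le_pos; lra).
    assert (0 <= mu * Gw u x) by (apply Rmult_le_pos; lra).
    assert (mu * duhamel u x <= mu * M) by (apply Rmult_le_compat_l; lra).
    assert (mu * Gw u x <= mu * M) by (apply Rmult_le_compat_l; lra). lra.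
  - lra.
  - lra.
Qed.

Lemma datum_pos z : 0 <= z -> datum u z = a z (hist u z).
Proof.
  intros H. pose proof phi_01. unfold datum. rewrite Rmax_right by lra. rewrite clamp01_lo by nra. lra.
Qed.

Lemma datum_neg z : z <= 0 -> datum u z = theta (clamp 0 1 (- phi 0 * z)).
Proof.
  intros H. unfold datum. rewrite Rmax_left by lra. rewrite hist_neg by lra. ring.
Qed.

End OneBoundaryValue.

(** * Dependence on the boundary value *)

Lemma kap_diff p q : 0 < p -> 0 < q -> Rabs (p / (c + p) - q / (c + q)) <= / c * Rabs (p - q).
Proof.
  intros Hp Hq.
  replace (p / (c + p) - q / (c + q)) with ((c / (c + p)) * (/ (c + q)) * (p - q)) by (field; lra).
  rewrite Rabs_mult. apply Rmult_le_compat_r; [apply Rabs_pos|].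
  assert (0 < c / (c + p) <= 1).
  { split; [apply Rdiv_lt_0_compat; lra|]. apply Rmult_le_reg_r with (c + p); [lra|].
    unfold Rdiv. rewrite Rmult_assoc, Rinv_l; lra. }
  assert (0 < / (c + q) <= / c).
  { split; [apply Rinv_0_lt_compat; lra|apply Rinv_le_contravar; lra]. }
  rewrite Rabs_pos_eq; nra.
Qed.

Section TwoBoundaryValues.
Variables (u1 u2 : R -> R) (t K : R).
Hypotheses (Hu1 : admissible u1) (Hu2 : admissible u2) (Ht : 0 <= t) (HK : 0 <= K).
Hypothesis Hclose : forall s, 0 <= s <= t -> Rabs (u1 s - u2 s) <= K.

(** Causality: the line t + x / c = s meets x = 1 at time s - 1 / c, so up to s = t + 1 / c only the
    values of the boundary functions on [0, t] matter. *)
Lemma hist_diff s : s <= t + / c -> Rabs (hist u1 s - hist u2 s) <= K.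
Proof.
  intros Hs. unfold hist.
  replace (phi (clamp 0 1 (c * s)) + (u1 (Rmax 0 (s - / c)) - phi 1) -
    (phi (clamp 0 1 (c * s)) + (u2 (Rmax 0 (s - / c)) - phi 1))) with
    (u1 (Rmax 0 (s - / c)) - u2 (Rmax 0 (s - / c))) by ring.
  apply Hclose. split; [apply Rmax_l|apply Rmax_lub; lra].
Qed.

Lemma Sig_close s : 0 <= s <= t + / c -> Rabs (Sig u1 s - Sig u2 s) <= / c * K * s.
Proof.
  intros Hs.
  pose proof (is_derive_bound_Lip (fun s => Sig u1 s - Sig u2 s) (fun s => kap u1 s - kap u2 s)
    (/ c * K) 0 s) as H.
  specialize (H (fun x _ => is_derive_R_minus _ _ x _ _ (Sig_derive u1 Hu1 x) (Sig_derive u2 Hu2 x))).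
  rewrite <- (Rabs_pos_eq s) at 3 by lra.
  replace (Rabs (Sig u1 s - Sig u2 s)) with (Rabs (Sig u1 s - Sig u2 s - (Sig u1 0 - Sig u2 0))).
  - replace (Rabs s) with (Rabs (s - 0)) by (f_equal; ring). apply H; [|lra|lra].
    intros x Hx. unfold kap. eapply Rle_trans; [apply kap_diff; apply hist_pos; assumption|].
    apply Rmult_le_compat_l; [left; apply Rinv_0_lt_compat, Hc|]. apply hist_diff. lra.
  - rewrite !Sig_0. f_equal. ring.
Qed.

(** For negative [z] the level function is determined by [phi] alone, so only z >= 0 contributes a
    difference. *)
Lemma foot_charac_close z : z <= t -> Rabs (foot_charac u1 z - foot_charac u2 z) <= / c * K * t.
Proof.
  intros Hz. pose proof (Rinv_0_lt_compat _ Hc).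
  assert (HcK : 0 <= / c * K) by (apply Rmult_le_pos; lra).
  destruct (Rle_dec 0 z) as [H0|H0].
  - rewrite !foot_charac_Sig by assumption. eapply Rle_trans; [apply Sig_close; lra|].
    apply Rmult_le_compat_l; assumption.
  - replace (foot_charac u1 z) with (foot_charac u2 z).
    + rewrite Rminus_diag, Rabs_R0. apply Rmult_le_pos; assumption.
    + apply RInt_ext. intros x Hx. rewrite Rmin_right, Rmax_left in Hx by lra.
      rewrite !rho_neg by (assumption || lra). reflexivity.
Qed.

(** The first factor is the inverse of the lower bound of [rho]. The two summands after it account
    for the change of the level of (t, 1) and for the change of the level function at the second
    foot. All are taken at [T], so that one constant serves every t <= T. *)
Lemma foot_close T : t <= T ->
  Rabs (foot u1 t 1 - foot u2 t 1) <=
    ((c + M) / (m0 * exp (- mu * T)) * (/ c * (T + / c) + / c * T)) * K.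
Proof.
  intros HT. set (del := m0 * exp (- mu * T) / (c + M)). pose proof phi_01.
  pose proof (exp_pos (- mu * T)). pose proof (Rinv_0_lt_compat _ Hc).
  assert (Hnum : 0 < m0 * exp (- mu * T)) by (apply Rmult_lt_0_compat; lra).
  assert (Hdel : 0 < del) by (apply Rdiv_lt_0_compat; lra).
  assert (H01 : 0 <= 1 <= 1) by lra.
  destruct (foot_spec u1 Hu1 t 1 Ht H01) as [S1 E1].
  destruct (foot_spec u2 Hu2 t 1 Ht H01) as [S2 E2].
  pose proof (inv_Lip (foot_charac u1) (rho u1) T del Hdel (foot_charac_derive u1 Hu1)
    (fun z Hz => rho_lower u1 Hu1 T z ltac:(lra) Hz) (foot u1 t 1) (foot u2 t 1) ltac:(lra) ltac:(lra)) as H2.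
  apply Rmult_le_reg_l with del; [exact Hdel|].
  eapply Rle_trans; [exact H2|].
  replace (foot_charac u1 (foot u1 t 1) - foot_charac u1 (foot u2 t 1)) with
    ((charac u1 t 1 - charac u2 t 1) - (foot_charac u1 (foot u2 t 1) - foot_charac u2 (foot u2 t 1))) by lra.
  eapply Rle_trans; [apply Rabs_triang|]. rewrite Rabs_Ropp.
  pose proof (foot_charac_close (foot u2 t 1) ltac:(lra)) as H3.
  assert (H4 : Rabs (charac u1 t 1 - charac u2 t 1) <= / c * K * (t + / c)).
  { unfold charac. replace (1 / c) with (/ c) by (unfold Rdiv; ring).
    replace (Sig u1 (t + / c) - / c - (Sig u2 (t + / c) - / c)) with (Sig u1 (t + / c) - Sig u2 (t + / c)) by ring.
    apply Sig_close. lra. }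
  replace (del * ((c + M) / (m0 * exp (- mu * T)) * (/ c * (T + / c) + / c * T) * K)) with
    (/ c * K * (T + / c) + / c * K * T) by (unfold del; field; lra).
  assert (0 <= / c * K) by (apply Rmult_le_pos; lra).
  assert (/ c * K * (t + / c) <= / c * K * (T + / c)) by (apply Rmult_le_compat_l; lra).
  assert (/ c * K * t <= / c * K * T) by (apply Rmult_le_compat_l; lra). lra.
Qed.

End TwoBoundaryValues.

(** The bound is uniform over all admissible [u]: it confines the second argument of [g] to one
    compact interval, so that a single Lipschitz constant of [g] serves in [Gw_diff]. *)
Lemma datum_bound T : 0 <= T -> exists B, 0 <= B /\ forall u z, admissible u -> z <= T -> Rabs (datum u z) <= B.
Proof.
  intros HT. destruct (a_BL T HT) as [B [HB H]].
  destruct (locBL_Lip (fun z => theta (clamp 0 1 z)) Ltheta Hthetal 0 1) as [B' [HB' H']].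
  exists (B + B'). split; [lra|]. intros u z Hu Hz.
  destruct (Rle_dec 0 z) as [H0|H0].
  - rewrite datum_pos by assumption.
    destruct (H (z, hist u z)) as [H1 _]; [|unfold uncurry2 in H1; simpl in H1; lra].
    pose proof (hist_pos u Hu z). pose proof (hist_le u Hu z). split; simpl; lra.
  - rewrite datum_neg by (assumption || lra).
    destruct (H' (clamp 0 1 (- phi 0 * z))) as [H1 _]; [apply clamp_in; lra|].
    rewrite (clamp_id 0 1 (clamp 0 1 (- phi 0 * z))) in H1 by (apply clamp_in; lra). lra.
Qed.

Lemma datum_diff T : 0 <= T -> exists A, 0 <= A /\ forall u1 u2 t K z1 z2, admissible u1 -> admissible u2 -> 0 <= t <= T -> 0 <= K ->
    (forall s, 0 <= s <= t -> Rabs (u1 s - u2 s) <= K) -> z1 <= t -> z2 <= t ->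
    Rabs (datum u1 z1 - datum u2 z2) <= A * (Rabs (z1 - z2) + K).
Proof.
  intros HT. destruct (a_BL T HT) as [B [HB H]].
  set (Kq := Rabs (Lphi * c + mu * M)). set (Lt := Rabs Ltheta * Rabs (- phi 0)).
  assert (HKq : 0 <= Kq) by apply Rabs_pos.
  assert (HLt : 0 <= Lt) by (apply Rmult_le_pos; apply Rabs_pos).
  assert (HBK : 0 <= B * Kq) by (apply Rmult_le_pos; assumption).
  exists (Lt + (B + B * Kq)). split; [lra|].
  intros u1 u2 t K z1 z2 Hu1 Hu2 Ht HK Hcl Hz1 Hz2.
  pose proof (Rabs_pos (z1 - z2)) as Hz. unfold datum.
  replace (theta (clamp 0 1 (- phi 0 * z1)) + (a (Rmax 0 z1) (hist u1 (Rmax 0 z1)) - a 0 (phi 0)) -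
   (theta (clamp 0 1 (- phi 0 * z2)) + (a (Rmax 0 z2) (hist u2 (Rmax 0 z2)) - a 0 (phi 0)))) with
   ((theta (clamp 0 1 (- phi 0 * z1)) - theta (clamp 0 1 (- phi 0 * z2))) +
    (a (Rmax 0 z1) (hist u1 (Rmax 0 z1)) - a (Rmax 0 z2) (hist u2 (Rmax 0 z2)))) by ring.
  eapply Rle_trans; [apply Rabs_triang|].
  assert (E1 : Rabs (theta (clamp 0 1 (- phi 0 * z1)) - theta (clamp 0 1 (- phi 0 * z2))) <= Lt * Rabs (z1 - z2)).
  { eapply Rle_trans; [apply Hthetal|]. rewrite <- Rmult_minus_distr_l, Rabs_mult.
    unfold Lt. rewrite Rmult_assoc. apply Rmult_le_compat_r; [|apply Rle_abs].
    apply Rmult_le_pos; apply Rabs_pos. }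
  assert (E2 : Rabs (a (Rmax 0 z1) (hist u1 (Rmax 0 z1)) - a (Rmax 0 z2) (hist u2 (Rmax 0 z2))) <=
     B * (Rabs (z1 - z2) + (Kq * Rabs (z1 - z2) + K))).
  { destruct (H (Rmax 0 z1, hist u1 (Rmax 0 z1))) as [_ H1].
    { split; simpl; [split; [apply Rmax_l|apply Rmax_lub; lra]|].
      split; [left; apply hist_pos|apply hist_le]; assumption. }
    specialize (H1 (Rmax 0 z2, hist u2 (Rmax 0 z2))). unfold uncurry2, dRR in H1; simpl in H1.
    eapply Rle_trans; [apply H1|].
    { split; simpl; [split; [apply Rmax_l|apply Rmax_lub; lra]|].
      split; [left; apply hist_pos|apply hist_le]; assumption. }
    apply Rmult_le_compat_l; [exact HB|]. pose proof (Rmax_lip 0 z1 z2).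
    apply Rplus_le_compat; [assumption|].
    replace (hist u1 (Rmax 0 z1) - hist u2 (Rmax 0 z2)) with
      ((hist u1 (Rmax 0 z1) - hist u1 (Rmax 0 z2)) + (hist u1 (Rmax 0 z2) - hist u2 (Rmax 0 z2))) by ring.
    eapply Rle_trans; [apply Rabs_triang|]. apply Rplus_le_compat.
    - eapply Rle_trans; [apply hist_Lip, Hu1|].
      apply Rle_trans with (Kq * Rabs (Rmax 0 z1 - Rmax 0 z2)).
      + apply Rmult_le_compat_r; [apply Rabs_pos|apply Rle_abs].
      + apply Rmult_le_compat_l; assumption.
    - apply (hist_diff u1 u2 t K ltac:(lra) Hcl). pose proof (Rinv_0_lt_compat _ Hc).
      assert (Rmax 0 z2 <= t) by (apply Rmax_lub; lra). lra. }
  assert (0 <= Lt * K) by (apply Rmult_le_pos; assumption).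
  assert (0 <= B * Kq * K) by (apply Rmult_le_pos; assumption). lra.
Qed.

Lemma Gw_diff T : 0 <= T -> exists L, 0 <= L /\ forall u1 u2 t K, admissible u1 -> admissible u2 -> 0 <= t <= T -> 0 <= K ->
    (forall s, 0 <= s <= t -> Rabs (u1 s - u2 s) <= K) -> Rabs (Gw u1 t - Gw u2 t) <= L * K.
Proof.
  intros HT. destruct (datum_diff T HT) as [A [HA H]]. destruct (datum_bound T HT) as [B [HB H']].
  destruct (g_BL B HB) as [L [HL H'']].
  set (F := (c + M) / (m0 * exp (- mu * T)) * (/ c * (T + / c) + / c * T)).
  assert (HF : 0 <= F).
  { pose proof phi_01. pose proof (exp_pos (- mu * T)). pose proof (Rinv_0_lt_compat _ Hc).
    apply Rmult_le_pos; [left; apply Rdiv_lt_0_compat; [lra|apply Rmult_lt_0_compat; lra]|].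
    assert (0 <= / c * T) by (apply Rmult_le_pos; lra).
    assert (0 <= / c * / c) by (apply Rmult_le_pos; lra). lra. }
  assert (HAF : 0 <= A * (F + 1)) by (apply Rmult_le_pos; lra).
  exists (L * (1 + A * (F + 1))). split; [apply Rmult_le_pos; lra|].
  intros u1 u2 t K Hu1 Hu2 Ht HK Hcl.
  assert (H01 : 0 <= 1 <= 1) by lra.
  unfold Gw. rewrite Rmax_right by lra.
  destruct (foot_spec u1 Hu1 t 1 ltac:(lra) H01) as [S1 _].
  destruct (foot_spec u2 Hu2 t 1 ltac:(lra) H01) as [S2 _].
  pose proof (u_pos u1 Hu1 t ltac:(lra)). pose proof (u_pos u2 Hu2 t ltac:(lra)).
  pose proof (H' u1 (foot u1 t 1) Hu1 ltac:(lra)) as B1. apply Rabs_le_between in B1.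
  pose proof (H' u2 (foot u2 t 1) Hu2 ltac:(lra)) as B2. apply Rabs_le_between in B2.
  pose proof (foot_close u1 u2 t K Hu1 Hu2 ltac:(lra) HK Hcl T ltac:(lra)) as HFK. fold F in HFK.
  pose proof (H u1 u2 t K (foot u1 t 1) (foot u2 t 1) Hu1 Hu2 Ht HK Hcl ltac:(lra) ltac:(lra)) as HD.
  destruct (H'' (u1 t, wsol u1 t 1)) as [_ HG]; [split; unfold wsol; simpl; lra|].
  specialize (HG (u2 t, wsol u2 t 1)). unfold uncurry2, dRR in HG; simpl in HG.
  eapply Rle_trans; [apply HG; split; unfold wsol; simpl; lra|].
  rewrite Rmult_assoc. apply Rmult_le_compat_l; [exact HL|].
  specialize (Hcl t ltac:(lra)). unfold wsol in *.
  assert (A * (Rabs (foot u1 t 1 - foot u2 t 1) + K) <= A * (F * K + K)) by (apply Rmult_le_compat_l; lra).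
  lra.
Qed.

Lemma exp_le x y : x <= y -> exp x <= exp y.
Proof.
  intros H. destruct (Req_dec x y) as [->|N]; [lra|]. left. apply exp_increasing. lra.
Qed.

Lemma duhamel_contract T : 0 <= T -> exists L, 0 <= L /\ forall u1 u2 lam K, admissible u1 -> admissible u2 -> 0 < lam -> 0 <= K ->
    (forall s, 0 <= s <= T -> Rabs (u1 s - u2 s) <= K * exp (lam * s)) ->
    forall t, 0 <= t <= T -> Rabs (duhamel u1 t - duhamel u2 t) <= L / lam * (K * exp (lam * t)).
Proof.
  intros HT. destruct (Gw_diff T HT) as [L [HL H]].
  assert (HmL : 0 <= mu * L) by (apply Rmult_le_pos; assumption).
  exists (mu * L). split; [exact HmL|].
  intros u1 u2 lam K Hu1 Hu2 Hlam HK Hcl t Ht.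
  (* The estimate at time [s] is applied with the constant [K * exp (lam * s)]: the weight is
     nondecreasing, so this bounds the difference on all of [0, s]. *)
  assert (HG : forall s, 0 <= s <= T -> Rabs (Gw u1 s - Gw u2 s) <= L * (K * exp (lam * s))).
  { intros s Hs. apply H; auto.
    - apply Rmult_le_pos; [exact HK|left; apply exp_pos].
    - intros r Hr. eapply Rle_trans; [apply Hcl; lra|]. apply Rmult_le_compat_l; [exact HK|].
      apply exp_le. apply Rmult_le_compat_l; lra. }
  (* Chosen so that [P * lam = mu * L * K]. Then the derivative of the barrier
     [P * exp ((mu + lam) * t)] dominates the difference of the two Duhamel integrands. *)
  set (P := mu * L / lam * K).
  assert (HP : 0 <= P).
  { apply Rmult_le_pos; [|exact HK]. apply Rmult_le_pos; [exact HmL|]. left. apply Rinv_0_lt_compat, Hlam. }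
  assert (HD : forall v1 v2, admissible v1 -> admissible v2 ->
    (forall s, 0 <= s <= T -> Rabs (Gw v1 s - Gw v2 s) <= L * (K * exp (lam * s))) ->
    duhamel v1 t - duhamel v2 t <= P * exp (lam * t)).
  { intros v1 v2 Hv1 Hv2 HGv.
    set (acc := fun v t => phi 1 + RInt (fun s => mu * exp (mu * s) * Gw v s) 0 t).
    assert (A0 : forall v, acc v 0 = phi 1) by (intros v; apply duhamel_acc_0).
    assert (HA : acc v1 t - acc v2 t - P * exp ((mu + lam) * t) <= 0).
    { pose proof (is_derive_nonpos_le (fun t => acc v1 t - acc v2 t - P * exp ((mu + lam) * t))
        (fun t => (mu * exp (mu * t) * Gw v1 t - mu * exp (mu * t) * Gw v2 t) -
           (0 * exp ((mu + lam) * t) + P * ((mu + lam) * exp ((mu + lam) * t)))) 0 t ltac:(lra)) as E.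
      simpl in E. rewrite !A0, Rmult_0_r, exp_0 in E.
      eapply Rle_trans; [apply E|lra].
      - intros x _. apply is_derive_R_minus; [apply is_derive_R_minus; apply duhamel_acc_derive; assumption|].
        apply (is_derive_R_mult (fun _ => P) (fun t => exp ((mu + lam) * t)));
          [apply is_derive_R_const|apply is_derive_exp_scal].
      - intros x Hx. specialize (HGv x ltac:(lra)). apply Rabs_le_between in HGv.
        replace (exp ((mu + lam) * x)) with (exp (mu * x) * exp (lam * x))
          by (rewrite <- exp_plus; f_equal; ring).
        pose proof (exp_pos (mu * x)) as E1. pose proof (exp_pos (lam * x)) as E2.
        replace (mu * exp (mu * x) * Gw v1 x - mu * exp (mu * x) * Gw v2 x -
          (0 * (exp (mu * x) * exp (lam * x)) + P * ((mu + lam) * (exp (mu * x) * exp (lam * x))))) with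
          (exp (mu * x) * (mu * (Gw v1 x - Gw v2 x) - P * lam * exp (lam * x) - P * mu * exp (lam * x))) by ring.
        replace (P * lam) with (mu * L * K) by (unfold P; field; lra).
        assert (mu * (Gw v1 x - Gw v2 x) <= mu * (L * (K * exp (lam * x)))) by (apply Rmult_le_compat_l; lra).
        assert (0 <= P * mu * exp (lam * x)) by (apply Rmult_le_pos; [apply Rmult_le_pos; assumption|lra]).
        nra. }
    unfold duhamel. fold (acc v1 t). fold (acc v2 t).
    replace (P * exp (lam * t)) with (exp (- mu * t) * (P * exp ((mu + lam) * t))).
    - rewrite <- Rmult_minus_distr_l. apply Rmult_le_compat_l; [left; apply exp_pos|lra].
    - replace (exp (- mu * t) * (P * exp ((mu + lam) * t))) with (P * (exp (- mu * t) * exp ((mu + lam) * t))) by ring.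
      rewrite <- exp_plus. do 2 f_equal. ring. }
  replace (mu * L / lam * (K * exp (lam * t))) with (P * exp (lam * t)) by (unfold P; ring).
  apply Rabs_le. split.
  - enough (duhamel u2 t - duhamel u1 t <= P * exp (lam * t)) by lra.
    apply HD; auto. intros s Hs. rewrite Rabs_minus_sym. auto.
  - apply HD; auto.
Qed.

Lemma admissible_closed (un : nat -> R -> R) (u : R -> R) : (forall n, admissible (un n)) ->
  (forall t, 0 <= t -> is_lim_seq (fun n => un n t) (u t)) -> admissible u.
Proof.
  intros Hun Hlim. split; [|split].
  - assert (E : is_lim_seq (fun n => un n 0) (phi 1)).
    { apply is_lim_seq_ext with (fun _ => phi 1); [|apply is_lim_seq_const].
      intros n. symmetry. apply (Hun n). }
    apply is_lim_seq_unique in E. pose proof (is_lim_seq_unique _ _ (Hlim 0 (Rle_refl 0))) as E'.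
    rewrite E in E'. exact (eq_sym (f_equal real E')).
  - intros t Ht. split.
    + apply (is_lim_seq_le (fun _ => phi 1 * exp (- mu * t)) (fun n => un n t)
        (phi 1 * exp (- mu * t)) (u t)); [|apply is_lim_seq_const|apply Hlim, Ht].
      intros n. apply (Hun n). exact Ht.
    + apply (is_lim_seq_le (fun n => un n t) (fun _ => M) (u t) M); [|apply Hlim, Ht|apply is_lim_seq_const].
      intros n. apply (Hun n). exact Ht.
  - intros s t Hs Ht.
    apply (is_lim_seq_le (fun n => Rabs (un n s - un n t)) (fun _ => mu * M * Rabs (s - t))
      (Rabs (u s - u t)) (mu * M * Rabs (s - t))).
    + intros n. apply (Hun n); assumption.
    + apply (is_lim_seq_abs _ (u s - u t)). apply is_lim_seq_minus'; apply Hlim; assumption.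
    + apply is_lim_seq_const.
Qed.

Lemma admissible_exists : exists u, admissible u.
Proof.
  exists (fun _ => phi 1). pose proof phi_01. split; [reflexivity|]. split.
  - intros t Ht. pose proof (exp_le_1 t Ht). pose proof (exp_pos (- mu * t)). split; [nra|lra].
  - intros s t _ _. rewrite Rminus_diag, Rabs_R0. apply Rmult_le_pos; [apply muM_ge0|apply Rabs_pos].
Qed.

Lemma boundary_value_exists_unique :
  (exists u, admissible u /\ forall t, 0 <= t -> duhamel u t = u t) /\
  (forall u1 u2, admissible u1 -> admissible u2 -> (forall t, 0 <= t -> duhamel u1 t = u1 t) ->
     (forall t, 0 <= t -> duhamel u2 t = u2 t) -> forall t, 0 <= t -> u1 t = u2 t).
Proof.
  apply causal_fixed_point with M.
  - apply admissible_exists.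
  - apply duhamel_admissible.
  - intros u t Hu Ht. pose proof (u_pos u Hu t Ht). rewrite Rabs_pos_eq; lra.
  - apply admissible_closed.
  - apply duhamel_contract.
Qed.


(** * Regularity of the constructed solution *)

Section ClassicalSolution.
Variables (u phie dphie thetae dthetae : R -> R) (Lp Lt : R).
Hypotheses (Hu : admissible u) (Hfix : forall t, 0 <= t -> duhamel u t = u t).
Hypothesis Ha2 : Ck 2 dom_a a.
Hypotheses (Hphie : forall x, is_derive phie x (dphie x))
  (Hdphie : forall x y, Rabs (dphie x - dphie y) <= Lp * Rabs (x - y))
  (Hphie01 : forall x, 0 <= x <= 1 -> phie x = phi x).
Hypotheses (Hthetae : forall x, is_derive thetae x (dthetae x))
  (Hdthetae : forall x y, Rabs (dthetae x - dthetae y) <= Lt * Rabs (x - y))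
  (Hthetae01 : forall x, 0 <= x <= 1 -> thetae x = theta x).
Hypothesis Hcompat0 :
  partial1 dom_a a 0 (phi 0) + c * partial2 dom_a a 0 (phi 0) * dphie 0 = - phi 0 * dthetae 0.
Hypothesis Hcompat1 : dphie 1 = - mu * / c * (phi 1 - g (phi 1) (theta 1)).

Definition du (t : R) : R := - mu * duhamel u t + mu * Gw u t.
(** A version of [hist u] that is C^1 on the whole line. The extension [phie] replaces the clamped
    [phi], whose slope may jump at s = 0, and [duhamel u] replaces [u], which is only known to be
    Lipschitz. *)
Definition vline (s : R) : R :=
  phie (c * Rmin (/ c) s) + (duhamel u (Rmax 0 (s - / c)) - phi 1).
Definition dvline (s : R) : R :=
  c * dphie (c * Rmin (/ c) s) + (du (Rmax 0 (s - / c)) - du 0).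

Lemma c_inv_c : c * / c = 1.
Proof. field. lra. Qed.

Lemma inv_c_pos : 0 < / c.
Proof. apply Rinv_0_lt_compat, Hc. Qed.

Lemma foot_corner : foot u 0 1 = - / phi 0.
Proof.
  apply foot_eq; [exact Hu|]. replace (- / phi 0) with (- / phi 0 * 1) by ring.
  apply foot_charac_neg; [exact Hu|lra].
Qed.

(** The compatibility condition at x = 1, read as equality of the slopes of [vline] on both sides of
    [/ c]. The foot of (0, 1) is the parameter [- / phi 0], where the datum equals [theta 1]. *)
Lemma du_0 : du 0 = c * dphie 1.
Proof.
  pose proof phi_01. pose proof c_inv_c. pose proof inv_c_pos.
  assert (0 < / phi 0) by (apply Rinv_0_lt_compat; lra).
  unfold du. rewrite duhamel_0. unfold Gw, wsol. rewrite Rmax_left by lra. rewrite foot_corner.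
  rewrite datum_neg by (assumption || lra).
  replace (- phi 0 * - / phi 0) with 1 by (field; lra). rewrite clamp_id by lra.
  destruct Hu as [-> _]. rewrite Hcompat1. field. lra.
Qed.

Lemma duhamel_locBL : locBL (duhamel u).
Proof.
  apply (C1_locBL _ (fun t => - mu * duhamel u t + mu * Gw u t)).
  - intros t. apply duhamel_derive, Hu.
  - intros t. apply (continuous_plus (fun t => - mu * duhamel u t) (fun t => mu * Gw u t)).
    + apply (continuous_mult (fun _ => - mu) (duhamel u)); [apply continuous_const|].
      apply (ex_derive_continuous (duhamel u)). eexists. apply duhamel_derive, Hu.
    + apply (continuous_mult (fun _ => mu) (Gw u)); [apply continuous_const|].
      apply locBL_continuous, Gw_locBL, Hu.
Qed.

Lemma du_locBL : locBL du.
Proof.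
  intros x y. unfold du. apply BL_plus; apply BL_mult; auto using BL_const.
  - apply duhamel_locBL.
  - apply Gw_locBL, Hu.
Qed.

Lemma Rmin_locBL k : locBL (Rmin k).
Proof. apply (locBL_Lip (Rmin k) 1). intros. rewrite Rmult_1_l. apply Rmin_lip. Qed.

Lemma shift_locBL k : locBL (fun s => Rmax 0 (s - k)).
Proof.
  apply (locBL_Lip _ 1). intros. rewrite Rmult_1_l. eapply Rle_trans; [apply Rmax_lip|].
  right. f_equal. ring.
Qed.

Lemma scal_Rmin_locBL k l : locBL (fun s => k * Rmin l s).
Proof. intros x y. apply BL_mult; auto using BL_const. apply Rmin_locBL. Qed.

Lemma vline_continuous s : continuous vline s.
Proof.
  apply (continuous_plus (fun s => phie (c * Rmin (/ c) s)) (fun s => duhamel u (Rmax 0 (s - / c)) - phi 1)).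
  - apply (continuous_comp (fun s => c * Rmin (/ c) s) phie).
    + apply (locBL_continuous (fun s => c * Rmin (/ c) s)), scal_Rmin_locBL.
    + apply (ex_derive_continuous phie). eexists. apply Hphie.
  - apply (continuous_minus (fun s => duhamel u (Rmax 0 (s - / c))) (fun _ => phi 1)); [|apply continuous_const].
    apply (continuous_comp (fun s => Rmax 0 (s - / c)) (duhamel u)).
    + apply (locBL_continuous (fun s => Rmax 0 (s - / c))), shift_locBL.
    + apply locBL_continuous, duhamel_locBL.
Qed.

Lemma dvline_locBL : locBL dvline.
Proof.
  intros x y. unfold dvline. apply BL_plus.
  - apply BL_mult; auto using BL_const.
    apply (locBL_comp dphie); [apply locBL_Lip with Lp, Hdphie|apply scal_Rmin_locBL].
  - apply BL_minus; auto using BL_const.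
    apply (locBL_comp du); [apply du_locBL|apply shift_locBL].
Qed.

Lemma vline_derive s : is_derive vline s (dvline s).
Proof.
  assert (W : forall s, s <> / c -> is_derive vline s (dvline s)).
  { clear s. intros s Hs. destruct (Rlt_dec s (/ c)) as [H|H].
    - apply (is_derive_ext_interval (fun s => phie (c * s + 0) + (duhamel u 0 - phi 1)) vline (s - 1) (/ c)).
      + lra.
      + intros y Hy. unfold vline. rewrite Rmin_right, Rmax_left by lra. rewrite Rplus_0_r. reflexivity.
      + unfold dvline. rewrite Rmin_right, Rmax_left by lra.
        eapply is_derive_eq.
        * apply is_derive_R_plus; [|apply is_derive_R_const].
          apply (is_derive_R_comp (fun s => c * s + 0)); [apply is_derive_R_affine|apply Hphie].
        * rewrite !Rplus_0_r. ring.
    - apply (is_derive_ext_interval (fun s => phie 1 + (duhamel u (1 * s + - / c) - phi 1)) vline (/ c) (s + 1)).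
      + lra.
      + intros y Hy. unfold vline. rewrite Rmin_left, Rmax_right, c_inv_c by lra.
        replace (1 * y + - / c) with (y - / c) by ring. reflexivity.
      + unfold dvline. rewrite Rmin_left, Rmax_right, c_inv_c by lra. rewrite du_0.
        eapply is_derive_eq.
        * apply is_derive_R_plus; [apply is_derive_R_const|].
          apply is_derive_R_minus; [|apply is_derive_R_const].
          apply (is_derive_R_comp (fun s => 1 * s + - / c)); [apply is_derive_R_affine|].
          apply duhamel_derive, Hu.
        * unfold du. replace (1 * s + - / c) with (s - / c) by ring. ring. }
  destruct (Req_dec s (/ c)) as [->|N]; [|apply W, N].
  apply (C1_glue vline dvline (/ c) 1); [lra|apply vline_continuous| |].
  - intros x _ Hx. apply W, Hx.
  - apply locBL_continuous, dvline_locBL.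
Qed.

Lemma vline_hist s : 0 <= s -> vline s = hist u s.
Proof.
  intros Hs. pose proof c_inv_c. pose proof inv_c_pos. unfold vline, hist. rewrite Hfix by apply Rmax_l. f_equal.
  assert (E : clamp 0 1 (c * s) = c * Rmin (/ c) s).
  { unfold Rmin. destruct Rle_dec; [rewrite clamp01_hi|rewrite clamp_id]; try nra. }
  rewrite E. apply Hphie01. rewrite <- E. apply clamp_in. lra.
Qed.

(** The derivative of the inflow datum [a z (v z 0)] along x = 0. *)
Definition da_line (z : R) : R :=
  partial1 dom_a a z (hist u z) + partial2 dom_a a z (hist u z) * dvline z.

(* On [z >= - / phi 0] this is [datum u], written with the C^1 extension of [theta]. *)
Definition wdat (z : R) : R :=
  thetae (- phi 0 * Rmin 0 z) + (a (Rmax 0 z) (hist u (Rmax 0 z)) - a 0 (phi 0)).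
Definition dwdat (z : R) : R :=
  - phi 0 * dthetae (- phi 0 * Rmin 0 z) + (da_line (Rmax 0 z) - da_line 0).

(** The compatibility condition at x = 0, read as equality of slopes at z = 0: [dvline 0] is
    [c * dphie 0], and the right side is the slope of [thetae (- phi 0 * z)]. *)
Lemma da_line_0 : da_line 0 = - phi 0 * dthetae 0.
Proof.
  pose proof inv_c_pos. unfold da_line. rewrite hist_neg by (assumption || lra). rewrite <- Hcompat0.
  unfold dvline. rewrite Rmin_right, Rmax_left by lra. rewrite Rmult_0_r. ring.
Qed.

(** Here C^2 regularity of [a] enters: the derivative of [wdat] contains first derivatives of [a],
    and it has to be Lipschitz. *)
Lemma partial_a_BL T : 0 <= T -> BL (rect 0 T 0 M) dRR (uncurry2 (partial1 dom_a a)) /\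
  BL (rect 0 T 0 M) dRR (uncurry2 (partial2 dom_a a)).
Proof.
  intros HT. pose proof phi_01. destruct Ha2 as [_ [_ [H1 H2]]].
  split; (apply (Ck_1_rect_BL dom_a); [lra|lra| |assumption]);
    intros p [P1 P2]; unfold dom_a; lra.
Qed.

Lemma dwdat_locBL : locBL dwdat.
Proof.
  intros b T. unfold dwdat. apply BL_plus.
  - apply BL_mult; auto using BL_const.
    apply (locBL_comp dthetae); [apply locBL_Lip with Lt, Hdthetae|apply scal_Rmin_locBL].
  - apply BL_minus; auto using BL_const. unfold da_line.
    destruct (partial_a_BL (Rmax 0 T) (Rmax_l _ _)) as [P1 P2].
    assert (R1 : forall z, seg b T z -> 0 <= Rmax 0 z <= Rmax 0 T).
    { intros z [_ Hz]. split; [apply Rmax_l|]. apply Rmax_lub; [apply Rmax_l|].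
      eapply Rle_trans; [exact Hz|apply Rmax_r]. }
    assert (R2 : forall z, seg b T z -> 0 <= hist u (Rmax 0 z) <= M).
    { intros z _. split; [left; apply hist_pos, Hu|apply hist_le, Hu]. }
    assert (R3 : BL (seg b T) dR (fun z => hist u (Rmax 0 z))).
    { apply (locBL_comp (hist u)); [apply hist_locBL, Hu|apply Rmax0_locBL]. }
    apply BL_plus.
    + apply (BL_comp2 _ _ dR_ge0 (partial1 dom_a a) (Rmax 0) (fun z => hist u (Rmax 0 z)) 0 (Rmax 0 T) 0 M);
        auto. apply Rmax0_locBL.
    + apply BL_mult; auto.
      * apply (BL_comp2 _ _ dR_ge0 (partial2 dom_a a) (Rmax 0) (fun z => hist u (Rmax 0 z)) 0 (Rmax 0 T) 0 M);
        auto. apply Rmax0_locBL.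
      * apply (locBL_comp dvline); [apply dvline_locBL|apply Rmax0_locBL].
Qed.

Lemma wdat_continuous z : continuous wdat z.
Proof.
  apply (continuous_plus (fun z => thetae (- phi 0 * Rmin 0 z)) (fun z => a (Rmax 0 z) (hist u (Rmax 0 z)) - a 0 (phi 0))).
  - apply (continuous_comp (fun z => - phi 0 * Rmin 0 z) thetae).
    + apply (locBL_continuous (fun s => - phi 0 * Rmin 0 s)), scal_Rmin_locBL.
    + apply (ex_derive_continuous thetae). eexists. apply Hthetae.
  - apply (locBL_continuous (fun z => a (Rmax 0 z) (hist u (Rmax 0 z)) - a 0 (phi 0))). intros b T.
    apply BL_minus; auto using BL_const.
    apply (BL_comp2 _ _ dR_ge0 a (Rmax 0) (fun z => hist u (Rmax 0 z)) 0 (Rmax 0 T) 0 M).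
    + apply a_BL, Rmax_l.
    + intros y [_ Hy]. split; [apply Rmax_l|]. apply Rmax_lub; [apply Rmax_l|].
      eapply Rle_trans; [exact Hy|apply Rmax_r].
    + intros y _. split; [left; apply hist_pos, Hu|apply hist_le, Hu].
    + apply Rmax0_locBL.
    + apply (locBL_comp (hist u)); [apply hist_locBL, Hu|apply Rmax0_locBL].
Qed.

Lemma wdat_derive z : is_derive wdat z (dwdat z).
Proof.
  assert (W : forall z, z <> 0 -> is_derive wdat z (dwdat z)).
  { clear z. intros z Hz. destruct (Rlt_dec z 0) as [H|H].
    - apply (is_derive_ext_interval (fun z => thetae (- phi 0 * z + 0) + 0) wdat (z - 1) 0).
      + lra.
      + intros y Hy. unfold wdat. rewrite Rmin_right, Rmax_left by lra.
        rewrite hist_neg by (assumption || lra). rewrite !Rplus_0_r. ring.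
      + unfold dwdat. rewrite Rmin_right, Rmax_left by lra.
        eapply is_derive_eq.
        * apply is_derive_R_plus; [|apply is_derive_R_const].
          apply (is_derive_R_comp (fun s => - phi 0 * s + 0)); [apply is_derive_R_affine|apply Hthetae].
        * rewrite !Rplus_0_r. ring.
    - apply (is_derive_ext_interval (fun z => thetae 0 + (a (id z) (vline z) - a 0 (phi 0))) wdat 0 (z + 1)).
      + lra.
      + intros y Hy. unfold wdat, id. rewrite Rmin_left, Rmax_right, Rmult_0_r by lra.
        rewrite vline_hist by lra. reflexivity.
      + unfold dwdat. rewrite Rmin_left, Rmax_right, Rmult_0_r by lra. rewrite da_line_0.
        pose proof (hist_pos u Hu z). pose proof (hist_le u Hu z).
        eapply is_derive_eq.
        * apply is_derive_R_plus; [apply is_derive_R_const|].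
          apply is_derive_R_minus; [|apply is_derive_R_const].
          apply (C1_chain dom_a a 0 (z + 1) 0 (M + 1) id vline z 1 (dvline z)).
          -- exact Ha.
          -- intros p [P1 P2]. unfold dom_a. lra.
          -- unfold id. lra.
          -- rewrite vline_hist by lra. lra.
          -- apply is_derive_R_id.
          -- apply vline_derive.
        * unfold da_line, id. rewrite vline_hist by lra. ring. }
  destruct (Req_dec z 0) as [->|N]; [|apply W, N].
  apply (C1_glue wdat dwdat 0 1); [lra|apply wdat_continuous| |].
  - intros x _ Hx. apply W, Hx.
  - apply locBL_continuous, dwdat_locBL.
Qed.

Lemma wdat_datum z : - / phi 0 <= z -> wdat z = datum u z.
Proof.
  intros Hz. pose proof phi_01. assert (0 < / phi 0) by (apply Rinv_0_lt_compat; lra).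
  assert (phi 0 * / phi 0 = 1) by (field; lra).
  unfold wdat, datum. f_equal.
  assert (E : clamp 0 1 (- phi 0 * z) = - phi 0 * Rmin 0 z).
  { unfold Rmin. destruct Rle_dec; [rewrite clamp01_lo|rewrite clamp_id]; nra. }
  rewrite E. apply Hthetae01. rewrite <- E. apply clamp_in. lra.
Qed.

Definition sol_v (t x : R) : R := vline (t + x / c).
Definition sol_w (t x : R) : R := wdat (foot u t x).

Lemma sol_v_hist t x : 0 <= t -> 0 <= x <= 1 -> sol_v t x = hist u (t + x / c).
Proof. intros Ht Hx. apply vline_hist. pose proof (div_c_bounds x Hx). lra. Qed.

Lemma sol_w_wsol t x : 0 <= t -> 0 <= x <= 1 -> sol_w t x = wsol u t x.
Proof. intros Ht Hx. apply wdat_datum. destruct (foot_spec u Hu t x Ht Hx). lra. Qed.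

Definition sol_v1 (t x : R) : R := dvline (t + x / c).
Definition sol_v2 (t x : R) : R := dvline (t + x / c) * / c.
Definition sol_w1 (t x : R) : R :=
  dwdat (foot u t x) * (/ rho u (foot u t x) * kap u (t + x / c)).
Definition sol_w2 (t x : R) : R :=
  dwdat (foot u t x) * (/ rho u (foot u t x) * (kap u (t + x / c) * / c - / c)).

Lemma time_derive t x : is_derive (fun s => s + x / c) t 1.
Proof.
  eapply is_derive_eq; [apply is_derive_R_plus; [apply is_derive_R_id|apply is_derive_R_const]|]. ring.
Qed.

Lemma space_derive t x : is_derive (fun y => t + y / c) x (/ c).
Proof.
  apply is_derive_ext with (fun y => / c * y + t).
  - intros y. unfold Rdiv. simpl. ring.
  - apply is_derive_R_affine.
Qed.

Lemma charac_derive1 t x : is_derive (fun s => charac u s x) t (kap u (t + x / c)).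
Proof.
  unfold charac. eapply is_derive_eq.
  - apply is_derive_R_minus; [|apply is_derive_R_const].
    apply (is_derive_R_comp (fun s => s + x / c) t 1 (time_derive t x) (Sig u)). apply Sig_derive, Hu.
  - ring.
Qed.

Lemma charac_derive2 t x : is_derive (fun y => charac u t y) x (kap u (t + x / c) * / c - / c).
Proof.
  unfold charac. apply is_derive_R_minus.
  - apply (is_derive_R_comp (fun y => t + y / c) x (/ c) (space_derive t x) (Sig u)). apply Sig_derive, Hu.
  - apply is_derive_ext with (fun y => / c * y + 0).
    + intros y. unfold Rdiv. simpl. ring.
    + apply is_derive_R_affine.
Qed.

Lemma foot_inverse_derive t x : 0 <= t -> 0 <= x <= 1 ->
  is_derive (fun y => iota (fun z => foot_charac u z = y)) (charac u t x) (/ rho u (foot u t x)).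
Proof.
  intros Ht Hx. destruct (foot_spec u Hu t x Ht Hx) as [_ E]. rewrite <- E.
  apply inverse_derive; intros z; [apply foot_charac_derive|apply rho_pos]; exact Hu.
Qed.

Lemma sol_w_derive1 t x : 0 <= t -> 0 <= x <= 1 -> is_derive (fun s => sol_w s x) t (sol_w1 t x).
Proof.
  intros Ht Hx. apply (is_derive_R_comp (fun s => foot u s x)); [|apply wdat_derive].
  apply (is_derive_R_comp (fun s => charac u s x) t _ (charac_derive1 t x)
    (fun y => iota (fun z => foot_charac u z = y))).
  apply foot_inverse_derive; assumption.
Qed.

Lemma sol_w_derive2 t x : 0 <= t -> 0 <= x <= 1 -> is_derive (fun y => sol_w t y) x (sol_w2 t x).
Proof.
  intros Ht Hx. apply (is_derive_R_comp (fun y => foot u t y)); [|apply wdat_derive].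
  apply (is_derive_R_comp (fun y => charac u t y) x _ (charac_derive2 t x)
    (fun y => iota (fun z => foot_charac u z = y))).
  apply foot_inverse_derive; assumption.
Qed.

Lemma sol_v_derive1 t x : is_derive (fun s => sol_v s x) t (sol_v1 t x).
Proof.
  eapply is_derive_eq.
  - apply (is_derive_R_comp (fun s => s + x / c) t 1 (time_derive t x) vline). apply vline_derive.
  - unfold sol_v1. ring.
Qed.

Lemma sol_v_derive2 t x : is_derive (fun y => sol_v t y) x (sol_v2 t x).
Proof.
  apply (is_derive_R_comp (fun y => t + y / c) x (/ c) (space_derive t x) vline). apply vline_derive.
Qed.

Lemma line_BL h T : locBL h -> BL (rect 0 T 0 1) dRR (uncurry2 (fun t x => h (t + x / c))).
Proof.
  intros Hh. apply (BL_comp _ _ dRR_ge0 h (fun p => fst p + snd p / c) 0 (T + / c)).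
  - apply Hh.
  - intros p [Hp1 Hp2]. pose proof (div_c_bounds _ Hp2). lra.
  - apply BL_plus; [apply BL_fst|]. apply BL_mult; auto using BL_const. apply BL_snd.
Qed.

Lemma foot_comp_BL h T : 0 <= T -> locBL h -> BL (rect 0 T 0 1) dRR (uncurry2 (fun t x => h (foot u t x))).
Proof.
  intros HT Hh. apply (BL_comp _ _ dRR_ge0 h (uncurry2 (foot u)) (- / phi 0) T).
  - apply Hh.
  - apply foot_range, Hu.
  - apply foot_BL; assumption.
Qed.

Lemma inv_rho_BL T : 0 <= T -> BL (rect 0 T 0 1) dRR (uncurry2 (fun t x => / rho u (foot u t x))).
Proof.
  intros HT. pose proof phi_01.
  apply (BL_inv _ _ dRR_ge0 (uncurry2 (fun t x => rho u (foot u t x))) (m0 * exp (- mu * T) / (c + M))).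
  - apply Rdiv_lt_0_compat; [|lra]. apply Rmult_lt_0_compat; [lra|apply exp_pos].
  - intros p Hp. apply rho_lower; [exact Hu|exact HT|]. apply (foot_range u Hu T p Hp).
  - apply foot_comp_BL; [exact HT|apply rho_locBL, Hu].
Qed.

Lemma vline_locBL : locBL vline.
Proof.
  apply (C1_locBL _ dvline); [apply vline_derive|apply locBL_continuous, dvline_locBL].
Qed.

Lemma wdat_locBL : locBL wdat.
Proof.
  apply (C1_locBL _ dwdat); [apply wdat_derive|apply locBL_continuous, dwdat_locBL].
Qed.

Lemma sol_v_C1 : Ck 1 strip sol_v /\
  (forall t x, 0 <= t -> 0 <= x <= 1 ->
     partial1 strip sol_v t x = sol_v1 t x /\ partial2 strip sol_v t x = sol_v2 t x) /\
  (forall S, compact_set S -> (forall p, S p -> strip p) ->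
     lipschitz_on S (uncurry2 (partial1 strip sol_v)) /\ lipschitz_on S (uncurry2 (partial2 strip sol_v))).
Proof.
  apply strip_C1.
  - intros t x _ _. apply sol_v_derive1.
  - intros t x _ _. apply sol_v_derive2.
  - intros T _. apply line_BL, vline_locBL.
  - intros T _. apply line_BL, dvline_locBL.
  - intros T _. unfold sol_v2. apply (BL_mult _ _ (uncurry2 (fun t x => dvline (t + x / c)))).
    + apply line_BL, dvline_locBL.
    + apply BL_const; auto.
Qed.

Lemma sol_w_C1 : Ck 1 strip sol_w /\
  (forall t x, 0 <= t -> 0 <= x <= 1 ->
     partial1 strip sol_w t x = sol_w1 t x /\ partial2 strip sol_w t x = sol_w2 t x) /\
  (forall S, compact_set S -> (forall p, S p -> strip p) ->
     lipschitz_on S (uncurry2 (partial1 strip sol_w)) /\ lipschitz_on S (uncurry2 (partial2 strip sol_w))).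
Proof.
  apply strip_C1.
  - apply sol_w_derive1.
  - apply sol_w_derive2.
  - intros T HT. apply foot_comp_BL; [exact HT|apply wdat_locBL].
  - intros T HT. apply (BL_mult _ _ (uncurry2 (fun t x => dwdat (foot u t x)))).
    + apply foot_comp_BL; [exact HT|apply dwdat_locBL].
    + apply (BL_mult _ _ (uncurry2 (fun t x => / rho u (foot u t x)))).
      * apply inv_rho_BL, HT.
      * apply (line_BL (kap u)), kap_locBL, Hu.
  - intros T HT. apply (BL_mult _ _ (uncurry2 (fun t x => dwdat (foot u t x)))).
    + apply foot_comp_BL; [exact HT|apply dwdat_locBL].
    + apply (BL_mult _ _ (uncurry2 (fun t x => / rho u (foot u t x)))).
      * apply inv_rho_BL, HT.
      * apply (BL_minus _ _ dRR_ge0 (uncurry2 (fun t x => kap u (t + x / c) * / c))); [|apply BL_const; auto].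
        apply (BL_mult _ _ (uncurry2 (fun t x => kap u (t + x / c)))); [|apply BL_const; auto].
        apply (line_BL (kap u)), kap_locBL, Hu.
Qed.

Lemma sol_is_solution : is_solution a g c mu theta phi sol_w sol_v.
Proof.
  pose proof phi_01 as [P0 P1]. pose proof inv_c_pos as Ic.
  assert (I0 : 0 < / phi 0) by (apply Rinv_0_lt_compat; lra).
  assert (H00 : 0 <= 0 <= 1) by lra. assert (H01 : 0 <= 1 <= 1) by lra.
  destruct sol_w_C1 as [Cw [Dw _]]. destruct sol_v_C1 as [Cv [Dv _]].
  split; [exact Cw|]. split; [exact Cv|]. split; [|split; [|split]].
  - intros t Ht. rewrite !sol_v_hist by assumption. split; left; apply hist_pos, Hu.
  - intros t x Ht Hx. destruct (Dw t x Ht Hx) as [-> ->]. destruct (Dv t x Ht Hx) as [-> ->].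
    split.
    (* With q = hist u (t + x / c), the transport equation reduces to kap + q (kap - 1) / c = 0,
       which characterizes kap = q / (c + q). *)
    + rewrite sol_v_hist by assumption. unfold sol_w1, sol_w2, kap.
      pose proof (hist_pos u Hu (t + x / c)). pose proof (rho_pos u Hu (foot u t x)). field. lra.
    + unfold sol_v1, sol_v2. field. lra.
  - intros t Ht. split.
    + rewrite sol_w_wsol, sol_v_hist by assumption. unfold wsol.
      rewrite (foot_eq u Hu t 0 t) by (rewrite charac_t0; apply foot_charac_Sig; assumption).
      rewrite datum_pos by assumption. replace (t + 0 / c) with t by (field; lra). ring.
    + destruct (Dv t 1 Ht H01) as [-> _]. rewrite sol_v_hist, sol_w_wsol by assumption.
      replace (t + 1 / c) with (t + / c) by (field; lra). rewrite hist_hi by (assumption || lra).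
      unfold sol_v1. replace (t + 1 / c) with (t + / c) by (field; lra).
      unfold dvline. rewrite Rmin_left, Rmax_right, c_inv_c by lra. rewrite du_0.
      replace (t + / c - / c) with t by ring. unfold du. rewrite Hfix by exact Ht.
      unfold Gw. rewrite Rmax_right by exact Ht. ring.
  - intros x Hx. pose proof (div_c_bounds x Hx). split.
    + rewrite sol_w_wsol by (assumption || lra). unfold wsol.
      rewrite (foot_eq u Hu 0 x (- / phi 0 * x)) by (apply foot_charac_neg; assumption).
      rewrite datum_neg by (assumption || nra).
      replace (- phi 0 * (- / phi 0 * x)) with x by (field; lra). rewrite clamp_id by lra. ring.
    + rewrite sol_v_hist by (assumption || lra). rewrite hist_lo by (assumption || lra).
      replace (c * (0 + x / c)) with x by (field; lra). rewrite clamp_id by lra. ring.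
Qed.

End ClassicalSolution.


(** * A priori bounds *)

Section Bounds.
Variables (u : R -> R) (t A Th : R).
Hypotheses (Hu : admissible u) (Hfix : forall s, 0 <= s -> duhamel u s = u s) (Ht : 0 <= t).
Hypotheses (HA : forall s v, 0 <= s <= t -> 0 <= v <= M -> Rabs (a s v) <= A)
  (HTh : forall x, 0 <= x <= 1 -> Rabs (theta x) <= Th).

Lemma wsol_bound s x : 0 <= s <= t -> 0 <= x <= 1 -> Rabs (wsol u s x) <= Rmax A Th.
Proof.
  intros Hs Hx. destruct (foot_spec u Hu s x ltac:(lra) Hx) as [Hz _]. unfold wsol.
  destruct (Rle_dec 0 (foot u s x)) as [H|H].
  - rewrite datum_pos by assumption. eapply Rle_trans; [|apply Rmax_l]. apply HA; [lra|].
    pose proof (hist_pos u Hu (foot u s x)). pose proof (hist_le u Hu (foot u s x)). lra.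
  - rewrite datum_neg by (assumption || lra). eapply Rle_trans; [|apply Rmax_r].
    apply HTh, clamp_in. lra.
Qed.

(** On s <= 1 / c the value is one of [phi]. Beyond, it is the fixed point at a time at most [t], a
    mean of [phi 1] and of values of [g] at times up to [t]; these are at least g(0, w), with |w|
    controlled by [wsol_bound] on [0, t]. *)
Lemma hist_lower k x : 0 <= x <= 1 -> (forall y, 0 <= y <= 1 -> k <= phi y) ->
  (forall om, Rabs om <= Rmax A Th -> k <= g 0 om) -> k <= hist u (t + x / c).
Proof.
  intros Hx Hk1 Hk2. pose proof (div_c_bounds x Hx).
  destruct (Rle_dec (t + x / c) (/ c)) as [H1|H1].
  - rewrite hist_lo by assumption. apply Hk1, clamp_in. lra.
  - rewrite hist_hi by (assumption || lra). rewrite <- Hfix by lra.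
    apply duhamel_ge; [exact Hu|lra|apply Hk1; lra|].
    intros s Hs. unfold Gw. rewrite Rmax_right by lra.
    pose proof (u_pos u Hu s ltac:(lra)).
    destruct (Hgb (u s) (wsol u s 1) ltac:(lra)) as [_ [Hg1 _]].
    eapply Rle_trans; [|exact Hg1]. apply Hk2, wsol_bound; lra.
Qed.

End Bounds.

(** * Uniqueness *)

Section AnySolution.
Variables (w v : R -> R -> R).
Hypothesis Hsol : is_solution a g c mu theta phi w v.

Definition outflow (t : R) : R := v t 1.

Lemma outflow_derive t : 0 < t ->
  is_derive outflow t (- mu * outflow t + mu * g (outflow t) (w t 1)).
Proof.
  intros Ht. destruct Hsol as [_ [Cv [_ [_ [Hb _]]]]].
  eapply is_derive_eq.
  - apply (Ck_1_derive1 strip v (t / 2) (t + 1) t 1 Cv); [|lra].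
    intros s Hs. split; simpl; lra.
  - destruct (Hb t ltac:(lra)) as [_ E]. unfold outflow. lra.
Qed.

Lemma outflow_continuous T : 0 <= T -> forall s, continuous (fun s => outflow (clamp 0 T s)) s.
Proof.
  intros HT. destruct Hsol as [_ [[Cv _] _]].
  apply (continuous_on_curve strip v (fun s => s) (fun _ => 1) 0 T HT Cv).
  - intros s Hs. split; simpl; lra.
  - intros s. apply continuous_id.
  - intros s. apply continuous_const.
Qed.

Lemma outflow_0 : outflow 0 = phi 1.
Proof.
  destruct Hsol as [_ [_ [_ [_ [_ Hi]]]]]. destruct (Hi 1 ltac:(lra)) as [_ E]. unfold outflow. lra.
Qed.

Lemma outflow_ge0 t : 0 <= t -> 0 <= outflow t.
Proof. intros Ht. destruct Hsol as [_ [_ [H _]]]. apply (H t Ht). Qed.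

Lemma outflow_g_bounds t : 0 <= t -> 0 < g (outflow t) (w t 1) <= M.
Proof.
  intros Ht. destruct (Hgb (outflow t) (w t 1) (outflow_ge0 t Ht)) as [H1 [H2 H3]]. lra.
Qed.

Lemma exp_outflow_derive t : 0 < t ->
  is_derive (fun s => exp (mu * s) * outflow s) t (mu * exp (mu * t) * g (outflow t) (w t 1)).
Proof.
  intros Ht. eapply is_derive_eq.
  - apply (is_derive_R_mult (fun s => exp (mu * s)) outflow); [apply is_derive_exp_scal|].
    apply outflow_derive, Ht.
  - ring.
Qed.

Lemma exp_outflow_continuous T : 0 <= T ->
  forall s, continuous (fun s => exp (mu * clamp 0 T s) * outflow (clamp 0 T s)) s.
Proof.
  intros HT s. apply (continuous_mult (fun s => exp (mu * clamp 0 T s)) (fun s => outflow (clamp 0 T s))).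
  - apply (continuous_comp (clamp 0 T) (fun s => exp (mu * s))); [apply continuous_clamp|].
    apply (ex_derive_continuous (fun s => exp (mu * s))). eexists. apply is_derive_exp_scal.
  - apply outflow_continuous, HT.
Qed.

(** The integrating factor e^(mu s) absorbs the damping: e^(mu s) v(s, 1) is nondecreasing because g
    > 0, and e^(mu s) (v(s, 1) - M) is nonincreasing because g <= M. *)
Lemma outflow_bounds t : 0 <= t -> phi 1 * exp (- mu * t) <= outflow t <= M.
Proof.
  intros Ht. pose proof phi_01 as [_ P1].
  assert (E : outflow t = exp (- mu * t) * (outflow t * exp (mu * t))) by (rewrite exp_mu_cancel; reflexivity).
  split.
  - rewrite E, Rmult_comm. apply Rmult_le_compat_l; [left; apply exp_pos|].
    pose proof (nonincreasing_clamp (fun s => - (exp (mu * s) * outflow s))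
      (fun s => 0 - mu * exp (mu * s) * g (outflow s) (w s 1)) t) as H.
    simpl in H. rewrite Rmult_0_r, exp_0, outflow_0 in H.
    enough (- (exp (mu * t) * outflow t) <= - (1 * phi 1)) by lra.
    apply H; [|exact Ht| |].
    + intros x. apply (continuous_opp (fun s => exp (mu * clamp 0 t s) * outflow (clamp 0 t s))).
      apply exp_outflow_continuous, Ht.
    + intros x Hx. apply is_derive_ext with (fun s => 0 - exp (mu * s) * outflow s).
      * intros s. apply Rminus_0_l.
      * apply is_derive_R_minus; [apply is_derive_R_const|]. apply exp_outflow_derive. lra.
    + intros x Hx. pose proof (outflow_g_bounds x ltac:(lra)). pose proof (exp_pos (mu * x)).
      assert (0 <= mu * exp (mu * x) * g (outflow x) (w x 1)) by (repeat apply Rmult_le_pos; lra). lra.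
  - rewrite E, <- (exp_mu_cancel t M). apply Rmult_le_compat_l; [left; apply exp_pos|].
    pose proof (nonincreasing_clamp (fun s => exp (mu * s) * outflow s - M * exp (mu * s))
      (fun s => mu * exp (mu * s) * g (outflow s) (w s 1) - (0 * exp (mu * s) + M * (mu * exp (mu * s)))) t) as H.
    simpl in H. rewrite Rmult_0_r, exp_0, outflow_0 in H.
    enough (exp (mu * t) * outflow t - M * exp (mu * t) <= 1 * phi 1 - M * 1) by lra.
    apply H; [|exact Ht| |].
    + intros x. apply (continuous_minus (fun s => exp (mu * clamp 0 t s) * outflow (clamp 0 t s))
        (fun s => M * exp (mu * clamp 0 t s))); [apply exp_outflow_continuous, Ht|].
      apply (continuous_mult (fun _ => M) (fun s => exp (mu * clamp 0 t s))); [apply continuous_const|].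
      apply (continuous_comp (clamp 0 t) (fun s => exp (mu * s))); [apply continuous_clamp|].
      apply (ex_derive_continuous (fun s => exp (mu * s))). eexists. apply is_derive_exp_scal.
    + intros x Hx. apply is_derive_R_minus; [apply exp_outflow_derive; lra|].
      apply (is_derive_R_mult (fun _ => M) (fun t => exp (mu * t))); [apply is_derive_R_const|apply is_derive_exp_scal].
    + intros x Hx. pose proof (outflow_g_bounds x ltac:(lra)). pose proof (exp_pos (mu * x)).
      assert (0 <= mu * exp (mu * x)) by (apply Rmult_le_pos; lra). nra.
Qed.

(** Places the boundary value of an arbitrary solution in the class where fixed points are unique.
    The sign condition on [v t 1] contained in [is_solution] is what gives access to the bounds on
    [g]. *)
Lemma outflow_admissible : admissible outflow.
Proof.
  split; [apply outflow_0|]. split; [apply outflow_bounds|].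
  assert (W : forall s t, 0 <= s -> s < t -> Rabs (outflow t - outflow s) <= mu * M * Rabs (t - s)).
  { intros s t Hs Hst. pose proof (clamp_in s t) as HC.
    destruct (MVT_clamp outflow (fun t => - mu * outflow t + mu * g (outflow t) (w t 1)) s t Hst)
      as [z [Hz E]].
    - intros x. apply (continuous_ext (fun y => outflow (clamp 0 t (clamp s t y)))).
      + intros y. rewrite (clamp_id 0 t); [reflexivity|]. specialize (HC y). lra.
      + apply (continuous_comp (clamp s t) (fun y => outflow (clamp 0 t y))); [apply continuous_clamp|].
        apply outflow_continuous. lra.
    - intros x Hx. apply outflow_derive. lra.
    - rewrite E, Rabs_mult. apply Rmult_le_compat_r; [apply Rabs_pos|].
      pose proof (outflow_ge0 z ltac:(lra)). pose proof (outflow_bounds z ltac:(lra)).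
      pose proof (outflow_g_bounds z ltac:(lra)). apply Rabs_le.
      assert (0 <= mu * outflow z) by (apply Rmult_le_pos; lra).
      assert (0 <= mu * g (outflow z) (w z 1)) by (apply Rmult_le_pos; lra).
      assert (mu * outflow z <= mu * M) by (apply Rmult_le_compat_l; lra).
      assert (mu * g (outflow z) (w z 1) <= mu * M) by (apply Rmult_le_compat_l; lra). lra. }
  intros s t Hs Ht. apply (Lip_of_lt outflow (mu * M) 0 (Rmax s t)).
  - intros x y Hx _ Hxy. apply W; lra.
  - split; [exact Hs|apply Rmax_l].
  - split; [exact Ht|apply Rmax_r].
Qed.

Lemma solution_v t x : 0 <= t -> 0 <= x <= 1 -> v t x = hist outflow (t + x / c).
Proof.
  intros Ht Hx. pose proof (Rinv_0_lt_compat _ Hc) as Ic. pose proof (div_c_bounds x Hx) as Hxc.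
  pose proof Hsol as [_ [Cv [_ [Hpde [_ Hi]]]]].
  (* [s0] is the time at which the line t + x / c = sg enters the strip, through t = 0 or through x
     = 1. *)
  set (sg := t + x / c). set (s0 := Rmax 0 (sg - / c)).
  assert (Hcs : c * sg = c * t + x) by (unfold sg; field; lra).
  assert (cI : c * / c = 1) by (field; lra).
  assert (Hs0 : 0 <= s0 <= t) by (split; [apply Rmax_l|apply Rmax_lub; unfold sg; lra]).
  assert (Hs0' : sg - / c <= s0) by apply Rmax_r.
  assert (E : v t (- c * t + c * sg) = v s0 (- c * s0 + c * sg)).
  { apply (strip_curve_const v (fun s => s) (fun s => - c * s + c * sg) (fun _ => 1) (fun _ => - c) s0 t).
    - lra.
    - exact Cv.
    - intros s Hs. split; simpl; [lra|].
      split; [nra|]. assert (c * (sg - / c) <= c * s) by (apply Rmult_le_compat_l; lra). lra.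
    - intros s. apply is_derive_R_id.
    - intros s. apply is_derive_R_affine.
    - intros s Hs. split; [lra|]. split; [nra|].
      assert (c * (sg - / c) < c * s) by (apply Rmult_lt_compat_l; lra). lra.
    - intros s Hs. destruct (Hpde s (- c * s + c * sg)) as [_ E]; [lra| |lra].
      split; [nra|]. assert (c * (sg - / c) <= c * s) by (apply Rmult_le_compat_l; lra). lra. }
  replace (- c * t + c * sg) with x in E by lra. rewrite E.
  destruct (Rle_dec sg (/ c)) as [H|H].
  - rewrite hist_lo by (apply outflow_admissible || exact H).
    unfold s0. rewrite Rmax_left by lra.
    assert (c * sg <= 1) by (rewrite <- cI; apply Rmult_le_compat_l; lra).
    assert (0 <= c * sg) by (rewrite Hcs; nra).
    rewrite clamp_id by lra. replace (- c * 0 + c * sg) with (c * sg) by ring.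
    destruct (Hi (c * sg) ltac:(lra)) as [_ E']. lra.
  - rewrite hist_hi by (apply outflow_admissible || lra).
    unfold s0. rewrite Rmax_right by lra. unfold outflow. f_equal.
    replace (- c * (sg - / c) + c * sg) with (c * / c) by ring. exact cI.
Qed.

Lemma solution_w t x : 0 <= t -> 0 <= x <= 1 -> w t x = wsol outflow t x.
Proof.
  intros Ht Hx. pose proof outflow_admissible as Hu. pose proof phi_01 as [P0 _].
  pose proof (Rinv_0_lt_compat _ Hc) as Ic.
  assert (I0 : 0 < / phi 0) by (apply Rinv_0_lt_compat; lra).
  assert (I1 : phi 0 * / phi 0 = 1) by (field; lra).
  pose proof Hsol as [Cw [_ [_ [Hpde [Hb Hi]]]]].
  destruct (foot_spec outflow Hu t x Ht Hx) as [Hz Ez]. unfold wsol. set (z := foot outflow t x) in *.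
  set (lev := charac outflow t x) in *.
  (* The characteristic through (t, x), parametrized by s = X + Y / c: its level is [lev], so that Y
     / c must be [Sig outflow s - lev]. Both coordinates increase with [s]. *)
  set (X := fun s => s - (Sig outflow s - lev)). set (Y := fun s => c * (Sig outflow s - lev)).
  assert (dX : forall s, is_derive X s (1 - (kap outflow s - 0))).
  { intros s. apply is_derive_R_minus; [apply is_derive_R_id|].
    apply is_derive_R_minus; [apply Sig_derive, Hu|apply is_derive_R_const]. }
  assert (dY : forall s, is_derive Y s (0 * (Sig outflow s - lev) + c * (kap outflow s - 0))).
  { intros s. apply (is_derive_R_mult (fun _ => c) (fun s => Sig outflow s - lev)); [apply is_derive_R_const|].
    apply is_derive_R_minus; [apply Sig_derive, Hu|apply is_derive_R_const]. }
  pose proof (kap_bounds outflow Hu) as Hk.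
  assert (XI : forall s s', s < s' -> X s < X s').
  { apply (is_derive_increasing X _ dX). intros s. specialize (Hk s). lra. }
  assert (YI : forall s s', s < s' -> Y s < Y s').
  { apply (is_derive_increasing Y _ dY). intros s. specialize (Hk s).
    assert (0 < c * kap outflow s) by (apply Rmult_lt_0_compat; lra). lra. }
  assert (XM : forall s s', s <= s' -> X s <= X s').
  { intros s s' H. destruct (Req_dec s s') as [->|N]; [lra|]. left. apply XI. lra. }
  assert (YM : forall s s', s <= s' -> Y s <= Y s').
  { intros s s' H. destruct (Req_dec s s') as [->|N]; [lra|]. left. apply YI. lra. }
  assert (X1 : X (t + x / c) = t) by (unfold X, lev, charac; ring).
  assert (Y1 : Y (t + x / c) = x) by (unfold Y, lev, charac; field; lra).
  (* A point of the characteristic lying on t = 0 or x = 0 must precede (t, x), since after (t, x)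
     both coordinates are positive; [w] is then transported from it. *)
  assert (Hfoot : forall s0, 0 <= X s0 -> 0 <= Y s0 -> X s0 = 0 \/ Y s0 = 0 -> w t x = w (X s0) (Y s0)).
  { intros s0 HX0 HY0 Hor.
    assert (Hs : s0 <= t + x / c).
    { destruct (Rle_dec s0 (t + x / c)) as [H|H]; [exact H|exfalso].
      pose proof (XI (t + x / c) s0 ltac:(lra)). pose proof (YI (t + x / c) s0 ltac:(lra)). lra. }
    transitivity (w (X (t + x / c)) (Y (t + x / c))); [rewrite X1, Y1; reflexivity|].
    apply (strip_curve_const w X Y (fun s => 1 - (kap outflow s - 0))
      (fun s => 0 * (Sig outflow s - lev) + c * (kap outflow s - 0)) s0 (t + x / c) Hs Cw).
    - intros s Hs'. pose proof (XM s0 s ltac:(lra)). pose proof (YM s0 s ltac:(lra)).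
      pose proof (YM s (t + x / c) ltac:(lra)). split; simpl; lra.
    - exact dX.
    - exact dY.
    - intros s Hs'. pose proof (XI s0 s ltac:(lra)). pose proof (YI s0 s ltac:(lra)).
      pose proof (YI s (t + x / c) ltac:(lra)). lra.
    - intros s Hs'. pose proof (XI s0 s ltac:(lra)). pose proof (YI s0 s ltac:(lra)).
      pose proof (YI s (t + x / c) ltac:(lra)).
      (* With q = hist outflow s, the velocity of the curve is (c / (c + q), c q / (c + q)), whose
         slope q is the value of [v] at this point. *)
      destruct (Hpde (X s) (Y s) ltac:(lra) ltac:(lra)) as [E _].
      rewrite (solution_v (X s) (Y s)) in E by lra.
      replace (X s + Y s / c) with s in E by (unfold X, Y; field; lra).
      assert (E' : partial1 strip w (X s) (Y s) = - hist outflow s * partial2 strip w (X s) (Y s)) by lra.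
      rewrite E'. unfold kap. pose proof (hist_pos outflow Hu s). field. lra. }
  (* A nonnegative [z] means entry through (z, 0), at parameter [z]; a negative one means a start at
     (0, y) with y = - phi 0 z, at parameter [y / c]. *)
  destruct (Rle_dec 0 z) as [H|H].
  - rewrite datum_pos by assumption.
    assert (EL : lev = Sig outflow z) by (rewrite <- Ez; apply foot_charac_Sig; assumption).
    assert (Xz : X z = z) by (unfold X; rewrite EL; ring).
    assert (Yz : Y z = 0) by (unfold Y; rewrite EL; ring).
    rewrite (Hfoot z) by (rewrite ?Xz, ?Yz; lra || (right; reflexivity)). rewrite Xz, Yz.
    destruct (Hb z H) as [E _]. rewrite (solution_v z 0) in E by lra.
    replace (z + 0 / c) with z in E by (field; lra). lra.
  - rewrite datum_neg by (assumption || lra).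
    set (y := - phi 0 * z). assert (Hy : 0 <= y <= 1) by (unfold y; nra).
    assert (EL : lev = Sig outflow (y / c) - y / c).
    { rewrite <- Ez. replace z with (- / phi 0 * y) by (unfold y; field; lra).
      rewrite foot_charac_neg by assumption. unfold charac. rewrite Rplus_0_l. reflexivity. }
    assert (Xy : X (y / c) = 0) by (unfold X; rewrite EL; ring).
    assert (Yy : Y (y / c) = y) by (unfold Y; rewrite EL; field; lra).
    rewrite (Hfoot (y / c)) by (rewrite ?Xy, ?Yy; lra || (left; reflexivity)). rewrite Xy, Yy, clamp_id by exact Hy.
    destruct (Hi y Hy) as [E _]. lra.
Qed.

(** Variation of constants: e^(mu t) v(t, 1) and the integral in [duhamel] have the same derivative
    once [solution_w] has identified [w t 1] as a function of the boundary value. *)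
Lemma outflow_fixed t : 0 <= t -> duhamel outflow t = outflow t.
Proof.
  intros Ht. pose proof outflow_admissible as Hu.
  set (acc := fun t => phi 1 + RInt (fun s => mu * exp (mu * s) * Gw outflow s) 0 t).
  assert (E : exp (mu * t) * outflow t - acc t = exp (mu * 0) * outflow 0 - acc 0).
  { apply (derive_0_const (fun t => exp (mu * t) * outflow t - acc t) 0 t Ht).
    - intros x. apply (continuous_minus (fun s => exp (mu * clamp 0 t s) * outflow (clamp 0 t s))
        (fun s => acc (clamp 0 t s))); [apply exp_outflow_continuous, Ht|].
      apply (continuous_comp (clamp 0 t) acc); [apply continuous_clamp|].
      apply (ex_derive_continuous acc). eexists. apply (duhamel_acc_derive outflow Hu).
    - intros x Hx. eapply is_derive_eq.
      + apply is_derive_R_minus; [apply exp_outflow_derive; lra|apply (duhamel_acc_derive outflow Hu)].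
      + unfold Gw. rewrite Rmax_right by lra. rewrite <- solution_w by lra. ring. }
  unfold acc at 2 in E. rewrite duhamel_acc_0, Rmult_0_r, exp_0, outflow_0 in E.
  unfold duhamel. fold (acc t). replace (acc t) with (outflow t * exp (mu * t)) by lra.
  apply exp_mu_cancel.
Qed.

End AnySolution.

Lemma hist_ext u1 u2 s : (forall t, 0 <= t -> u1 t = u2 t) -> hist u1 s = hist u2 s.
Proof. intros E. unfold hist. rewrite E by apply Rmax_l. reflexivity. Qed.

(** Two fixed points are known to agree at nonnegative times only. Equality passes to [wsol] because
    [hist] never samples its argument at negative times. *)
Lemma wsol_ext u1 u2 : (forall t, 0 <= t -> u1 t = u2 t) -> forall t x, admissible u1 -> admissible u2 ->
  0 <= t -> 0 <= x <= 1 -> wsol u1 t x = wsol u2 t x.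
Proof.
  intros E t x H1 H2 Ht Hx.
  assert (EF : forall z, foot_charac u1 z = foot_charac u2 z).
  { intros z. apply RInt_ext. intros s _. unfold rho. rewrite (hist_ext u1 u2 s E). reflexivity. }
  assert (ES : forall s, Sig u1 s = Sig u2 s).
  { intros z. apply RInt_ext. intros s _. unfold kap. rewrite (hist_ext u1 u2 s E). reflexivity. }
  assert (Efoot : foot u1 t x = foot u2 t x).
  { apply foot_eq; [exact H1|]. rewrite EF. destruct (foot_spec u2 H2 t x Ht Hx) as [_ ->].
    unfold charac. rewrite ES. reflexivity. }
  unfold wsol, datum. rewrite Efoot, (hist_ext u1 u2 _ E). reflexivity.
Qed.

Lemma solution_unique w v w' v' t x :
  is_solution a g c mu theta phi w v -> is_solution a g c mu theta phi w' v' ->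
  0 <= t -> 0 <= x <= 1 -> w' t x = w t x /\ v' t x = v t x.
Proof.
  intros H H' Ht Hx.
  assert (E : forall t, 0 <= t -> outflow v' t = outflow v t).
  { apply boundary_value_exists_unique.
    - apply (outflow_admissible w' v' H').
    - apply (outflow_admissible w v H).
    - apply (outflow_fixed w' v' H').
    - apply (outflow_fixed w v H). }
  rewrite (solution_v w v H), (solution_v w' v' H'), (solution_w w v H), (solution_w w' v' H') by assumption.
  split; [|apply hist_ext, E].
  apply (wsol_ext _ _ E t x); auto; [apply (outflow_admissible w' v' H')|apply (outflow_admissible w v H)].
Qed.

End Characteristics.

(** * Extrema and suprema of the data *)

Lemma set_max_eq E m : is_max E m -> set_max E = m.
Proof.
  intros H. apply iota_R_eq; [|exact H]. intros y [Hy Hy']. destruct H as [Hm Hm'].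
  apply Rle_antisym; auto.
Qed.

Lemma set_min_eq E m : is_min E m -> set_min E = m.
Proof.
  intros H. apply iota_R_eq; [|exact H]. intros y [Hy Hy']. destruct H as [Hm Hm'].
  apply Rle_antisym; auto.
Qed.

Lemma max01_spec f : (forall x, continuous (fun y => f (clamp 0 1 y)) x) ->
  is_max (fun y => exists x, unit_itv x /\ y = f x) (max01 f).
Proof.
  intros Hf. destruct (continuity_ab_maj (fun y => f (clamp 0 1 y)) 0 1 Rle_0_1) as [m [H1 H2]].
  { intros x _. apply continuity_pt_filterlim, Hf. }
  assert (H : is_max (fun y => exists x, unit_itv x /\ y = f x) (f m)).
  { split; [exists m; auto|]. intros y [x [Hx ->]]. specialize (H1 x Hx). simpl in H1.
    rewrite !clamp_id in H1 by (exact Hx || lra). exact H1. }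
  unfold max01. rewrite (set_max_eq _ _ H). exact H.
Qed.

Lemma min01_spec f : (forall x, continuous (fun y => f (clamp 0 1 y)) x) ->
  is_min (fun y => exists x, unit_itv x /\ y = f x) (min01 f).
Proof.
  intros Hf. destruct (continuity_ab_min (fun y => f (clamp 0 1 y)) 0 1 Rle_0_1) as [m [H1 H2]].
  { intros x _. apply continuity_pt_filterlim, Hf. }
  assert (H : is_min (fun y => exists x, unit_itv x /\ y = f x) (f m)).
  { split; [exists m; auto|]. intros y [x [Hx ->]]. specialize (H1 x Hx). simpl in H1.
    rewrite !clamp_id in H1 by (exact Hx || lra). exact H1. }
  unfold min01. rewrite (set_min_eq _ _ H). exact H.
Qed.

(** [B_bound] is an [iota], meaningful only if the maximum is attained; compactness of the rectangle
    supplies the maximizer. *)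
Lemma B_bound_spec a phi vmax t s v : continuous_on dom_a (uncurry2 a) ->
  0 <= Rmax (max01 phi) vmax -> 0 <= s <= t -> 0 <= v <= Rmax (max01 phi) vmax ->
  Rabs (a s v) <= B_bound a phi vmax t.
Proof.
  intros Ha HM Hs Hv.
  destruct (continuous_on_rect_max dom_a (fun s v => Rabs (a s v)) 0 t 0 (Rmax (max01 phi) vmax))
    as [s0 [v0 [Hs0 [Hv0 H]]]].
  - lra.
  - exact HM.
  - intros p [P1 P2]. unfold dom_a. lra.
  - apply continuous_on_comp_R; [|exact Ha]. intros x. apply continuous_Rabs.
  - unfold B_bound. rewrite (set_max_eq _ (Rabs (a s0 v0))); [apply H; assumption|].
    split; [exists s0, v0; auto|]. intros y [s' [v' [Hs' [Hv' ->]]]]. apply H; assumption.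
Qed.

Lemma g0_min_spec g W om : continuous_on dom_g (uncurry2 g) -> Rabs om <= W ->
  set_min (fun y => exists om, Rabs om <= W /\ y = g 0 om) <= g 0 om.
Proof.
  intros Hg Hom. pose proof (Rabs_pos om).
  (* The minimum of [g 0] is a maximum of [- g] over the degenerate rectangle [0, 0] x [- W, W]. *)
  destruct (continuous_on_rect_max dom_g (fun v w => - g v w) 0 0 (- W) W)
    as [x0 [om0 [Hx0 [Hom0 H']]]].
  - lra.
  - lra.
  - intros p [P1 P2]. unfold dom_g. lra.
  - apply continuous_on_comp_R; [|exact Hg]. intros x. apply (continuous_opp (fun x : R => x)), continuous_id.
  - replace x0 with 0 in H' by lra.
    assert (HH : forall om, Rabs om <= W -> g 0 om0 <= g 0 om).
    { intros om' Hom'. apply Rabs_le_between in Hom'. specialize (H' 0 om' ltac:(lra) Hom'). lra. }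
    rewrite (set_min_eq _ (g 0 om0)); [apply HH, Hom|].
    split; [exists om0; split; [apply Rabs_le; lra|reflexivity]|].
    intros y [om' [Hom' ->]]. apply HH, Hom'.
Qed.

Lemma sup_norm_spec f B : (forall x, unit_itv x -> Rabs (f x) <= B) ->
  (forall x, unit_itv x -> Rabs (f x) <= sup_norm f) /\ sup_norm f <= B.
Proof.
  intros H. unfold sup_norm.
  destruct (Lub_Rbar_correct (fun y => exists x, unit_itv x /\ y = Rabs (f x))) as [H1 H2].
  destruct (Lub_Rbar _) as [l| |].
  - split.
    + intros x Hx. apply (H1 (Rabs (f x))). exists x. auto.
    + apply (H2 B). intros y [x [Hx ->]]. apply H, Hx.
  (* The least upper bound is finite: the bound [B] excludes plus infinity, and the value at 0
     excludes minus infinity. *)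
  - destruct (H2 B). intros y [x [Hx ->]]. apply H, Hx.
  - destruct (H1 (Rabs (f 0))). exists 0. unfold unit_itv. split; [lra|reflexivity].
Qed.

Lemma extension_clamp_Lip (F dF f : R -> R) : (forall x, is_derive F x (dF x)) ->
  (exists L, forall x y, Rabs (dF x - dF y) <= L * Rabs (x - y)) ->
  (forall x, 0 <= x <= 1 -> F x = f x) ->
  exists L, forall x y, Rabs (f (clamp 0 1 x) - f (clamp 0 1 y)) <= L * Rabs (x - y).
Proof.
  intros Hd [L HL] E.
  destruct (C1_locBL F dF Hd (locBL_continuous _ (locBL_Lip _ L HL)) 0 1) as [B [HB H]].
  exists B. intros x y. pose proof (clamp_in 0 1 x Rle_0_1) as Hx. pose proof (clamp_in 0 1 y Rle_0_1) as Hy.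
  rewrite <- !E by assumption. destruct (H _ Hx) as [_ H']. eapply Rle_trans; [apply (H' _ Hy)|].
  apply Rmult_le_compat_l; [exact HB|apply clamp_lip].
Qed.

Theorem theorem2p1 :
  forall (a : R -> R -> R) (c mu : R) (g : R -> R -> R) (vmax : R)
         (theta phi : R -> R),
    Ck 2 dom_a a ->
    0 < c ->
    0 <= mu ->
    Ck 1 dom_g g ->
    0 < vmax ->
    (forall v w, 0 <= v -> 0 < g 0 w /\ g 0 w <= g v w /\ g v w <= vmax) ->
    W2inf theta ->
    W2inf phi ->
    (forall x, 0 <= x <= 1 -> 0 < phi x) ->
    theta 0 = a 0 (phi 0) ->
    partial1 dom_a a 0 (phi 0)
      + c * partial2 dom_a a 0 (phi 0) * Derive_on unit_itv phi 0
      = - phi 0 * Derive_on unit_itv theta 0 ->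
    Derive_on unit_itv phi 1 = - mu * / c * (phi 1 - g (phi 1) (theta 1)) ->
    exists w v : R -> R -> R,
      is_solution a g c mu theta phi w v /\
      (forall w' v' : R -> R -> R,
         is_solution a g c mu theta phi w' v' ->
         forall t x, 0 <= t -> 0 <= x <= 1 -> w' t x = w t x /\ v' t x = v t x) /\
      (forall S : R * R -> Prop,
         compact_set S -> (forall p, S p -> strip p) ->
         lipschitz_on S (uncurry2 (partial1 strip w)) /\
         lipschitz_on S (uncurry2 (partial2 strip w)) /\
         lipschitz_on S (uncurry2 (partial1 strip v)) /\
         lipschitz_on S (uncurry2 (partial2 strip v))) /\
      (forall t x, 0 <= t -> 0 <= x <= 1 ->
         sup_norm (w t) <= Rmax (B_bound a phi vmax t) (sup_norm theta) /\
         Rmin (min01 phi)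
              (set_min (fun y => exists om,
                 Rabs om <= Rmax (B_bound a phi vmax t) (sup_norm theta) /\
                 y = g 0 om))
           <= v t x /\
         v t x <= Rmax (max01 phi) vmax).
Proof.
  intros a c mu g vmax theta phi Ha2 Hc Hmu Hg Hvm Hgb Htheta Hphi Hpos Hc0 Hc1 Hc2.
  destruct (W2inf_extend phi Hphi) as [phie [dphie [Dphi [Lphi' Ephi]]]].
  destruct (W2inf_extend theta Htheta) as [thetae [dthetae [Dtheta [Ltheta' Etheta]]]].
  destruct (extension_clamp_Lip phie dphie phi Dphi Lphi' (fun x Hx => proj1 (Ephi x Hx))) as [Lphi Hphil].
  destruct (extension_clamp_Lip thetae dthetae theta Dtheta Ltheta' (fun x Hx => proj1 (Etheta x Hx)))
    as [Ltheta Hthetal].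
  destruct Lphi' as [Lp HLp]. destruct Ltheta' as [Lt HLt].
  assert (H00 : 0 <= 0 <= 1) by lra. assert (H01 : 0 <= 1 <= 1) by lra.
  (* The compatibility conditions are restated for the C^1 extensions, whose derivatives at 0 and 1
     are the one-sided derivatives of the data. *)
  rewrite <- (proj2 (Ephi 0 H00)), <- (proj2 (Etheta 0 H00)) in Hc1.
  rewrite <- (proj2 (Ephi 1 H01)) in Hc2.
  assert (Ha : Ck 1 dom_a a).
  { destruct Ha2 as [A1 [A2 [[A3 _] [A4 _]]]]. repeat split; auto; apply A2; assumption. }
  pose proof (locBL_continuous _ (locBL_Lip _ Lphi Hphil)) as Cphi.
  pose proof (locBL_continuous _ (locBL_Lip _ Ltheta Hthetal)) as Ctheta.
  destruct (min01_spec phi Cphi) as [[xm [Hxm Em]] Hmin]. destruct (max01_spec phi Cphi) as [_ Hmax].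
  (* [m0] is positive because the minimum of [phi] is attained; [M] is the upper bound claimed for
     [v], and also the range of the second argument of [a] in [B_bound]. *)
  set (m0 := min01 phi) in *. set (M := Rmax (max01 phi) vmax).
  assert (Hm0 : 0 < m0) by (rewrite Em; apply Hpos, Hxm).
  assert (HM : vmax <= M) by apply Rmax_r.
  assert (Hphib : forall x, 0 <= x <= 1 -> m0 <= phi x <= M).
  { intros x Hx. split; [apply Hmin; exists x; auto|].
    apply Rle_trans with (max01 phi); [apply Hmax; exists x; auto|apply Rmax_l]. }
  destruct (boundary_value_exists_unique a g c mu vmax theta phi m0 M Lphi Ltheta) as [[u [Hu Hfix]] _];
    try assumption.
  pose proof (Hphib 0 H00) as P0.
  assert (Ca : continuous_on dom_a (uncurry2 a)) by apply Ha.
  assert (Cg : continuous_on dom_g (uncurry2 g)) by apply Hg.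
  assert (Hth : forall x, 0 <= x <= 1 -> Rabs (theta x) <= sup_norm theta).
  { destruct (locBL_Lip _ Ltheta Hthetal 0 1) as [B [_ HB]].
    apply (sup_norm_spec theta B). intros x Hx. destruct (HB x Hx) as [HB' _].
    rewrite clamp_id in HB' by exact Hx. exact HB'. }
  pose proof (fun x Hx => proj1 (Ephi x Hx)) as Ephi1.
  pose proof (fun x Hx => proj1 (Etheta x Hx)) as Etheta1.
  assert (Hsol : is_solution a g c mu theta phi (sol_w a c phi u thetae) (sol_v a g c mu theta phi u phie)).
  { exact (sol_is_solution a g c mu theta phi m0 M Lphi Ltheta Ha Hg Hc Hmu Hm0 Hphib Hphil Hthetal
      Hc0 u phie dphie thetae dthetae Lp Lt Hu Hfix Ha2 Dphi HLp Ephi1 Dtheta HLt Etheta1 Hc1 Hc2). }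
  exists (sol_w a c phi u thetae), (sol_v a g c mu theta phi u phie).
  split; [exact Hsol|]. split; [|split].
  - intros w' v' Hsol' t x Ht Hx.
    exact (solution_unique a g c mu vmax theta phi m0 M Lphi Ltheta Ha Hg Hc Hmu Hgb Hm0 HM Hphib
      Hphil Hthetal Hc0 _ _ _ _ t x Hsol Hsol' Ht Hx).
  - intros S HS Hst.
    destruct (sol_w_C1 a g c mu theta phi m0 M Lphi Ltheta Ha Hg Hc Hmu Hm0 Hphib Hphil Hthetal
      u phie dphie thetae dthetae Lp Lt Hu Hfix Ha2 Dphi HLp Ephi1 Dtheta HLt Hc1 Hc2) as [_ [_ Lw]].
    destruct (sol_v_C1 a g c mu theta phi m0 M Lphi Ltheta Ha Hg Hc Hmu Hm0 Hphib Hphil Hthetal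
      u phie dphie Lp Hu Dphi HLp Hc2) as [_ [_ Lv]].
    destruct (Lw S HS Hst) as [L1 L2]. destruct (Lv S HS Hst) as [L3 L4]. auto.
  - intros t x Ht Hx.
    assert (HB : forall s v, 0 <= s <= t -> 0 <= v <= M -> Rabs (a s v) <= B_bound a phi vmax t).
    { intros s v Hs Hv. apply B_bound_spec; [exact Ca|apply Rle_trans with (phi 0); [lra|exact (proj2 P0)]|exact Hs|exact Hv]. }
    split; [|split].
    + apply (sup_norm_spec (sol_w a c phi u thetae t)). intros y Hy.
      rewrite (sol_w_wsol a c mu theta phi m0 M Lphi Hc Hmu Hm0 Hphib Hphil u thetae Hu Etheta1) by assumption.
      apply (wsol_bound a c mu theta phi m0 M Lphi Hc Hmu Hm0 Hphib Hphil Hc0 u t); try assumption. lra.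
    + rewrite (sol_v_hist a g c mu theta phi Hc u phie Hfix Ephi1) by assumption.
      apply (hist_lower a g c mu vmax theta phi m0 M Lphi Ltheta Ha Hg Hc Hmu Hgb Hm0 Hphib Hphil
        Hthetal Hc0 u t (B_bound a phi vmax t) (sup_norm theta)); try assumption.
      * intros y Hy. eapply Rle_trans; [apply Rmin_l|]. apply Hphib, Hy.
      * intros om Hom. eapply Rle_trans; [apply Rmin_r|]. apply g0_min_spec; assumption.
    + rewrite (sol_v_hist a g c mu theta phi Hc u phie Hfix Ephi1) by assumption.
      exact (hist_le c mu phi m0 M Hc Hmu Hm0 Hphib u Hu _).
Qed.
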